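(* Let $k\ge1$ be an integer, $\lambda,\mu>0$, $\theta>0$, $\alpha\in(0,1)$. The mean queue length $M^{\theta,\alpha}(t)=\mathbb{E}(L^{\theta,\alpha}(t)\mid L^{\theta,\alpha}(0)=0)$ of the tempered Erlang queue solves the fractional Cauchy problem \begin{equation*} \partial_t^{\theta,\alpha}M^{\theta,\alpha}(t)=k\mu\, p_{0}^{\theta,\alpha}(t)+k(\lambda-\mu),\qquad M^{\theta,\alpha}(0)=0. \end{equation*}
   Context: Erlang queue: $\{Q(t)\}_{t\ge0}$, $Q(t)=(N(t),S(t))$, is the continuous-time Markov chain on $\{(0,0)\}\cup S$, $S=\{(n,s)\in\mathbb{N}\times\mathbb{N}: n\ge1,\ 1\le s\le k\}$ (number of customers, phase of the customer in service), started at $(0,0)$, with Poisson arrivals of rate $\lambda$ and Erlang service with $k$ phases each exponential of rate $k\mu$; transition rates: $(0,0)\to(1,k)$ and $(n,s)\to(n+1,s)$ at rate $\lambda$; $(n,s)\to(n,s-1)$ at rate $k\mu$ for $s\ge2$; $(n,1)\to(n-1,k)$ at rate $k\mu$ for $n\ge2$; $(1,1)\to(0,0)$ at rate $k\mu$. Let $D_{\theta,\alpha}$ be the subordinator with $\mathbb{E}e^{-sD_{\theta,\alpha}(t)}=e^{-t((s+\theta)^\alpha-\theta^\alpha)}$, $Y_{\theta,\alpha}(t)=\inf\{x>0:D_{\theta,\alpha}(x)>t\}$ independent of $Q$; the tempered Erlang queue is $Q^{\theta,\alpha}(t)=Q(Y_{\theta,\alpha}(t))$. Its queue length process is $L^{\theta,\alpha}(t)=g_k(Q^{\theta,\alpha}(t))$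 with $g_k(n,s)=k(n-1)+s$ for $(n,s)\in S$, $g_k(0,0)=0$, and $p_0^{\theta,\alpha}(t)=\Pr(L^{\theta,\alpha}(t)=0\mid L^{\theta,\alpha}(0)=0)$. Caputo tempered fractional derivative: with $\mathcal{D}_t^{\alpha}f(t)=\frac{1}{\Gamma(1-\alpha)}\frac{d}{dt}\int_0^t \frac{f(s)}{(t-s)^\alpha}ds$ and $\mathcal{D}_t^{\theta,\alpha}f(t)=e^{-\theta t}\mathcal{D}_t^{\alpha}(e^{\theta t}f(t))-\theta^\alpha f(t)$, $\partial_t^{\theta,\alpha}f(t)=\mathcal{D}_t^{\theta,\alpha}f(t)-\frac{f(0)}{\Gamma(1-\alpha)}\int_t^\infty e^{-\theta s}\alpha s^{-\alpha-1}ds$. *)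

(* Defs.v *)
From HB Require Import structures.
From mathcomp Require Import all_boot all_order all_algebra.
From mathcomp Require Import all_classical all_reals all_analysis.
Set Implicit Arguments. Unset Strict Implicit. Unset Printing Implicit Defensive.
Import Order.TTheory GRing.Theory Num.Theory.
Import numFieldNormedType.Exports.
Local Open Scope classical_set_scope.
Local Open Scope ring_scope.

(* States of the Erlang queue: (number of customers, phase).           *)
(* The state space is {(0,0)} U {(n,s) : n >= 1, 1 <= s <= k}.         *)
Definition state := (nat * nat)%type.

(* Outgoing transitions (target, rate) from state i, exactly as listed:
   (0,0) -> (1,k) at rate lam;  (n,s) -> (n+1,s) at rate lam;
   (n,s) -> (n,s-1) at rate k mu for s >= 2;
   (n,1) -> (n-1,k) at rate k mu for n >= 2;  (1,1) -> (0,0) at rate k mu.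
   Pairs outside the state space are given no transitions (irrelevant). *)
Definition erlang_rates {R : realType} (k : nat) (lam mu : R) (i : state)
    : seq (state * R) :=
  match i with
  | (0, _) => if i == (0, 0)%N then [:: ((1, k)%N, lam)] else [::]
  | (n.+1, s) =>
      if ((1 <= s) && (s <= k))%N then
        ((n.+2, s), lam) ::
        (if (2 <= s)%N then [:: ((n.+1, s.-1), k%:R * mu)]
         else if n == 0%N then [:: ((0, 0)%N, k%:R * mu)]
         else [:: ((n, k), k%:R * mu)])
      else [::]
  end.

(* Pt is the (stochastic) transition function of the CTMC with these rates:
   Pt 0 = identity, nonnegative, rows sum to one, right-continuous at 0,
   and it solves the backward Kolmogorov equations for t > 0.
   (Rates are bounded, so such a transition function is unique.) *)
Definition erlang_transition {R : realType} (k : nat) (lam mu : R)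
    (Pt : R -> state -> state -> R) : Prop :=
  [/\ (forall i j, Pt 0 i j = (i == j)%:R),
      (forall (t : R) i j, 0 <= t -> 0 <= Pt t i j),
      (forall (t : R) i, 0 <= t -> (\esum_(j in [set: state]) (Pt t i j)%:E = 1)%E),
      (forall i j, Pt u i j @[u --> 0^'+] --> Pt 0 i j) &
      (forall (t : R) i j, 0 < t ->
         is_derive t 1 (fun u => Pt u i j)
           (\sum_(p <- erlang_rates k lam mu i) p.2 * (Pt t p.1 j - Pt t i j)))].

Fixpoint fdd_prob {R : realType} (Pt : R -> state -> state -> R)
    (s0 : state) (t0 : R) (l : seq (R * state)) : R :=
  match l with
  | [::] => 1
  | (t, s) :: l' => Pt (t - t0) s0 s * fdd_prob Pt s t l'
  end.

Definition ctmc_fdd {R : realType} {d} {Omega : measurableType d}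
    (P : probability Omega R) (X : R -> Omega -> state)
    (Pt : R -> state -> state -> R) (i0 : state) : Prop :=
  forall l : seq (R * state), path <=%R 0 (map fst l) ->
    P [set w | forall p, p \in l -> X p.1 w = p.2] = (fdd_prob Pt i0 0 l)%:E.

Definition erlang_queue {R : realType} {d} {Omega : measurableType d}
    (P : probability Omega R) (k : nat) (lam mu : R)
    (Q : R -> Omega -> state) : Prop :=
  [/\ (forall t s, measurable (Q t @^-1` [set s])),
      (forall w t, 0 <= t -> exists e : R, 0 < e /\
          forall u, t <= u < t + e -> Q u w = Q t w) &
      exists Pt, erlang_transition k lam mu Pt /\ ctmc_fdd P Q Pt (0, 0)%N].

Definition tempered_subordinator {R : realType} {d} {Omega : measurableType d}
    (P : probability Omega R) (theta alpha : R) (D : R -> Omega -> R) : Prop :=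
  [/\ (forall x, measurable_fun setT (D x)),
      (forall w, D 0 w = 0),
      (forall w x y, 0 <= x -> x <= y -> D x w <= D y w) &
      (forall w x, 0 <= x -> D u w @[u --> x^'+] --> D x w)] /\
  [/\
      (forall (ts : seq R) (B : nat -> set R),
         path <=%R 0 ts -> (forall i, measurable (B i)) ->
         P [set w | forall i, (i < size ts)%N ->
                      B i (D (nth 0%R ts i) w - D (nth 0%R (0%R :: ts) i) w)]
         = (\prod_(i < size ts)
              P [set w | B i (D (nth 0%R ts i) w - D (nth 0%R (0%R :: ts) i) w)%R])%E),
      (forall t h B, 0 <= t -> 0 <= h -> measurable B ->
         P [set w | B (D (t + h) w - D t w)] = P [set w | B (D h w)]) &
      (forall t s, 0 <= t -> 0 <= s ->
         (\int[P]_w (expR (- (s * D t w)))%:E)%E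
         = (expR (- (t * ((s + theta) `^ alpha - theta `^ alpha))))%:E)].

Definition indep_processes {R : realType} {d} {Omega : measurableType d}
    (P : probability Omega R) (Q : R -> Omega -> state) (D : R -> Omega -> R)
    : Prop :=
  forall A B,
    <<s [set E | exists t s, E = Q t @^-1` [set s]] >> A ->
    <<s [set E | exists x (C : set R), measurable C /\ E = D x @^-1` C] >> B ->
    P (A `&` B) = (P A * P B)%E.

Definition inv_sub {R : realType} {Omega : Type} (D : R -> Omega -> R)
    (t : R) (w : Omega) : R :=
  inf [set x | 0 < x /\ t < D x w].

Definition g_k (k : nat) (i : state) : nat :=
  match i with (0, _) => 0%N | (n.+1, s) => (k * n + s)%N end.

Definition queue_length {R : realType} {Omega : Type} (k : nat)
    (Q : R -> Omega -> state) (D : R -> Omega -> R) (t : R) (w : Omega) : nat :=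
  g_k k (Q (inv_sub D t w) w).

Definition L0_event {R : realType} {Omega : Type} (k : nat)
    (Q : R -> Omega -> state) (D : R -> Omega -> R) : set Omega :=
  [set w | queue_length k Q D 0 w = 0%N].

Definition mean_num {R : realType} {d} {Omega : measurableType d}
    (P : probability Omega R) (k : nat) (Q : R -> Omega -> state)
    (D : R -> Omega -> R) (t : R) : \bar R :=
  (\int[P]_(w in L0_event k Q D) ((queue_length k Q D t w)%:R : R)%:E)%E.

Definition mean_queue {R : realType} {d} {Omega : measurableType d}
    (P : probability Omega R) (k : nat) (Q : R -> Omega -> state)
    (D : R -> Omega -> R) (t : R) : R :=
  fine (mean_num P k Q D t) / fine (P (L0_event k Q D)).

Definition p0 {R : realType} {d} {Omega : measurableType d}
    (P : probability Omega R) (k : nat) (Q : R -> Omega -> state)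
    (D : R -> Omega -> R) (t : R) : R :=
  fine (P (L0_event k Q D `&` [set w | queue_length k Q D t w = 0%N]))
  / fine (P (L0_event k Q D)).

Definition Gamma_fn {R : realType} (x : R) : R :=
  fine (\int[@lebesgue_measure R]_(u in `]0%R, +oo[%classic)
          (u `^ (x - 1) * expR (- u))%:E)%E.

Definition rl_kernel_int {R : realType} (alpha : R) (f : R -> R) (u : R) : R :=
  fine (\int[@lebesgue_measure R]_(s in `[0%R, u]%classic)
          (f s * (u - s) `^ (- alpha))%:E)%E.

Definition rl_deriv {R : realType} (alpha : R) (f : R -> R) (t : R) : R :=
  (Gamma_fn (1 - alpha))^-1 * derive1 (rl_kernel_int alpha f) t.

Definition tempered_rl_deriv {R : realType} (theta alpha : R) (f : R -> R)
    (t : R) : R :=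
  expR (- (theta * t)) * rl_deriv alpha (fun s => expR (theta * s) * f s) t
  - theta `^ alpha * f t.

Definition caputo_tempered {R : realType} (theta alpha : R) (f : R -> R)
    (t : R) : R :=
  tempered_rl_deriv theta alpha f t
  - f 0 / Gamma_fn (1 - alpha) *
    fine (\int[@lebesgue_measure R]_(s in `]t%R, +oo[%classic)
            (expR (- (theta * s)) * alpha * s `^ (- alpha - 1))%:E)%E.

(* Main.v *)
(* With Y the inverse of D, the occupation integral
     A_f(t) = E \int_0^oo f(v) 1_{D(v) <= t} dv = E \int_0^{Y(t)} f(v) dv
   has Laplace transform f^(phi(s)) / s, where phi(s) = (s + theta)^alpha - theta^alpha.
   If f' = l (b2 - b1) and f(0) = c0, comparing Laplace transforms shows that
   e^{theta t} A_f, convolved with t^{-alpha}, is Gamma(1 - alpha) times the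
   primitive of e^{theta t} (theta^alpha A_f + c0 + l (A_b2 - A_b1)).
   The backward Kolmogorov equations give
     E g_k(Q(u)) = k (lam - mu) u + k mu \int_0^u p_00(v) dv,
   and p_00' = lam (p_{(1,k),0} - p_00). By independence of Y and Q the tempered
   mean is k (lam - mu) A_1 + k mu A_{p_00}, and p_0^{theta,alpha} is
   1 + lam (A_{p_{(1,k),0}} - A_{p_00}), so the case f = 1 and the case f = p_00
   of the fractional equation add up to the claim. *)
Require Import Defs.
From HB Require Import structures.
From mathcomp Require Import all_boot all_order all_algebra.
From mathcomp Require Import all_classical all_reals all_analysis.
From mathcomp Require Import measurable_realfun zify ring lra.
Set Implicit Arguments.
Unset Strict Implicit.
Unset Printing Implicit Defensive.
Import Order.TTheory GRing.Theory Num.Theory.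
Import numFieldNormedType.Exports.
Local Open Scope classical_set_scope.
Local Open Scope ring_scope.

(** * Laplace transforms and convolutions *)

(** Integrals are exchanged by Tonelli, so Laplace transforms are taken of nonnegative functions
    with values in [\bar R], and equations with a minus sign are kept in additive form. The
    occupation integral is attached to the set {(v, w) : D(v) <= t} rather than to Y: integrating
    e^{-st} over t >= D(v) gives e^{-s D(v)} / s, whose expectation is given by hypothesis. The
    factor e^{theta t} moves transforms to s + theta, where t^{-alpha} has transform Gamma(1 -
    alpha) (s + theta)^{alpha - 1}; since (s + theta)^alpha = phi(s) + theta^alpha, this is the
    origin of the term theta^alpha A_f. Two obstacles shape the rest. The derivative is claimed at
    every t > 0, so A_f has to be continuous: a jump would charge {D = t}, which is null because D
    is strictly increasing, and this in turn comes from phi being unbounded. The mean runs over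
    infinitely many states, and the backward equations are not summed term by term: E min(N, g_k) is
    N minus a finite sum, and a Gronwall estimate weighted by 2^{g_k} controls its distance to the
    limit. *)

Lemma integral_shift (R : realType) (f : R -> \bar R) (a : R) :
  measurable_fun [set: R] f -> (forall x, (0 <= f x)%E) ->
  (\int[lebesgue_measure]_x f (x - a)%R = \int[lebesgue_measure]_x f x)%E.
Proof.
move=> mf f0.
pose s := (fun x => x - a) : measurableTypeR R -> measurableTypeR R.
have ms : measurable_fun [set: measurableTypeR R] s by apply: measurable_funB => //; exact: measurable_id.
transitivity (\int[pushforward (@lebesgue_measure R) s]_x f x)%E.
  by rewrite ge0_integral_pushforward//= preimage_setT.
apply: eq_measure_integral => A mA _; apply/esym/lebesgue_measure_unique => //=.
move=> _ [[b c]] _ <-; rewrite /pushforward /=.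
have -> : s @^-1` `]b, c] = `](b + a), (c + a)]%classic.
  by apply/seteqP; split => x; rewrite /s /= !in_itv/= ltrBrDr lerBlDr.
by rewrite !lebesgue_measure_itv/= !lte_fin ltrD2r -!EFinB opprD addrACA subrr addr0.
Qed.

(** The pushforward under x -> c x, rescaled by c, agrees with Lebesgue measure on half-open
    intervals, which determine it. *)
Lemma integral_scale (R : realType) (f : R -> \bar R) (c : R) : 0 < c ->
  measurable_fun [set: R] f -> (forall x, (0 <= f x)%E) ->
  (c%:E * \int[lebesgue_measure]_x f (c * x)%R = \int[lebesgue_measure]_x f x)%E.
Proof.
move=> c0 mf f0.
pose s := (fun x => c * x) : measurableTypeR R -> measurableTypeR R.
have ms : measurable_fun [set: measurableTypeR R] s by exact: measurable_funM.
transitivity (c%:E * \int[pushforward (@lebesgue_measure R) s]_x f x)%E.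
  by rewrite ge0_integral_pushforward//= preimage_setT.
rewrite -(@ge0_integral_mscale _ _ _ _ _ measurableT (NngNum (ltW c0)))//.
apply: eq_measure_integral => A mA _; apply/esym/lebesgue_measure_unique => //=.
move=> _ [[b d]] _ <-; rewrite /mscale /= /pushforward.
have -> : s @^-1` `]b, d] = `](b / c), (d / c)]%classic.
  by apply/seteqP; split => x; rewrite /s /= !in_itv/= ltr_pdivrMr// ler_pdivlMr// ![x * c]mulrC.
rewrite !lebesgue_measure_itv/= !lte_fin ltr_pM2r ?invr_gt0//.
case: ifPn => _; last by rewrite mule0.
by rewrite -!EFinB -mulrBl -EFinM mulrC divfK// gt_eqF.
Qed.

Lemma ge0_integral_shiftZ (R : realType) (f : R -> \bar R) (c : \bar R) (a : R) :
  measurable_fun [set: R] f -> (forall x, (0 <= f x)%E) -> (0 <= c)%E ->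
  (\int[lebesgue_measure]_x (c * f (x - a)%R) = c * \int[lebesgue_measure]_x f x)%E.
Proof.
move=> mf f0 c0; rewrite -(integral_shift a mf f0) -ge0_integralZl//.
apply: measurableT_comp => //.
by apply: measurable_funB; [exact: measurable_id | exact: measurable_cst].
Qed.

Definition laplace {R : realType} (f : R -> \bar R) (s : R) : \bar R :=
  (\int[@lebesgue_measure R]_(t in `[0%R, +oo[) ((expR (- (s * t)))%:E * f t))%E.

Definition conv {R : realType} (f g : R -> \bar R) (t : R) : \bar R :=
  (\int[@lebesgue_measure R]_(u in `[0%R, t]) (f u * g (t - u)%R))%E.

Lemma measurable_expRM (R : realType) (s : R) :
  measurable_fun [set: R] (fun t => expR (- (s * t))).
Proof.
have h : measurable_fun [set: R] (fun t : R => - (s * t)).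
  by apply: measurable_funN; exact: mulrl_measurable.
apply: (@measurableT_comp _ _ _ _ _ _ (@expR R)) => //; exact: measurable_expR.
Qed.

Section convolution.
Context {R : realType}.
Variables f g : R -> \bar R.
Hypotheses (mf : measurable_fun [set: R] f) (mg : measurable_fun [set: R] g).
Hypotheses (f0 : forall x, (0 <= f x)%E) (g0 : forall x, (0 <= g x)%E).
Local Notation mu := (@lebesgue_measure R).
Let pf := f \_ `[0, +oo[.
Let pg := g \_ `[0, +oo[.

Let mpf : measurable_fun [set: R] pf.
Proof. by apply/(measurable_restrictT _ _).1 => //; exact: measurable_funTS. Qed.

Let mpg : measurable_fun [set: R] pg.
Proof. by apply/(measurable_restrictT _ _).1 => //; exact: measurable_funTS. Qed.

Let pf0 x : (0 <= pf x)%E. Proof. by apply: erestrict_ge0. Qed.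
Let pg0 x : (0 <= pg x)%E. Proof. by apply: erestrict_ge0. Qed.

(** Cutting both factors to the half-line turns the moving domain of integration into the whole
    line: Fubini then gives measurability in t, and translation invariance becomes applicable. *)
Let convE t : conv f g t = (\int[mu]_u (pf u * pg (t - u)%R))%E.
Proof.
rewrite /conv integral_mkcond; apply: eq_integral => u _.
rewrite /pf /pg !patchE !mem_setE !in_itv/= !andbT subr_ge0.
by case: (0 <= u) => /=; case: (u <= t); rewrite ?mul0e ?mule0.
Qed.

Let mpfpg : measurable_fun [set: R * R] (fun z : R * R => pf z.2 * pg (z.1 - z.2)%R)%E.
Proof.
apply: emeasurable_funM; first exact: measurableT_comp.
apply: measurableT_comp => //.
by apply: measurable_funB; [exact: measurable_fst | exact: measurable_snd].
Qed.

Lemma conv_ge0 t : (0 <= conv f g t)%E.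
Proof. by apply: integral_ge0 => u _; exact: mule_ge0. Qed.

Lemma measurable_conv : measurable_fun [set: R] (conv f g).
Proof.
rewrite (funext convE : conv f g = _).
have h := @measurable_fun_fubini_tonelli_F _ _ _ _ R mu _ mpfpg.
by apply: h => z; exact: mule_ge0.
Qed.

(** The translation by t moves the dependence on t into [f] alone. Monotonicity is thus asked of [f]
    and not of [g], which matters because the kernel t^{-alpha} decreases. *)
Lemma conv_nd : {homo f : s t / s <= t >-> (s <= t)%E} ->
  {homo conv f g : s t / s <= t >-> (s <= t)%E}.
Proof.
move=> ndf.
have mpft (t : R) : measurable_fun [set: R] (fun x => pf (x + t)%R * pg (- x)%R)%E.
  apply: emeasurable_funM; apply: measurableT_comp => //.
  by apply: measurable_funD; [exact: measurable_id | exact: measurable_cst].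
have shE t : conv f g t = (\int[mu]_x (pf (x + t)%R * pg (- x)%R))%E.
  rewrite convE -(integral_shift t (mpft t)); last by move=> x; exact: mule_ge0.
  by apply: eq_integral => u _; rewrite subrK opprB.
move=> s t st; rewrite !shE; apply: ge0_le_integral => //.
- by move=> x _; exact: mule_ge0.
- exact: mpft.
- exact: mpft.
- move=> x _; apply: lee_wpmul2r => //.
  rewrite /pf !patchE !mem_setE !in_itv/= !andbT.
  have xst : x + s <= x + t by rewrite lerD2l.
  case: (leP 0 (x + s)) => xs; last by case: ifP.
  by rewrite (le_trans xs xst); exact: ndf.
Qed.

Lemma laplace_conv s : laplace (conv f g) s = (laplace f s * laplace g s)%E.
Proof.
pose e (t : R) := (expR (- (s * t)))%:E.
have me : measurable_fun [set: R] e.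
  by apply/measurable_EFinP; exact: measurable_expRM.
have e0 t : (0 <= e t)%E by rewrite lee_fin expR_ge0.
have lapE (h : R -> \bar R) : laplace h s = (\int[mu]_t (e t * (h \_ `[0%R, +oo[) t))%E.
  rewrite /laplace integral_mkcond; apply: eq_integral => t _.
  by rewrite !patchE; case: ifP => //; rewrite mule0.
pose F (z : R * R) := (e z.1 * (pf z.2 * pg (z.1 - z.2)%R))%E.
have mF : measurable_fun [set: R * R] F.
  by apply: emeasurable_funM => //; exact: measurableT_comp.
have F0 z : (0 <= F z)%E by rewrite !mule_ge0.
transitivity (\int[mu]_t \int[mu]_u F (t, u))%E.
  rewrite lapE; apply: eq_integral => t _; rewrite patchE.
  rewrite /F/= ge0_integralZl//; last 2 first.
  - apply: emeasurable_funM => //; apply: measurableT_comp => //.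
    by apply: measurable_funB; [exact: measurable_cst | exact: measurable_id].
  - by move=> u _; exact: mule_ge0.
  rewrite -convE; case: ifPn => //; rewrite mem_setE in_itv/= andbT -ltNge => t0.
  congr (_ * _)%E; rewrite /conv set_itv_ge ?integral_set0//.
  by rewrite bnd_simp -ltNge.
rewrite (@fubini_tonelli _ _ _ _ R mu mu F mF F0) !lapE -/pf -/pg.
have mepg : measurable_fun [set: R] (fun t => e t * pg t)%E by exact: emeasurable_funM.
have epg0 t : (0 <= e t * pg t)%E by exact: mule_ge0.
rewrite -ge0_integralZr//; last 3 first.
- exact: emeasurable_funM.
- by move=> t _; exact: mule_ge0.
- exact: integral_ge0.
apply: eq_integral => u _; rewrite /F/=.
rewrite -(ge0_integral_shiftZ u mepg epg0 (mule_ge0 (e0 u) (pf0 u))).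
apply: eq_integral => t _; rewrite muleACA; congr (_ * _)%E.
by rewrite -EFinM -expRD; congr (expR _)%:E; lra.
Qed.

End convolution.

Lemma laplace_cst1 (R : realType) (c : R) : 0 < c ->
  laplace (fun=> 1%E) c = (c^-1)%:E :> \bar R.
Proof.
move=> c0; rewrite /laplace integral_mkcond.
transitivity (c^-1%:E * \int[@lebesgue_measure R]_x (exponential_pdf c x)%:E)%E.
  rewrite -ge0_integralZl_EFin//.
  - apply: eq_integral => x _; rewrite patchE /exponential_pdf patchE.
    case: ifP; rewrite ?mule0// mule1 -EFinM mulNr mulrA mulVf ?gt_eqF//.
    by rewrite mul1r.
  - by move=> x _; rewrite lee_fin exponential_pdf_ge0// ltW.
  - by apply/measurable_EFinP; exact: measurable_exponential_pdf.
  - by rewrite invr_ge0 ltW.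
by rewrite integral_exponential_pdf// mule1.
Qed.

Lemma measurable_laplace_integrand (R : realType) (f : R -> \bar R) (c : R) (A : set R) :
  measurable_fun [set: R] f ->
  measurable_fun A (fun t => (expR (- (c * t)))%:E * f t)%E.
Proof.
move=> mf; apply: measurable_funTS; apply: emeasurable_funM => //.
by apply/measurable_EFinP; exact: measurable_expRM.
Qed.

Lemma laplaceD (R : realType) (f g : R -> \bar R) (c : R) :
  measurable_fun [set: R] f -> measurable_fun [set: R] g ->
  (forall t, (0 <= f t)%E) -> (forall t, (0 <= g t)%E) ->
  laplace (fun t => f t + g t)%E c = (laplace f c + laplace g c)%E.
Proof.
move=> mf mg f0 g0; rewrite /laplace -ge0_integralD//.
- by apply: eq_integral => t _; rewrite ge0_muleDr.
- by move=> t _; rewrite mule_ge0// lee_fin expR_ge0.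
- exact: measurable_laplace_integrand.
- by move=> t _; rewrite mule_ge0// lee_fin expR_ge0.
- exact: measurable_laplace_integrand.
Qed.

Lemma laplaceZ (R : realType) (a : R) (f : R -> \bar R) (c : R) : 0 <= a ->
  measurable_fun [set: R] f -> (forall t, (0 <= f t)%E) ->
  laplace (fun t => a%:E * f t)%E c = (a%:E * laplace f c)%E.
Proof.
move=> a0 mf f0; rewrite /laplace -ge0_integralZl//.
- by apply: eq_integral => t _; rewrite muleCA.
- exact: measurable_laplace_integrand.
- by move=> t _; rewrite mule_ge0// lee_fin expR_ge0.
Qed.

Lemma laplace_expM (R : realType) (a : R) (f : R -> \bar R) (c : R) :
  laplace (fun t => (expR (a * t))%:E * f t)%E (c + a) = laplace f c.
Proof.
rewrite /laplace; apply: eq_integral => t _.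
rewrite muleA -EFinM -expRD; congr ((expR _)%:E * _)%E; ring.
Qed.

(** A monotone function that is infinite at one point is infinite on the unit interval after it,
    which already makes the transform infinite. One finite transform thus gives finiteness at every
    point. *)
Lemma nd_laplace_lty (R : realType) (f : R -> \bar R) (c t : R) : 0 <= c ->
  measurable_fun [set: R] f -> (forall t, (0 <= f t)%E) ->
  {homo f : s t / s <= t >-> (s <= t)%E} -> (laplace f c < +oo)%E -> (f t < +oo)%E.
Proof.
move=> c0 mf f0 ndf lty; pose t0 := Num.max t 0.
apply: (@le_lt_trans _ _ (f t0)); first by apply: ndf; rewrite le_max lexx.
have t00 : 0 <= t0 by rewrite le_max lexx orbT.
have h : ((expR (- (c * (t0 + 1))))%:E * f t0 <= laplace f c)%E.
  rewrite /laplace; apply: (@le_trans _ _ (\int[@lebesgue_measure R]_(u in `[t0, (t0 + 1)%R])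
      ((expR (- (c * u)))%:E * f u))%E); last first.
    apply: ge0_subset_integral => //.
    - exact: measurable_laplace_integrand.
    - by move=> u _; rewrite mule_ge0// lee_fin expR_ge0.
    - by move=> u; rewrite /= !in_itv/= andbT => /andP[+ _]; exact: le_trans.
  apply: (@le_trans _ _ (\int[@lebesgue_measure R]_(u in `[t0, (t0 + 1)%R])
      ((expR (- (c * (t0 + 1))))%:E * f t0))%E).
    rewrite integral_cst//= lebesgue_measure_itv/= lte_fin ltrDl ltr01 -EFinB.
    by rewrite addrAC subrr add0r mule1.
  apply: ge0_le_integral => //.
  - by move=> u _; rewrite mule_ge0// lee_fin expR_ge0.
  - exact: measurable_laplace_integrand.
  - move=> u; rewrite /= in_itv/= => /andP[tu ut].
    apply: lee_pmul; rewrite ?lee_fin ?expR_ge0//.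
      by rewrite ler_expR lerN2 ler_wpM2l.
    exact: ndf.
rewrite ltey; apply/eqP => e; move: (le_lt_trans h lty).
by rewrite e gt0_muley ?ltxx// lte_fin expR_gt0.
Qed.

(** * The Gamma integral *)

(** On [1/(n+1), 1] the primitive u^{1-a} / (1-a) bounds the integral by 1/(1-a) uniformly in n;
    monotone convergence then reaches the singularity at 0. *)
Lemma integral_powR_oc01_lty (R : realType) (a : R) : 0 < a < 1 ->
  (\int[@lebesgue_measure R]_(u in `]0%R, 1%R]) (u `^ (- a))%:E < +oo)%E.
Proof.
move=> /andP[a0 a1].
pose F (n : nat) : set R := `[n.+1%:R^-1, 1]%classic.
have FE : \bigcup_n F n = `]0, 1]%classic.
  apply/seteqP; split => x /=.
    move=> [n _]; rewrite /F/= !in_itv/= => /andP[nx ->]; rewrite andbT.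
    by apply: lt_le_trans nx; rewrite invr_gt0.
  rewrite in_itv/= => /andP[x0 x1]; exists (Num.truncn x^-1) => //.
  rewrite /F/= in_itv/= x1 andbT invf_ple ?posrE//.
  by apply/ltW; exact: Num.Theory.truncnS_gt.
have mF n : measurable (F n) by exact: measurable_itv.
have mp A : measurable_fun A (fun u : R => (u `^ (- a))%:E).
  by apply/measurable_EFinP; apply: measurable_funTS; exact: measurable_powR.
have := @ge0_nondecreasing_set_cvg_integral _ (measurableTypeR R) R F (fun u : R => (u `^ (- a))%:E)
  (@lebesgue_measure R).
rewrite FE => /(_ _ _ _ _)/cvg_lim <-//.
- apply: (@le_lt_trans _ _ ((1 - a)^-1)%:E); last exact: ltry.
  apply: lime_le.
    apply: ereal_nondecreasing_is_cvgn.
    apply: ge0_nondecreasing_set_nondecreasing_integral => //.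
    + apply/nondecreasing_seqP => n; apply/subsetPset; apply: subset_itvr.
      by rewrite bnd_simp lef_pV2 ?posrE// ler_nat.
    + by move=> n; exact: mp.
    + by move=> n x _; rewrite lee_fin powR_ge0.
  (* For n = 0 the interval is a single point, while the fundamental theorem of calculus asks for a
     nondegenerate one. *)
  apply: nearW => -[|n].
    by rewrite /F invr1 set_itv1 integral_set1 lee_fin invr_ge0 subr_ge0 ltW.
  have n0 : (0 : R) < n.+2%:R^-1 by rewrite invr_gt0.
  have n1 : (n.+2%:R^-1 : R) < 1 by rewrite invf_lt1// ltr1n.
  pose G : R -> R := (1 - a)^-1 *: (fun u : R => u `^ (1 - a)).
  have GE u : G u = (1 - a)^-1 * u `^ (1 - a) by [].
  have d (u : R) : 0 < u -> is_derive u 1 G (u `^ (- a)).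
    move=> u0; have dp := @is_derive1_powR R (1 - a) u u0.
    apply: is_derive_eq; rewrite /GRing.scale/= mulrA mulVf ?mul1r.
      by congr powR; lra.
    by rewrite gt_eqF// subr_gt0.
  rewrite /F (@continuous_FTC2 _ _ G)//.
  + rewrite -EFinB lee_fin !GE powR1 mulr1 lerBlDr lerDl mulr_ge0 ?powR_ge0// invr_ge0 subr_ge0 ltW//.
  + apply: continuous_in_subspaceT => x; rewrite inE/= in_itv/= => /andP[nx x1].
    apply: differentiable_continuous; apply/derivable1_diffP.
    by apply: derivable_powR; rewrite in_itv/= andbT; exact: lt_le_trans nx.
  + have c x : 0 < x -> {for x, continuous G}.
      move=> x0; apply: differentiable_continuous; apply/derivable1_diffP.
      by have [] := d x x0.
    split.
    * move=> x; rewrite in_itv/= => /andP[nx _].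
      by have [] := d x (lt_trans n0 nx).
    * by apply: cvg_at_right_filter; apply: c.
    * by apply: cvg_at_left_filter; apply: c.
  + move=> x; rewrite in_itv/= => /andP[nx _].
    by have [_] := d x (lt_trans n0 nx); rewrite -derive1E.
- apply/nondecreasing_seqP => n; apply/subsetPset; apply: subset_itvr.
  by rewrite bnd_simp lef_pV2 ?posrE// ler_nat.
- by move=> n; exact: mp.
- by move=> n x _; rewrite lee_fin powR_ge0.
Qed.

Section gamma.
Context {R : realType} (a : R).
Hypothesis a01 : 0 < a < 1.
Local Notation mu := (@lebesgue_measure R).
Let gam (u : R) : \bar R := (u `^ (1 - a - 1) * expR (- u))%:E.

Let mgam A : measurable_fun A gam.
Proof.
apply/measurable_EFinP; apply: measurable_funTS; apply: measurable_funM.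
  exact: measurable_powR.
have -> : (fun u : R => expR (- u)) = (fun u => expR (- (1 * u))).
  by apply/funext => u; rewrite mul1r.
exact: measurable_expRM.
Qed.

Let gam0 x : (0 <= gam x)%E.
Proof. by rewrite lee_fin mulr_ge0 ?powR_ge0 ?expR_ge0. Qed.

Let one_powR : (1 : R) `^ a = 1. Proof. by rewrite powR1. Qed.

Let powRN_ge1 (u : R) : 0 < u -> u <= 1 -> 1 <= u `^ (- a).
Proof.
move=> u0 u1; rewrite powRN invf_ge1 ?powR_gt0// -[leRHS]one_powR.
have /andP[a0 _] := a01.
by apply: ge0_ler_powR; rewrite ?nnegrE ?(ltW a0) ?(ltW u0).
Qed.

Let powRN_le1 (u : R) : 1 < u -> u `^ (- a) <= 1.
Proof.
move=> u1; have u0 : 0 < u by exact: lt_trans u1.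
rewrite powRN invf_le1 ?powR_gt0// -[leLHS]one_powR.
have /andP[a0 _] := a01.
by apply: ge0_ler_powR; rewrite ?nnegrE ?(ltW a0) ?(ltW u0)// ltW.
Qed.

Let exponentE : 1 - a - 1 = - a. Proof. lra. Qed.

(** Split at 1: e^{-u} <= 1 leaves u^{-a} on (0, 1], and u^{-a} <= 1 leaves e^{-u} beyond. *)
Lemma integral_gamma_lty : (\int[mu]_(u in `]0%R, +oo[) gam u < +oo)%E.
Proof.
have -> : `]0, +oo[%classic = `]0, 1] `|` `]1, +oo[ :> set R.
  by rewrite -itv_bndbnd_setU// bnd_simp.
rewrite ge0_integral_setU//; last 2 first.
- exact: mgam.
- apply/disj_set2P; rewrite -subset0 => x/=; rewrite !in_itv/= andbT => -[/andP[_ x1]].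
  by rewrite ltNge x1.
apply: lte_add_pinfty.
  apply: (@le_lt_trans _ _ (\int[mu]_(u in `]0%R, 1%R]) (u `^ (- a))%:E)%E); last first.
    exact: integral_powR_oc01_lty.
  apply: ge0_le_integral => //.
  - exact: mgam.
  - by apply/measurable_EFinP; apply: measurable_funTS; exact: measurable_powR.
  - move=> u; rewrite /= in_itv/= => /andP[u0 _].
    rewrite lee_fin exponentE ler_piMr ?powR_ge0// -expR0 ler_expR; lra.
have mexp A : measurable_fun A (fun t : R => ((expR (- (1 * t)))%:E * 1)%E).
  rewrite (_ : (fun _ => _) = (fun t : R => (expR (- (1 * t)))%:E)).
    by apply/measurable_EFinP; apply: measurable_funTS; exact: measurable_expRM.
  by apply/funext => t; rewrite mule1.
have := laplace_cst1 (@ltr01 R); rewrite /laplace => h.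
apply: (@le_lt_trans _ _ (1^-1 : R)%:E); last exact: ltry.
rewrite -h; apply: (@le_trans _ _ (\int[mu]_(t in `]1%R, +oo[) ((expR (- (1 * t)))%:E * 1))%E).
  apply: ge0_le_integral => //.
  - exact: mgam.
  - exact: mexp.
  - move=> u; rewrite /= in_itv/= andbT => u1.
    rewrite mule1 lee_fin exponentE mul1r ler_piMl ?expR_ge0//.
    exact: powRN_le1.
apply: ge0_subset_integral => //.
- exact: mexp.
- by apply: subset_itvr; rewrite bnd_simp.
Qed.

Lemma integral_gamma : (\int[mu]_(u in `]0%R, +oo[) gam u = (Gamma_fn (1 - a))%:E)%E.
Proof.
rewrite /Gamma_fn fineK// ge0_fin_numE; first exact: integral_gamma_lty.
by apply: integral_ge0 => u _; exact: gam0.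
Qed.

(** The integrand is at least e^{-1} on (0, 1]. *)
Lemma Gamma_fn_gt0 : 0 < Gamma_fn (1 - a).
Proof.
rewrite -lte_fin -integral_gamma.
apply: (@lt_le_trans _ _ (\int[mu]_(u in `]0%R, 1%R]) (expR (-1))%:E)%E).
  rewrite integral_cst//= lebesgue_measure_itv/= lte_fin ltr01 oppr0 adde0 mule1.
  by rewrite lte_fin expR_gt0.
apply: (@le_trans _ _ (\int[mu]_(u in `]0%R, 1%R]) gam u)%E).
  apply: ge0_le_integral => //.
  - exact: mgam.
  - move=> u; rewrite /= in_itv/= => /andP[u0 u1]; rewrite lee_fin exponentE.
    rewrite -[leLHS]mul1r ler_pM ?expR_ge0// ?ler_expR ?lerN2//.
    exact: powRN_ge1.
by apply: ge0_subset_integral => //; [exact: mgam|move=> u; rewrite /= !in_itv/= => /andP[->]].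
Qed.

Lemma laplace_powR (c : R) : 0 < c ->
  laplace (fun u => (u `^ (- a))%:E) c = (c `^ (a - 1) * Gamma_fn (1 - a))%:E.
Proof.
move=> c0; rewrite EFinM -integral_gamma integral_itv_obnd_cbnd//.
rewrite integral_mkcond -(integral_scale c0); last 2 first.
- by apply/(measurable_restrictT _ _).1.
- by move=> u; apply: erestrict_ge0.
rewrite /laplace integral_mkcond -[LHS]mul1e.
(* The scaling u -> c u produces a factor c and, from the power, c^{-a}; the prefactor c^{a-1}
   compensates both. *)
rewrite (_ : 1%E = (c `^ (a - 1) * c * c `^ (- a))%:E); last first.
  congr (_%:E); rewrite [_ * c]mulrC mulr_powRB1 ?(ltW c0)//; last by case/andP: a01.
  by rewrite powRN mulfV// gt_eqF// powR_gt0.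
rewrite !EFinM -!muleA; congr (_ * (_ * _))%E.
rewrite -ge0_integralZl//; last 3 first.
- apply/(measurable_restrictT _ _).1 => //; apply: emeasurable_funM.
    by apply/measurable_EFinP; apply: measurable_funTS; exact: measurable_expRM.
  by apply/measurable_EFinP; apply: measurable_funTS; exact: measurable_powR.
- move=> u _; apply: erestrict_ge0 => x _.
  by rewrite mule_ge0// lee_fin ?expR_ge0 ?powR_ge0.
- by rewrite lee_fin powR_ge0.
apply: eq_integral => u _; rewrite !patchE !mem_setE !in_itv/= !andbT pmulr_rge0//.
case: ifP => u0; rewrite ?mule0// /gam exponentE powRM ?(ltW c0)// -!EFinM.
by congr (_%:E); ring.
Qed.

End gamma.

(** * Injectivity of the Laplace transform *)

Lemma bernoulli_unbounded (R : realType) (c r C : R) : 0 < c -> 1 < r ->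
  exists N, C < c * r ^+ N.
Proof.
move=> c0 r1.
have h N : 1 + N%:R * (r - 1) <= r ^+ N.
  elim: N => [|N IH]; first by rewrite mul0r addr0 expr0.
  rewrite exprS -natr1.
  have h1 : r * (1 + N%:R * (r - 1)) <= r * r ^+ N by rewrite ler_wpM2l// ltW// (lt_trans ltr01).
  have h2 : 0 <= N%:R * (r - 1) ^+ 2 by rewrite mulr_ge0// sqr_ge0.
  nra.
pose N := (Num.truncn (C / (c * (r - 1)))).+1.
exists N; apply: (@lt_le_trans _ _ (c * (1 + N%:R * (r - 1)))); last by rewrite ler_pM2l.
have : C / (c * (r - 1)) < N%:R by exact: Num.Theory.truncnS_gt.
rewrite ltr_pdivrMr ?mulr_gt0 ?subr_gt0//; nra.
Qed.

Section lerch.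
Context {R : realType}.
Local Notation mu := (@lebesgue_measure R).
Local Notation D := (`[0%R, +oo[%classic : set R).
Variables X Z : R -> R.
Hypotheses (mX : measurable_fun [set: R] X) (mZ : measurable_fun [set: R] Z).
Hypotheses (X0 : forall t, 0 <= X t) (Z0 : forall t, 0 <= Z t).
(** Large integer arguments suffice: for n >= n0, e^{-nt} is e^{-n0 t} times a power of e^{-t}, and
    the test kernels are polynomials in e^{-t}. *)
Variable n0 : nat.
Hypothesis lapE : forall n, (n0 <= n)%N ->
  laplace (EFin \o X) n%:R = laplace (EFin \o Z) n%:R :> \bar R.
Hypothesis lapX : (laplace (EFin \o X) n0%:R < +oo)%E.

Let ex n (t : R) := expR (- (n%:R * t)).

Let int_ex (Y : R -> R) n : measurable_fun [set: R] Y -> (forall t, 0 <= Y t) ->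
  (laplace (EFin \o Y) n0%:R < +oo)%E -> (n0 <= n)%N ->
  mu.-integrable D (fun t => (ex n t * Y t)%:E).
Proof.
move=> mY Y0 lapY n0n.
have m k : measurable_fun D (fun t => (ex k t * Y t)%:E).
  apply/measurable_EFinP; apply: measurable_funTS; apply: measurable_funM => //.
  exact: measurable_expRM.
apply/integrableP; split; [exact: m|apply: le_lt_trans lapY].
apply: ge0_le_integral => //.
- by apply: measurableT_comp => //; exact: m.
- exact: m.
- move=> t; rewrite /= in_itv/= andbT => t0.
  rewrite lee_fin ger0_norm ?mulr_ge0 ?expR_ge0//.
  by rewrite ler_wpM2r// ler_expR lerN2 ler_wpM2r// ler_nat.
Qed.

Let mD : measurable (D : set (measurableTypeR R)). Proof. exact: measurable_itv. Qed.

Let h t := X t - Z t.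

Let int_h n : (n0 <= n)%N -> mu.-integrable D (fun t => (ex n t * h t)%:E).
Proof.
move=> n0n; have iX := int_ex mX X0 lapX n0n.
have iZ : mu.-integrable D (fun t => (ex n t * Z t)%:E).
  by apply: int_ex => //; rewrite -lapE.
apply: eq_integrable (integrableB _ iX iZ) => // t _.
by rewrite -EFinB -mulrBr.
Qed.

Let int_h0 n : (n0 <= n)%N -> (\int[mu]_(t in D) (ex n t * h t)%:E = 0)%E.
Proof.
move=> n0n; have iX := int_ex mX X0 lapX n0n.
have iZ : mu.-integrable D (fun t => (ex n t * Z t)%:E).
  by apply: int_ex => //; rewrite -lapE.
under eq_integral do rewrite mulrBr EFinB.
rewrite integralB_EFin//.
have := lapE n0n; rewrite /laplace => e.
have -> : (\int[mu]_(t in D) (ex n t * X t)%:E = \int[mu]_(t in D) (ex n t * Z t)%:E)%E.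
  by under eq_integral do rewrite EFinM; rewrite e; under [RHS]eq_integral do rewrite EFinM.
by rewrite subee//; exact: integrable_fin_num.
Qed.

(* The kernel q(e^{-t})^N with q(x) = 1 + dl^2 - (x - x0)^2 is a polynomial in
   e^{-t}; it blows up around x0 and stays in [0, 1] away from it. *)
Variables x0 dl : R.
Let q (t : R) := 1 + dl ^+ 2 - (expR (- t) - x0) ^+ 2.

Let exD n m t : ex (n + m) t = ex n t * expR (- t) ^+ m.
Proof.
rewrite /ex -expRM_natl -expRD natrD; congr expR; ring.
Qed.

(** A further factor [q] is a quadratic polynomial in e^{-t}, so the case N + 1 at exponent n
    combines the case N at n, n + 1 and n + 2. *)
Let int_kernel N n : (n0 <= n)%N ->
  mu.-integrable D (fun t => (ex n t * q t ^+ N * h t)%:E) /\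
  (\int[mu]_(t in D) (ex n t * q t ^+ N * h t)%:E = 0)%E.
Proof.
elim: N n => [|N IH] n n0n.
  under [X in integrable _ _ X]eq_fun do rewrite expr0 mulr1.
  under eq_integral do rewrite expr0 mulr1.
  by split; [exact: int_h | exact: int_h0].
have [i0 e0] := IH _ n0n.
have [i1 e1] := IH (n + 1)%N (leq_trans n0n (leq_addr _ _)).
have [i2 e2] := IH (n + 2)%N (leq_trans n0n (leq_addr _ _)).
have E t : ex n t * q t ^+ N.+1 * h t =
    (1 + dl ^+ 2 - x0 ^+ 2) * (ex n t * q t ^+ N * h t) +
    ((2 * x0) * (ex (n + 1) t * q t ^+ N * h t) +
     (-1) * (ex (n + 2) t * q t ^+ N * h t)).
  by rewrite exprS !exD {1}/q; ring.
have j0 := integrableZl mD (1 + dl ^+ 2 - x0 ^+ 2) i0.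
have j1 := integrableZl mD (2 * x0) i1.
have j2 := integrableZl mD (-1) i2.
have j12 := integrableD mD j1 j2.
split.
  apply: eq_integrable (integrableD mD j0 j12) => // t _.
  by rewrite E !EFinD !EFinM.
under eq_integral do rewrite E EFinD EFinD !(EFinM (_ - _)) !(EFinM (2 * x0)) !(EFinM (-1)).
by rewrite integralD// integralD// !integralZl// e0 e1 e2 !mule0 !adde0.
Qed.

(** The integrals of [ex n0 * q ^+ N * h] all vanish. Adding |[ex n0 * h]| makes the integrand
    nonnegative: near x0 the gap makes h positive, and away from x0 one has 0 <= q^N <= 1. The total
    then stays at the constant [C], while [a, b] alone contributes at least [c * r ^+ N], which is
    unbounded in N. *)
Lemma lerch_gap (eps : R) : 0 < dl -> dl < x0 -> x0 + dl < 1 -> 0 < eps ->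
  ~ (forall t : R, 0 <= t -> `|expR (- t) - x0| < dl -> eps <= X t - Z t).
Proof.
move=> dl0 x0dl x1dl eps0 hh.
(* For t in [a, b], e^{-t} is within dl/2 of x0, so that q(t) >= 1 + dl^2 - dl^2/4, which is the [r]
   below. *)
pose a := - ln (x0 + dl / 2); pose b := - ln (x0 - dl / 2).
have p1 : 0 < x0 - dl / 2 by lra.
have p2 : 0 < x0 + dl / 2 by lra.
have ab : a < b by rewrite ltrN2 ltr_ln ?posrE//; lra.
have a0 : 0 < a by rewrite oppr_gt0 ln_lt0//; lra.
have inab (t : R) : a <= t <= b -> x0 - dl / 2 <= expR (- t) <= x0 + dl / 2.
  move=> /andP[at_ tb].
  have k1 : x0 - dl / 2 = expR (ln (x0 - dl / 2)) by rewrite lnK// posrE.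
  have k2 : x0 + dl / 2 = expR (ln (x0 + dl / 2)) by rewrite lnK// posrE.
  rewrite k1 {}k2 !ler_expR.
  by rewrite /a in at_; rewrite /b in tb; rewrite lerNr tb lerNl at_.
pose r := 1 + 3 / 4 * dl ^+ 2.
have dl2 : 0 < dl ^+ 2 by rewrite exprn_gt0.
have r1 : 1 < r by rewrite /r; lra.
have q0 (t : R) : 0 <= t -> 0 <= q t.
  move=> t0; have e1 : expR (- t) <= 1 by rewrite -expR0 ler_expR oppr_le0.
  have e0 := expR_ge0 (- t); rewrite /q; nra.
have q1 (t : R) : 0 <= t -> dl <= `|expR (- t) - x0| -> q t <= 1.
  move=> t0 le; rewrite /q.
  have : dl ^+ 2 <= (expR (- t) - x0) ^+ 2.
    by rewrite -(real_normK (num_real (expR (- t) - x0))) lerXn2r ?nnegrE// ltW.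
  lra.
have qr (t : R) : a <= t <= b -> r <= q t.
  by move=> /inab/andP[l1 l2]; rewrite /q /r; nra.
have iH := integrable_abse (int_h (leqnn n0)).
pose C := fine (\int[mu]_(t in D) `|(ex n0 t * h t)%:E|)%E.
have CE : (\int[mu]_(t in D) `|(ex n0 t * h t)%:E| = C%:E)%E.
  by rewrite /C fineK//; exact: integrable_fin_num.
pose c := ex n0 b * eps * (b - a).
have c0 : 0 < c by rewrite !mulr_gt0 ?expR_gt0 ?subr_gt0.
have [N CN] := bernoulli_unbounded C c0 r1.
have [iN eN] := int_kernel N (leqnn n0).
have : (\int[mu]_(t in D) ((ex n0 t * q t ^+ N * h t)%:E + `|(ex n0 t * h t)%:E|) = C%:E)%E.
  by rewrite integralD// eN add0e.
have int_sum := integrableD mD iN iH.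
have ge0sum (t : R) : 0 <= t -> 0 <= ex n0 t * q t ^+ N * h t + `|ex n0 t * h t|.
  move=> t0; have [lt|le] := ltP `|expR (- t) - x0| dl.
    have := hh _ t0 lt; rewrite -/(h t) => ht.
    by rewrite addr_ge0// !mulr_ge0 ?expR_ge0// ?exprn_ge0 ?q0// (le_trans (ltW eps0)).
  have qN : 0 <= q t ^+ N <= 1.
    by rewrite exprn_ge0 ?q0//= exprn_ile1 ?q0// q1.
  have : `|ex n0 t * q t ^+ N * h t| <= `|ex n0 t * h t|.
    rewrite mulrAC normrM [`|q t ^+ N|]ger0_norm; last by case/andP: qN.
    by rewrite ler_piMr//; case/andP: qN.
  by have := ler_norm (- (ex n0 t * q t ^+ N * h t)); rewrite normrN; lra.
have : ((c * r ^+ N)%:E <=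
  \int[mu]_(t in D) ((ex n0 t * q t ^+ N * h t)%:E + `|(ex n0 t * h t)%:E|))%E.
  apply: (@le_trans _ _ (\int[mu]_(t in `[a, b]) ((ex n0 t * q t ^+ N * h t)%:E + `|(ex n0 t * h t)%:E|))%E); last first.
    apply: ge0_subset_integral => //.
    - by case/integrableP : int_sum.
    - by move=> t; rewrite /= in_itv/= andbT => t0; rewrite lee_fin ge0sum.
    - by move=> t; rewrite /= !in_itv/= andbT => /andP[+ _]; apply: le_trans; exact: ltW.
  apply: (@le_trans _ _ (\int[mu]_(t in `[a, b]) (ex n0 b * eps * r ^+ N)%:E)%E).
    rewrite integral_cst//= lebesgue_measure_itv/= lte_fin ab -EFinB -EFinM lee_fin.
    by rewrite /c mulrAC.
  have sub : `[a, b] `<=` D.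
    by move=> t; rewrite /= !in_itv/= andbT => /andP[+ _]; apply: le_trans; exact: ltW.
  apply: ge0_le_integral => //.
  - by move=> t _; rewrite lee_fin !mulr_ge0 ?expR_ge0 ?exprn_ge0// ltW// (lt_trans ltr01).
  - by case/integrableP : int_sum => + _; exact: measurable_funS.
  - move=> t; rewrite /= in_itv/= => tab.
    have t0 : 0 <= t by case/andP: tab => + _; apply: le_trans; exact: ltW.
    rewrite -EFinD lee_fin -[leLHS]addr0 lerD//.
    have lt : `|expR (- t) - x0| < dl by rewrite ltr_norml; have := inab _ tab; lra.
    have ht := hh _ t0 lt; rewrite -/(h t) in ht.
    have e1 : ex n0 b <= ex n0 t.
      by rewrite ler_expR lerN2 ler_wpM2l//; case/andP: tab.
    have r0 : 0 <= r by rewrite ltW// (lt_trans ltr01).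
    have e2 : r ^+ N <= q t ^+ N by rewrite lerXn2r ?nnegrE ?q0 ?qr.
    rewrite mulrAC; apply: ler_pM => //; first by rewrite mulr_ge0 ?expR_ge0 ?exprn_ge0.
      exact: ltW.
    by apply: ler_pM => //; rewrite ?expR_ge0 ?exprn_ge0.
by move=> + e; rewrite e lee_fin leNgt CN.
Qed.

End lerch.

(** The map t -> e^{-t} sends (a, b) onto an interval, here described by its centre and half-length;
    positivity of a keeps it below 1. *)
Lemma lerch_gap_itv (R : realType) (X Z : R -> R) (n0 : nat) (a b eps : R) :
  measurable_fun [set: R] X -> measurable_fun [set: R] Z ->
  (forall t, 0 <= X t) -> (forall t, 0 <= Z t) ->
  (forall n, (n0 <= n)%N -> laplace (EFin \o X) n%:R = laplace (EFin \o Z) n%:R) ->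
  (laplace (EFin \o X) n0%:R < +oo)%E ->
  0 < a < b -> 0 < eps -> ~ (forall t : R, a < t < b -> eps <= X t - Z t).
Proof.
move=> mX mZ X0 Z0 lapE lapX /andP[a0 ab] eps0 hh.
pose x1 := expR (- b); pose x2 := expR (- a).
have x12 : x1 < x2 by rewrite ltr_expR ltrN2.
have x10 : 0 < x1 by exact: expR_gt0.
have x21 : x2 < 1 by rewrite -expR0 ltr_expR oppr_lt0.
apply: (@lerch_gap R X Z mX mZ X0 Z0 n0 lapE lapX ((x1 + x2) / 2) ((x2 - x1) / 2) eps _ _ _ eps0); [lra|lra|lra|].
move=> t _; rewrite ltr_norml => tt; apply: hh.
have h1 : x1 < expR (- t) by lra.
have h2 : expR (- t) < x2 by lra.
by move: h1 h2; rewrite !ltr_expR !ltrN2 => -> ->.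
Qed.

(* If a nondecreasing X differs from a continuous Z at one point, then X - Z is
   bounded away from 0, with a constant sign, on a whole interval. *)
Lemma laplace_inj (R : realType) (X Z : R -> R) (n0 : nat) :
  measurable_fun [set: R] X -> measurable_fun [set: R] Z ->
  (forall t, 0 <= X t) -> (forall t, 0 <= Z t) ->
  (forall n, (n0 <= n)%N -> laplace (EFin \o X) n%:R = laplace (EFin \o Z) n%:R) ->
  (laplace (EFin \o X) n0%:R < +oo)%E ->
  {homo X : s t / s <= t} -> {in `]0, +oo[, continuous Z} ->
  forall t, 0 < t -> X t = Z t.
Proof.
move=> mX mZ X0 Z0 lapE lapX ndX cZ t t0.
have ct : {for t, continuous Z} by apply: cZ; rewrite in_itv/= t0.
apply/eqP/negPn/negP => /eqP XZ.
pose e := `|X t - Z t| / 2.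
have e0 : 0 < e by rewrite divr_gt0// normr_gt0 subr_eq0; apply/eqP.
have /cvgrPdist_lt/(_ e e0)/nbhs_ballP[d /= d0 hd] := ct.
have hd' s : `|t - s| < d -> `|Z t - Z s| < e by move=> ?; apply: hd.
have [XZlt|XZge] := ltP (Z t) (X t).
  apply: (@lerch_gap_itv R X Z n0 t (t + d) e mX mZ X0 Z0 lapE lapX _ e0); first by rewrite t0/=; lra.
  move=> s /andP[ts sd].
  have := hd' s; rewrite distrC ger0_norm; last lra.
  move=> /(_ ltac:(lra)); rewrite ltr_norml.
  have := ndX _ _ (ltW ts); move: e0; rewrite /e ger0_norm; lra.
have XltZ : X t < Z t by rewrite lt_neqAle XZge andbT; apply/eqP.
have lapE' n : (n0 <= n)%N -> laplace (EFin \o Z) n%:R = laplace (EFin \o X) n%:R by move=> ?; rewrite lapE.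
have lapZ : (laplace (EFin \o Z) n0%:R < +oo)%E by rewrite -lapE.
(* When X(t) < Z(t), monotonicity of X preserves the gap to the left of t; the bound t / 2 keeps the
   interval at positive times. *)
apply: (@lerch_gap_itv R Z X n0 (Num.max (t / 2) (t - d)) t e mZ mX Z0 X0 lapE' lapZ _ e0).
  by rewrite lt_max gt_max; apply/andP; split; [apply/orP; left|apply/andP; split]; lra.
move=> s; rewrite gt_max => /andP[/andP[s1 s2] st].
have := hd' s; rewrite ger0_norm; last lra.
move=> /(_ ltac:(lra)); rewrite ltr_norml.
have := ndX _ _ (ltW st); move: e0; rewrite /e ler0_norm; lra.
Qed.

(** * Backward equations of the Erlang queue *)

Lemma derivable_within_continuous0 (R : realType) (v v' : R -> R) (t : R) :
  v u @[u --> 0^'+] --> v 0 ->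
  (forall s : R, 0 < s -> is_derive s 1 v (v' s)) ->
  0 < t -> {within `[0, t], continuous v}.
Proof.
move=> v0 dv t0; apply: derivable_oo_LRcontinuous_within; split => //.
  by move=> s; rewrite in_itv/= => /andP[s0 _]; have [] := dv s s0.
apply: cvg_at_left_filter; apply: differentiable_continuous; apply/derivable1_diffP.
by have [] := dv t t0.
Qed.

(** Mean value theorem for w - v and w + v, whose derivatives are both nonnegative. At 0 a right
    limit is assumed instead of a derivative, because the backward equations hold at positive
    times. *)
Lemma le_increment (R : realType) (v w v' w' : R -> R) (t : R) : 0 <= t ->
  v u @[u --> 0^'+] --> v 0 -> w u @[u --> 0^'+] --> w 0 ->
  (forall s : R, 0 < s -> is_derive s 1 v (v' s)) ->
  (forall s : R, 0 < s -> is_derive s 1 w (w' s)) ->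
  (forall s : R, 0 < s < t -> `|v' s| <= w' s) ->
  `|v t - v 0| <= w t - w 0.
Proof.
rewrite le_eqVlt => /predU1P[<-|t0] v0 w0 dv dw vw; first by rewrite !subrr normr0.
have cv := derivable_within_continuous0 v0 dv t0.
have cw := derivable_within_continuous0 w0 dw t0.
have dm (s : R) : s \in `]0, t[ -> is_derive s 1 (w \- v) (w' s - v' s).
  by rewrite in_itv/= => /andP[s0 _]; have := dv s s0; have := dw s s0; move=> ? ?; exact: is_deriveB.
have dp (s : R) : s \in `]0, t[ -> is_derive s 1 (w \+ v) (w' s + v' s).
  by rewrite in_itv/= => /andP[s0 _]; have := dv s s0; have := dw s s0; move=> ? ?; exact: is_deriveD.
have cm : {within `[0, t], continuous (w \- v)} by move=> x; apply: cvgB; [exact: cw|exact: cv].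
have cp : {within `[0, t], continuous (w \+ v)} by move=> x; apply: cvgD; [exact: cw|exact: cv].
have [c1 i1 e1] := MVT t0 dm cm.
have [c2 i2 e2] := MVT t0 dp cp.
rewrite /= subr0 in e1 e2.
have := vw c1; rewrite in_itv/= in i1; move=> /(_ i1); rewrite ler_norml => /andP[l1 l2].
have := vw c2; rewrite in_itv/= in i2; move=> /(_ i2); rewrite ler_norml => /andP[l3 l4].
have h1 : 0 <= (w' c1 - v' c1) * t by rewrite mulr_ge0 ?(ltW t0)//; lra.
have h2 : 0 <= (w' c2 + v' c2) * t by rewrite mulr_ge0 ?(ltW t0)//; lra.
by rewrite ler_norml; apply/andP; split; lra.
Qed.

Definition erlang_state (k : nat) (i : state) : bool :=
  (i == (0, 0)%N) || [&& (0 < i.1)%N, (0 < i.2)%N & (i.2 <= k)%N].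

Definition erlang_gen {R : realType} (k : nat) (lam mu : R) (v : state -> R) (i : state) : R :=
  \sum_(p <- erlang_rates k lam mu i) p.2 * (v p.1 - v i).

Section backward.
Context {R : realType} (k : nat) (lam mu : R).
Hypotheses (k1 : (1 <= k)%N) (lam0 : 0 < lam) (mu0 : 0 < mu).
Local Notation rates := (erlang_rates k lam mu).
Local Notation gen := (erlang_gen k lam mu).
Local Notation g := (g_k k).
Local Notation valid := (erlang_state k).

Let kmu0 : 0 <= k%:R * mu. Proof. by rewrite mulr_ge0// ltW. Qed.

(** An arrival adds k phases and a service step removes one, also when it takes (n, 1) to (n - 1,
    k). An increase of at most k is what the weight 2^g can absorb. *)
Lemma erlang_rates_state i p : valid i -> p \in rates i ->
  [/\ valid p.1, (g p.1 <= g i + k)%N & 0 <= p.2].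
Proof.
have l0 : 0 <= lam by exact: ltW.
have k0 : (0 < k)%N by [].
case: i => [[|n] s] /=.
  rewrite /erlang_state /= => /orP[/eqP[->]|//].
  rewrite eqxx mem_seq1 => /eqP -> /=; split => //.
    by rewrite /erlang_state /= k0 leqnn.
  by rewrite muln0.
rewrite /erlang_state/= => /andP[s1 sk]; rewrite s1 sk /= inE => /orP[/eqP -> /=|].
  by split => //; rewrite ?s1 ?sk// mulnS; lia.
case: ifP => s2; rewrite ?mem_seq1.
  by move=> /eqP -> /=; split => //; rewrite ?orbF /=; lia.
case: ifP => n0; rewrite mem_seq1 => /eqP -> /=; split => //.
  by rewrite /erlang_state /= lt0n n0 k0 leqnn orbT.
by case: n n0 => // n _; rewrite /= mulnS; lia.
Qed.

Lemma sum_erlang_rates i : \sum_(p <- rates i) p.2 <= lam + k%:R * mu.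
Proof.
have l0 : 0 <= lam by exact: ltW.
case: i => [[|n] s] /=; case: ifP => _; rewrite ?big_nil ?big_cons ?big_nil ?addr0.
- by rewrite lerDl.
- by rewrite addr_ge0.
- by case: ifP => _; [|case: ifP => _]; rewrite big_cons big_nil addr0.
- by rewrite addr_ge0.
Qed.

(** Bound for the generator in the norm with weight 2^g: the total rate is at most lam + k mu, a
    neighbour weighs at most 2^k times as much, and the 1 accounts for the state itself. *)
Definition erlang_growth : R := (lam + k%:R * mu) * (2 ^+ k + 1).

Let K0 : 0 <= erlang_growth.
Proof.
by rewrite mulr_ge0// ?addr_ge0 ?(ltW lam0)// exprn_ge0.
Qed.

Lemma erlang_gen_bound (v : state -> R) (B : R) i : 0 <= B -> valid i ->
  (forall j, valid j -> `|v j| <= B * 2 ^+ g j) ->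
  `|gen v i| <= erlang_growth * (B * 2 ^+ g i).
Proof.
move=> B0 vi hv; apply: (le_trans (ler_norm_sum _ _ _)).
apply: (@le_trans _ _ (\sum_(p <- rates i) p.2 * (B * 2 ^+ g i * (2 ^+ k + 1)))).
  rewrite big_seq [leRHS]big_seq; apply: ler_sum => p pi.
  have [vp gp p0] := erlang_rates_state vi pi.
  rewrite normrM ger0_norm// ler_wpM2l//.
  apply: (le_trans (ler_normB _ _)).
  rewrite mulrDr mulr1 lerD// ?hv//; apply: (le_trans (hv _ vp)).
  by rewrite -mulrA ler_wpM2l// -exprD ler_eXn2l// ltr1n.
rewrite -mulr_suml /erlang_growth -[leRHS]mulrA (mulrC (2 ^+ k + 1)).
by apply: ler_wpM2r; [rewrite !mulr_ge0 ?addr_ge0 ?exprn_ge0 | exact: sum_erlang_rates].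
Qed.

(* Gronwall's argument in the norm weighted by 2^g: iterating the backward
   equation improves the bound to eps e^{Kt} + B (Kt)^n / n!. *)
Lemma backward_bound (v : R -> state -> R) (T B eps : R) : 0 <= B -> 0 <= eps ->
  (forall i, valid i -> v u i @[u --> 0^'+] --> v 0 i) ->
  (forall (t : R) i, valid i -> 0 < t -> is_derive t 1 (v ^~ i) (gen (v t) i)) ->
  (forall (t : R) i, valid i -> 0 <= t <= T -> `|v t i| <= B * 2 ^+ g i) ->
  (forall i, valid i -> `|v 0 i| <= eps * 2 ^+ g i) ->
  forall (t : R) i, valid i -> 0 <= t <= T -> `|v t i| <= eps * expR (erlang_growth * t) * 2 ^+ g i.
Proof.
move=> B0 eps0 v0 dv bv b0.
pose K := erlang_growth; have K0' : 0 <= K := K0; rewrite -/K.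
(* W_{n+1}' = K W_n, so the bound of stage n on the generator integrates to stage n + 1. W_0
   dominates the a priori bound [B], and W_{n+1} equals eps at time 0. *)
pose W n (t : R) := eps * expR (K * t) + B * (exp_coeff (K * t) n).
have W0 n t : 0 <= t -> 0 <= W n t.
  move=> t0; rewrite addr_ge0// mulr_ge0 ?expR_ge0//.
  by apply: exp_coeff_ge0; rewrite mulr_ge0.
have key n (t : R) i : valid i -> 0 <= t <= T -> `|v t i| <= W n t * 2 ^+ g i.
  elim: n t i => [|n IH] t i vi tT.
    apply: (le_trans (bv _ _ vi tT)); rewrite ler_wpM2r ?exprn_ge0// /W.
    by rewrite /exp_coeff/= expr0 fact0 divr1 mulr1 lerDr mulr_ge0 ?expR_ge0.
  have /andP[t0 tT'] := tT.
  pose w (s : R) := W n.+1 s * 2 ^+ g i.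
  pose w' (s : R) := K * (W n s * 2 ^+ g i).
  have dw (s : R) : is_derive s 1 w (w' s).
    have d1 : is_derive s 1 (K *: (id : R -> R)) (K *: (1 : R)).
      by apply: is_deriveZ; exact: is_derive_id.
    have d2 : is_derive s 1 (expR \o (K *: (id : R -> R))) (expR (K * s) * (K *: 1)).
      by apply: is_derive1_comp; exact: is_derive_expR.
    have d3 : is_derive s 1 ((id : R -> R) ^+ n.+1) ((n.+1%:R * s ^+ n) *: (1 : R)).
      by apply: is_deriveX; exact: is_derive_id.
    have d4 := is_deriveZ (2 ^+ g i)
      (is_deriveD (is_deriveZ eps d2) (is_deriveZ (B / n.+1`!%:R * K ^+ n.+1) d3)).
    have -> : w = 2 ^+ g i *: (eps *: (expR \o (K *: (id : R -> R))) +
        (B / n.+1`!%:R * K ^+ n.+1) *: ((id : R -> R) ^+ n.+1)).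
      apply/funext => u; rewrite /w /W /exp_coeff/= exprMn.
      rewrite -[RHS]/(2 ^+ g i * (eps * expR (K * u) +
        (B / n.+1`!%:R * K ^+ n.+1) * ((id : R -> R) ^+ n.+1) u)) exprfctE; ring.
    have -> : w' s = 2 ^+ g i *: (eps *: (expR (K * s) * (K *: 1)) +
        (B / n.+1`!%:R * K ^+ n.+1) *: ((n.+1%:R * s ^+ n) *: 1)).
      rewrite /w' /W /exp_coeff /GRing.scale/= exprMn factS natrM exprS.
      have a0 : n.+1%:R != 0 :> R by rewrite pnatr_eq0.
      have b0' : n`!%:R != 0 :> R by rewrite pnatr_eq0 -lt0n fact_gt0.
      move: (n.+1%:R : R) (n`!%:R : R) a0 b0' => a b a0 b0'.
      by field; rewrite a0 b0'.
    exact: d4.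
  have cw : w u @[u --> 0^'+] --> w 0.
    apply: cvg_at_right_filter; apply: differentiable_continuous; apply/derivable1_diffP.
    by have [] := dw 0.
  have vw (s : R) : 0 < s < t -> `|gen (v s) i| <= w' s.
    move=> /andP[s0 st]; apply: erlang_gen_bound => //; first by apply: W0; exact: ltW.
    by move=> j vj; apply: IH => //; rewrite (ltW s0) (le_trans (ltW st)).
  have wE : w 0 = eps * 2 ^+ g i.
    by rewrite /w /W /exp_coeff/= mulr0 expR0 mulr1 exprS mul0r mul0r mulr0 addr0.
  have := @le_increment R (v ^~ i) w (fun s => gen (v s) i) w' t t0 (v0 _ vi) cw
    (fun s s0 => dv s i vi s0) (fun s _ => dw s) vw.
  have := ler_normD (v t i - v 0 i) (v 0 i); rewrite subrK wE.
  by have := b0 _ vi; rewrite -/(w t); lra.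
move=> t i vi tT.
have : W n t * 2 ^+ g i @[n --> \oo] --> (eps * expR (K * t) + B * 0) * 2 ^+ g i.
  apply: cvgMl; apply: cvgD; first exact: cvg_cst.
  by apply: cvgMr; exact: cvg_exp_coeff.
rewrite mulr0 addr0 => cW; rewrite -(cvg_lim (@Rhausdorff R) cW).
apply: limr_ge; first by apply/cvg_ex; eexists; exact: cW.
by apply: nearW => n; exact: key.
Qed.

End backward.

Lemma is_derive_sum_seq (R : realType) (I : eqType) (l : seq I) (h : I -> R -> R)
    (dh : I -> R) (x : R) :
  (forall i, is_derive x 1 (h i) (dh i)) ->
  is_derive x 1 (fun u => \sum_(i <- l) h i u) (\sum_(i <- l) dh i).
Proof.
move=> dhi; elim: l => [|a l IH].
  under eq_fun do rewrite big_nil; rewrite big_nil; exact: is_derive_cst.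
under eq_fun do rewrite big_cons; rewrite big_cons; exact: (is_deriveD (dhi a) IH).
Qed.

Lemma cvg_sum_seq (R : realType) (I : eqType) (l : seq I) (h : I -> R -> R)
    (lh : I -> R) (F : set_system R) {FF : Filter F} :
  (forall i, h i u @[u --> F] --> lh i) ->
  (\sum_(i <- l) h i u) @[u --> F] --> \sum_(i <- l) lh i.
Proof.
move=> dhi; elim: l => [|a l IH].
  under eq_fun do rewrite big_nil; rewrite big_nil; exact: cvg_cst.
by under eq_fun do rewrite big_cons; rewrite big_cons; exact: (cvgD (dhi a) IH).
Qed.

Section generator.
Context {R : realType} (k : nat) (lam mu : R).
Local Notation gen := (erlang_gen k lam mu).

Lemma erlang_genD (v w : state -> R) i : gen (fun j => v j + w j) i = gen v i + gen w i.
Proof. by rewrite /erlang_gen -big_split/=; apply: eq_bigr => p _; ring. Qed.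

Lemma erlang_genZ (c : R) (v : state -> R) i : gen (fun j => c * v j) i = c * gen v i.
Proof. by rewrite /erlang_gen mulr_sumr; apply: eq_bigr => p _; ring. Qed.

Lemma erlang_gen_cst (c : R) i : gen (fun=> c) i = 0.
Proof. by rewrite /erlang_gen big1// => p _; rewrite subrr mulr0. Qed.

Lemma erlang_gen_sum (I : eqType) (l : seq I) (v : I -> state -> R) i :
  gen (fun j => \sum_(a <- l) v a j) i = \sum_(a <- l) gen (v a) i.
Proof.
rewrite /erlang_gen exchange_big/=; apply: eq_bigr => p _.
by rewrite -sumrB mulr_sumr.
Qed.

Lemma is_derive_erlang_gen (v : R -> state -> R) (dv : state -> R) (t : R) i :
  (forall j, is_derive t 1 (v ^~ j) (dv j)) ->
  is_derive t 1 (fun u => gen (v u) i) (gen dv i).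
Proof.
by move=> h; apply: is_derive_sum_seq => p.
Qed.

Lemma cvg_erlang_gen (v : R -> state -> R) i :
  (forall j, v u j @[u --> 0^'+] --> v 0 j) ->
  gen (v u) i @[u --> 0^'+] --> gen (v 0) i.
Proof. by move=> h; apply: cvg_sum_seq => p; apply: cvgMr; apply: cvgB. Qed.

(** Measured in phases, an arrival counts k and every service step counts -1, departures included;
    the empty state has no service. *)
Lemma erlang_gen_g (i : state) : (1 <= k)%N -> erlang_state k i ->
  gen (fun j => (g_k k j)%:R) i = k%:R * lam - k%:R * mu * (i != (0, 0)%N)%:R.
Proof.
move=> k1; rewrite /erlang_gen /erlang_state; case: i => [[|n] s] /=.
  move=> /orP[/eqP[->]|//]; rewrite eqxx big_cons big_nil /= muln0 add0n; ring.
move=> /andP[s1 sk]; rewrite s1 sk big_cons /= mulnS.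
case: ifP => s2.
  rewrite big_cons big_nil /=; case: s s1 sk s2 => // s _ _ _ /=.
  by rewrite !natrD -[s.+1%:R]natr1; ring.
have -> : s = 1%N by case: s s1 s2 {sk} => [|[|]].
case: ifP => n0; rewrite big_cons big_nil /=.
  by rewrite (eqP n0) muln0 !addr0 natrD; ring.
case: n n0 => // n _ /=; rewrite !mulnS !natrD; ring.
Qed.

End generator.

(** * Transition probabilities, their time integrals and truncated means *)

Section transition.
Context {R : realType} (k : nat) (lam mu : R) (Pt : R -> state -> state -> R).
Hypotheses (k1 : (1 <= k)%N) (lam0 : 0 < lam) (mu0 : 0 < mu).
Hypothesis HP : erlang_transition k lam mu Pt.
Local Notation gen := (erlang_gen k lam mu).
Local Notation g := (g_k k).
Local Notation valid := (erlang_state k).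
Local Notation K := (erlang_growth k lam mu).
Local Notation mes := (@lebesgue_measure R).

Lemma transition_ge0 (t : R) i j : 0 <= t -> 0 <= Pt t i j.
Proof. by case: HP => _ h _ _ _; exact: h. Qed.

Lemma transition_sum_le1 (t : R) i (l : seq state) : 0 <= t -> uniq l ->
  \sum_(j <- l) Pt t i j <= 1.
Proof.
case: HP => _ h0 h1 _ _ t0 ul; rewrite -lee_fin -(h1 t i t0); apply: esum_ge.
exists [set` l]; first by split => //; exact: finite_seq.
by rewrite -fsbig_seq//= sumEFin.
Qed.

Lemma transition_le1 (t : R) i j : 0 <= t -> Pt t i j <= 1.
Proof.
by move=> t0; have := @transition_sum_le1 t i [:: j] t0 isT; rewrite big_seq1.
Qed.

Lemma is_derive_transition (t : R) i j : 0 < t ->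
  is_derive t 1 (fun u => Pt u i j) (gen (fun p => Pt t p j) i).
Proof. by case: HP => _ _ _ _ h; exact: h. Qed.

(** The column j starts at 0 on valid states, so the Gronwall bound with eps = 0 keeps it there. *)
Lemma transition_invalid (t : R) i j : 0 <= t -> valid i -> ~~ valid j -> Pt t i j = 0.
Proof.
move=> t0 vi vj; case: HP => h0 _ _ hc _.
suff : `|Pt t i j| <= 0 * expR (K * t) * 2 ^+ g i.
  by rewrite !mul0r normr_le0 => /eqP.
apply: (@backward_bound R k lam mu k1 lam0 mu0 (fun u p => Pt u p j) t 1 0 ler01 (lexx _)).
- by move=> p _; exact: hc.
- by move=> u p vp u0; exact: is_derive_transition.
- move=> u p vp /andP[u0 _]; rewrite mul1r ger0_norm ?transition_ge0//.
  by rewrite (le_trans (transition_le1 _ _ u0))// exprn_ege1// ler1n.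
- move=> p vp; rewrite h0; case: eqP => [e|]; last by rewrite normr0 mul0r.
  by rewrite e (negbTE vj) in vp.
- by [].
- by rewrite t0 lexx.
Qed.

(* Time is clamped at 0 because nothing is assumed about [Pt] at negative times. *)
Definition ptrans i j (s : R) : R := Pt (Num.max s 0) i j.

Lemma ptransE i j (s : R) : 0 <= s -> ptrans i j s = Pt s i j.
Proof. by move=> s0; rewrite /ptrans max_l. Qed.

Lemma ptrans_ge0 i j (s : R) : 0 <= ptrans i j s.
Proof. by rewrite transition_ge0// le_max lexx orbT. Qed.

Lemma ptrans_le1 i j (s : R) : ptrans i j s <= 1.
Proof. by rewrite transition_le1// le_max lexx orbT. Qed.

Lemma continuous_ptrans i j : continuous (ptrans i j).
Proof.
case: HP => h0 _ _ hc hd t; have [t0|t0|t0] := ltgtP t 0.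
- have : {near t, (fun=> Pt 0 i j) =1 ptrans i j}.
    near=> s; rewrite /ptrans max_r//; apply: ltW; near: s; exact: lt_nbhsl.
  move=> h; apply: (cvg_trans (near_eq_cvg h)).
  by rewrite /ptrans max_r ?(ltW t0)//; exact: cvg_cst.
- have : {near t, (fun s => Pt s i j) =1 ptrans i j}.
    near=> s; rewrite /ptrans max_l//; apply: ltW; near: s; exact: lt_nbhsr.
  move=> h; apply: (cvg_trans (near_eq_cvg h)); rewrite ptransE ?(ltW t0)//.
  have ct : {for t, continuous (fun s : R => Pt s i j)}.
    apply: differentiable_continuous; apply/derivable1_diffP.
    by have [] := is_derive_transition i j t0.
  exact: ct.
- rewrite t0; apply/cvgrPdist_lt => e e0; rewrite ptransE//.
  have /cvgrPdist_lt/(_ e e0) := hc i j; rewrite near_withinE => h.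
  near=> s; rewrite /ptrans; have [s0|s0] := ltP s 0.
    by rewrite subrr normr0.
  move: s0; rewrite le_eqVlt => /predU1P[<-|s0]; first by rewrite subrr normr0.
  by move: s0; near: s.
Unshelve. all: by end_near. Qed.

Lemma measurable_ptrans i j A : measurable_fun A (ptrans i j).
Proof. by apply: measurable_funTS; apply: continuous_measurable_fun; exact: continuous_ptrans. Qed.

Definition occ (t : R) i j : R := (\int[mes]_(s in `[0%R, t]) ptrans i j s)%R.

Lemma integrable_ptrans i j (t : R) : mes.-integrable `[0, t] (EFin \o ptrans i j).
Proof.
apply: continuous_compact_integrable; first exact: segment_compact.
by apply: continuous_subspaceT; exact: continuous_ptrans.
Qed.

Lemma EFin_occ (t : R) i j : (occ t i j)%:E = (\int[mes]_(s in `[0%R, t]) (ptrans i j s)%:E)%E.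
Proof. by rewrite /occ /Rintegral fineK//; exact/integrable_fin_num/integrable_ptrans. Qed.

Lemma occ0 i j : occ 0 i j = 0.
Proof. by rewrite /occ set_itv1 Rintegral_set1. Qed.

Lemma occ_ge0 (t : R) i j : 0 <= occ t i j.
Proof. by apply: Rintegral_ge0 => s _; exact: ptrans_ge0. Qed.

Lemma occ_le (t : R) i j : 0 <= t -> occ t i j <= t.
Proof.
move=> t0; rewrite -lee_fin EFin_occ.
apply: (@le_trans _ _ (\int[mes]_(s in `[0%R, t]) 1)%E).
  apply: ge0_le_integral => //.
  - by move=> s _; rewrite lee_fin ptrans_ge0.
  - by apply/measurable_EFinP; exact: measurable_ptrans.
  - by move=> s _; rewrite lee_fin ptrans_le1.
rewrite integral_cst//= mul1e lebesgue_measure_itv/= lte_fin.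
by case: ltP => // _; rewrite ?sube0 ?oppr0 ?adde0// lee_fin.
Qed.

Lemma is_derive_occ (t : R) i j : 0 < t -> is_derive t 1 (fun u => occ u i j) (Pt t i j).
Proof.
move=> t0; have tt : t < t + 1 by rewrite ltrDl.
have [d1 d2] := @continuous_FTC1_closed R (ptrans i j) 0 t (t + 1) tt
  (integrable_ptrans i j (t + 1)) t0 (@continuous_ptrans i j t).
by apply: DeriveDef => //; rewrite -derive1E d2 ptransE// ltW.
Qed.

Lemma cvg_occ i j : occ u i j @[u --> 0^'+] --> occ 0 i j.
Proof.
rewrite occ0; apply/cvgrPdist_lt => e e0; near=> u.
have u0 : 0 <= u by near: u; exact: nbhs_right_ge.
rewrite sub0r normrN ger0_norm ?occ_ge0//; apply: (le_lt_trans (occ_le _ _ u0)).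
by near: u; exact: nbhs_right_lt.
Unshelve. all: by end_near. Qed.

(** The backward equation integrated from 0: the difference [v] has zero derivative for t > 0 and is
    right-continuous at 0, hence keeps its initial value. *)
Lemma erlang_gen_occ (t : R) i j : 0 <= t ->
  gen (fun p => occ t p j) i = Pt t i j - (i == j)%:R.
Proof.
move=> t0; case: HP => h0 _ _ hc _.
pose v (s : R) := gen (fun p => occ s p j) i - Pt s i j.
have dv (s : R) : 0 < s -> is_derive s 1 v 0.
  move=> s0; rewrite -[X in is_derive _ _ _ X](subrr (gen (fun p => Pt s p j) i)).
  apply: is_deriveB; last exact: is_derive_transition.
  by apply: (@is_derive_erlang_gen _ _ _ _ (fun s p => occ s p j)) => p; exact: is_derive_occ.
have cv : v u @[u --> 0^'+] --> v 0.
  apply: cvgB; last exact: hc.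
  by apply: (@cvg_erlang_gen _ _ _ _ (fun s p => occ s p j)) => p; exact: cvg_occ.
have : `|v t - v 0| <= (cst 0 : R -> R) t - (cst 0 : R -> R) 0.
  apply: (@le_increment R v (cst 0) (cst 0) (cst 0) t t0 cv (cvg_cst _) dv).
  by move=> s _; rewrite normr0.
rewrite subrr normr_le0 subr_eq0 => /eqP.
rewrite /v; have -> : gen (fun p => occ 0 p j) i = 0.
  by rewrite (_ : (fun p => _) = fun=> 0) ?erlang_gen_cst//; apply/funext => p; exact: occ0.
rewrite h0; lra.
Qed.

(** A finite list is enough, since n <= g(n, s) and s <= k on valid states. *)
Definition box (N : nat) : seq state :=
  [seq j <- [seq (a, b) | a <- iota 0 N.+1, b <- iota 0 k.+1] | valid j && (g j < N)%N].

Lemma box_uniq N : uniq (box N).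
Proof.
apply: filter_uniq; apply: allpairs_uniq; rewrite ?iota_uniq// => -[a b] [c d] _ _ /=.
by move=> [-> ->].
Qed.

Lemma mem_box N j : (j \in box N) = valid j && (g j < N)%N.
Proof.
rewrite mem_filter; case: (boolP (valid j && (g j < N)%N)) => [/andP[vj gj]|//]; rewrite andTb.
case: j vj gj => [[|n] s].
  rewrite /erlang_state/= => /orP[/eqP[->] _|//].
  by rewrite inE eqxx.
rewrite /erlang_state/= => /andP[s1 sk] gj.
suff : (n.+1, s) \in [seq (a, b) | a <- iota 0 N.+1, b <- iota 0 k.+1] by [].
apply/allpairsP; exists (n.+1, s).
rewrite !mem_iota/= !add0n !ltnS sk; split => //.
have : (n <= k * n)%N by rewrite leq_pmull.
lia.
Qed.

(** From a valid state this is E (N - g)^+, so that N - [tail_mean] is E min(N, g); the sum is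
    finite and can be differentiated term by term. *)
Definition tail_mean (N : nat) (t : R) i : R := \sum_(j <- box N) Pt t i j * (N - g j)%N%:R.

Lemma is_derive_tail_mean N (t : R) i : 0 < t ->
  is_derive t 1 (fun u => tail_mean N u i) (gen (tail_mean N t) i).
Proof.
move=> t0; rewrite /tail_mean erlang_gen_sum; apply: is_derive_sum_seq => j.
rewrite (_ : (fun=> _) = (N - g j)%N%:R *: (fun u => Pt u i j)); last first.
  by apply/funext => u; rewrite mulrC.
rewrite (_ : (fun j0 => _) = (fun j0 => (N - g j)%N%:R * Pt t j0 j)); last first.
  by apply/funext => u; rewrite mulrC.
by rewrite erlang_genZ; apply: is_deriveZ; exact: is_derive_transition.
Qed.

(** Candidate for the mean. On valid states its generator and its time derivative are both k (lam -
    mu) + k mu p_{i,0}(t), by [erlang_gen_g] and [erlang_gen_occ]. *)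
Definition mean_length (t : R) i : R :=
  (g i)%:R + k%:R * (lam - mu) * t + k%:R * mu * occ t i (0, 0)%N.

(* The difference solves the backward equation, with an initial value bounded by
   (g - N)^+ <= 2^{-N} 2^g. *)
Lemma truncated_mean N (t : R) i : 0 <= t -> valid i ->
  `|mean_length t i - (N%:R - tail_mean N t i)| <= 2 ^- N * expR (K * t) * 2 ^+ g i.
Proof.
move=> t0 vi; case: HP => h0 _ _ hc _.
pose v (s : R) p := mean_length s p + (tail_mean N s p - N%:R).
have -> : mean_length t i - (N%:R - tail_mean N t i) = v t i by rewrite /v; ring.
(* On [0, t] everything in [v] except the initial term g is at most [C]; since g and 1 are below
   2^g, this gives the a priori bound (1 + C) 2^g. *)
pose C : R := `|k%:R * (lam - mu)| * t + k%:R * mu * t + N%:R + \sum_(j <- box N) (N - g j)%N%:R.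
have kmu0 : 0 <= k%:R * mu by rewrite mulr_ge0// ltW.
have S0 : 0 <= \sum_(j <- box N) (N - g j)%N%:R :> R by apply: sumr_ge0.
have C0 : 0 <= C by rewrite !addr_ge0// mulr_ge0.
apply: (@backward_bound R k lam mu k1 lam0 mu0 v t (1 + C) (2 ^- N)).
- by rewrite addr_ge0.
- by rewrite invr_ge0 exprn_ge0.
- move=> p vp; apply: cvgD; last first.
    apply: cvgB; last exact: cvg_cst.
    by apply: cvg_sum_seq => j; apply: cvgMl; exact: hc.
  apply: cvgD; last by apply: cvgMr; exact: cvg_occ.
  apply: cvgD; first exact: cvg_cst.
  by apply: cvgMr; apply: cvg_at_right_filter; exact: cvg_id.
- move=> s p vp s0.
  have -> : gen (v s) p = k%:R * (lam - mu) * 1 + k%:R * mu * Pt s p (0, 0)%N + gen (tail_mean N s) p.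
    rewrite /v /mean_length !erlang_genD !erlang_genZ !erlang_gen_cst erlang_gen_g// erlang_gen_occ ?(ltW s0)//.
    by case: eqP => _ /=; ring.
  have d1 := is_deriveZ (k%:R * (lam - mu)) (is_derive_id (V := R) s (1 : R)).
  have d2 := is_deriveZ (k%:R * mu) (is_derive_occ p (0, 0)%N s0).
  have d3 := is_derive_tail_mean N p s0.
  have d4 := is_deriveD (is_deriveD (is_deriveD (is_derive_cst ((g p)%:R : R) s (1 : R)) d1) d2)
    (is_deriveB d3 (is_derive_cst (N%:R : R) s (1 : R))).
  rewrite add0r subr0 in d4; exact: d4.
- move=> s p vp /andP[s0 st].
  have G1 : 1 <= 2 ^+ g p :> R by rewrite exprn_ege1// ler1n.
  have Gg : (g p)%:R <= 2 ^+ g p :> R by rewrite -natrX ler_nat ltnW// ltn_expl.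
  have T1 : 0 <= tail_mean N s p by apply: sumr_ge0 => j _; rewrite mulr_ge0// transition_ge0.
  have T2 : tail_mean N s p <= \sum_(j <- box N) (N - g j)%N%:R.
    by apply: ler_sum => j _; rewrite ler_piMl// transition_le1.
  have a0 := occ_ge0 s p (0, 0)%N; have a1 := occ_le p (0, 0)%N s0.
  have b0 : 0 <= k%:R * mu * occ s p (0, 0)%N by rewrite mulr_ge0.
  have b1 : k%:R * mu * occ s p (0, 0)%N <= k%:R * mu * t by rewrite ler_wpM2l// (le_trans a1).
  have b2 : `|k%:R * (lam - mu) * s| <= `|k%:R * (lam - mu)| * t.
    by rewrite normrM (ger0_norm s0) ler_wpM2l.
  have g0 : 0 <= (g p)%:R :> R by [].
  have N0 : 0 <= N%:R :> R by [].
  have h1 : C <= C * 2 ^+ g p by rewrite ler_peMr.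
  have h2 : `|v s p| <= (g p)%:R + C.
    move: b2; rewrite /v /mean_length /C !ler_norml => /andP[b2 b3].
    have := mulr_ge0 kmu0 t0.
    by move=> ?; apply/andP; split; lra.
  rewrite (mulrDl 1 C) mul1r; lra.
- move=> p vp; rewrite /v /mean_length mulr0 addr0 occ0 mulr0 addr0.
  have -> : tail_mean N 0 p = (N - g p)%N%:R.
    rewrite /tail_mean; under eq_bigr do rewrite h0.
    have [pN|pN] := boolP (p \in box N).
      rewrite (bigD1_seq p) ?box_uniq//= eqxx mul1r big1 ?addr0// => j /negbTE.
      by rewrite eq_sym => ->; rewrite mul0r.
    rewrite big1_seq => [|j /andP[_ jN]]; last first.
      by case: eqP => [e|_]; [rewrite e jN in pN|rewrite mul0r].
    move: pN; rewrite mem_box vp/= -leqNgt => gN.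
    by move: gN; rewrite -subn_eq0 => /eqP ->.
  have [gN|gN] := leqP (g p) N.
    have -> : (g p)%:R + ((N - g p)%N%:R - N%:R) = 0 :> R by rewrite natrB//; ring.
    by rewrite normr0 mulr_ge0 ?invr_ge0 ?exprn_ge0.
  rewrite (_ : (N - g p)%N = 0%N); last by apply/eqP; rewrite subn_eq0 ltnW.
  rewrite add0r -natrB ?(ltnW gN)// ger0_norm//.
  rewrite (_ : 2 ^+ g p = 2 ^+ (g p - N) * 2 ^+ N); last by rewrite -exprD subnK// ltnW.
  rewrite mulrCA mulVf ?mulr1 ?expf_neq0//.
  by rewrite -natrX ler_nat ltnW// ltn_expl.
- by [].
- by rewrite t0 lexx.
Qed.

(** Passing from N to N + 1 raises (N - g)^+ by 1 exactly on {g <= N}, an event of probability at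
    most 1. States with g = N contribute 0 to the old sum by truncated subtraction. *)
Lemma tail_mean_nd N (t : R) i : 0 <= t ->
  N%:R - tail_mean N t i <= N.+1%:R - tail_mean N.+1 t i.
Proof.
move=> t0.
have -> : tail_mean N t i = \sum_(j <- box N.+1) Pt t i j * (N - g j)%N%:R.
  rewrite (bigID (fun j => (g j < N)%N))/= [X in _ = _ + X]big1 ?addr0; last first.
    by move=> j; rewrite -leqNgt -subn_eq0 => /eqP ->; rewrite mulr0.
  rewrite -big_filter /tail_mean; apply: perm_big; apply: uniq_perm.
  - exact: box_uniq.
  - by apply: filter_uniq; exact: box_uniq.
  - move=> j; rewrite [in RHS]mem_filter !mem_box andbCA; congr (_ && _).
    by case: ltnP => //= jN; rewrite (leq_trans jN).
have -> : tail_mean N.+1 t i = \sum_(j <- box N.+1) (Pt t i j * (N - g j)%N%:R + Pt t i j).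
  rewrite /tail_mean big_seq [RHS]big_seq; apply: eq_bigr => j.
  rewrite mem_box => /andP[_]; rewrite ltnS => jN.
  by rewrite subSn// -natr1 mulrDr mulr1.
rewrite big_split/= -natr1; have := transition_sum_le1 i t0 (box_uniq N.+1); lra.
Qed.

Lemma cvg_tail_mean (t : R) i : 0 <= t -> valid i ->
  (N%:R - tail_mean N t i) @[N --> \oo] --> mean_length t i.
Proof.
move=> t0 vi; apply/cvgrPdist_le => e e0.
have : (2^-1 ^+ N * (expR (K * t) * 2 ^+ g i)) @[N --> \oo] --> (0 : R).
  rewrite -[X in _ --> X](mul0r (expR (K * t) * 2 ^+ g i)); apply: cvgMl.
  by apply: cvg_expr; rewrite ger0_norm ?invf_lt1// ?ltr1n// invr_ge0.
move/cvgrPdist_le/(_ e e0) => h; near=> N.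
apply: (le_trans (truncated_mean N t0 vi)).
have : `|0 - 2^-1 ^+ N * (expR (K * t) * 2 ^+ g i)| <= e by near: N.
rewrite sub0r normrN ger0_norm; first by rewrite exprVn mulrA.
by rewrite !mulr_ge0 ?exprn_ge0 ?expR_ge0 ?invr_ge0.
Unshelve. all: by end_near. Qed.

End transition.

(** * Occupation times of the inverse subordinator *)

Section subordinator.
Context {R : realType} {d : measure_display} {Omega : measurableType d}.
Variables (P : probability Omega R) (theta alpha : R) (D : R -> Omega -> R).
Hypotheses (theta0 : 0 < theta) (alpha01 : 0 < alpha < 1).
Hypothesis HD : tempered_subordinator P theta alpha D.
Local Notation mu := (@lebesgue_measure R).

Definition laplace_exponent (s : R) : R := (s + theta) `^ alpha - theta `^ alpha.
Local Notation phi := laplace_exponent.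

Lemma laplace_exponent_gt0 s : 0 < s -> 0 < phi s.
Proof.
move=> s0; have /andP[a0 _] := alpha01.
by rewrite subr_gt0 gt0_ltr_powR ?nnegrE ?addr_ge0 ?ltW// ltrDr.
Qed.

(** Unboundedness of phi, in the form that forces D(h) > 0 almost surely; the witness inverts phi
    explicitly. *)
Lemma laplace_exponent_surj M : 0 < M -> exists2 s, 0 < s & phi s = M.
Proof.
move=> M0; have /andP[a0 _] := alpha01.
exists ((theta `^ alpha + M) `^ alpha^-1 - theta).
  rewrite subr_gt0 -[ltLHS]powRr1 ?(ltW theta0)// -(mulfV (lt0r_neq0 a0)) powRrM.
  rewrite gt0_ltr_powR ?invr_gt0 ?nnegrE ?powR_ge0 ?addr_ge0 ?powR_ge0 ?(ltW M0)//.
  by rewrite ltrDl.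
rewrite /phi subrK -powRrM mulVf ?lt0r_neq0// powRr1.
  by rewrite addrAC subrr add0r.
by rewrite addr_ge0 ?powR_ge0 ?ltW.
Qed.

Lemma measurable_subordinator x : measurable_fun [set: Omega] (D x).
Proof. by case: HD => -[]. Qed.

Lemma subordinator_nd w (x y : R) : 0 <= x -> x <= y -> D x w <= D y w.
Proof. by case: HD => -[_ _ h _] _; exact: h. Qed.

Lemma subordinator_ge0 w (x : R) : 0 <= x -> 0 <= D x w.
Proof.
move=> x0; case: HD => -[_ h _ _] _; rewrite -(h w); exact: subordinator_nd.
Qed.

Lemma laplace_subordinator (x s : R) : 0 <= x -> 0 <= s ->
  (\int[P]_w (expR (- (s * D x w)))%:E = (expR (- (x * phi s)))%:E)%E.
Proof. by case: HD => _ [_ _ h]; exact: h. Qed.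

(* Clamped as in [ptrans]. *)
Definition dsub (z : measurableTypeR R * Omega) : R := D (Num.max z.1 0) z.2.

Lemma dsubE (v : R) w : 0 <= v -> dsub (v, w) = D v w.
Proof. by move=> v0; rewrite /dsub/= max_l. Qed.

(** By monotonicity and right-continuity, D(v) < a holds iff D(q) < a for some rational q > v; this
    gives a countable union of measurable rectangles. *)
Lemma measurable_dsub : measurable_fun [set: measurableTypeR R * Omega] dsub.
Proof.
apply: (measurability _ (RGenInftyO.measurableE R)) => _ [_ [a ->] <-].
rewrite setTI.
have -> : dsub @^-1` `]-oo, a[ = \bigcup_(q : rat)
    ([set z : measurableTypeR R * Omega | z.1 < ratr q /\ D (Num.max (ratr q) 0) z.2 < a]).
  apply/seteqP; split => -[v w] /=; rewrite in_itv/=; last first.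
    move=> [q _ /= [vq]]; apply: le_lt_trans; apply: subordinator_nd.
      by rewrite le_max lexx orbT.
    by rewrite ge_max !le_max lexx orbT (ltW vq).
  rewrite /dsub/=; set m := Num.max v 0 => Da.
  have m0 : 0 <= m by rewrite le_max lexx orbT.
  case: HD => -[_ _ _ /(_ w m m0)/cvgrPdist_lt rc] _.
  have e0 : 0 < a - D m w by rewrite subr_gt0.
  have := rc _ e0; rewrite near_withinE => /nbhs_ballP[e /= e1 he].
  have me : m < m + e by rewrite ltrDl.
  have [q] := rat_in_itvoo me.
  rewrite in_itv/= => /andP[mq qe]; exists q => //=.
  have vm : v <= m by rewrite le_max lexx.
  split; first exact: le_lt_trans mq.
  rewrite max_l; last by rewrite ltW// (le_lt_trans m0).
  have := he (ratr q); rewrite /ball/= ltr0_norm; last by rewrite subr_lt0.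
  move=> /(_ ltac:(by rewrite opprB ltrBlDl) mq).
  have Dm : D m w <= D (ratr q) w by apply: subordinator_nd => //; exact: ltW.
  by rewrite ler0_norm ?subr_le0// opprB ltrD2r.
apply: bigcupT_measurable_rat => q.
have -> : [set z : measurableTypeR R * Omega | z.1 < ratr q /\ D (Num.max (ratr q) 0) z.2 < a] =
    `]-oo, (ratr q : R)[%classic `*` (D (Num.max (ratr q) 0) @^-1` `]-oo, a[).
  by apply/seteqP; split => -[v w] /=; rewrite !in_itv.
apply: measurableX; first exact: measurable_itv.
by rewrite -[X in measurable X]setTI; apply: measurable_subordinator => //; exact: measurable_itv.
Qed.

(** On a path that exceeds t, the section at w is [0, Y(t)] up to its right endpoint. *)
Definition subset_le (t : R) : set (measurableTypeR R * Omega) :=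
  [set z | 0 <= z.1 /\ dsub z <= t].

Lemma measurable_subset_le t : measurable (subset_le t).
Proof.
have -> : subset_le t = (fst @^-1` `[0, +oo[) `&` (dsub @^-1` `]-oo, t]).
  by apply/seteqP; split => z; rewrite /subset_le/= !in_itv/= andbT.
apply: measurableI; rewrite -[X in measurable X]setTI.
  by apply: measurable_fst => //; exact: measurable_itv.
by apply: measurable_dsub => //; exact: measurable_itv.
Qed.

Definition occupation (f : R -> R) (t : R) : \bar R :=
  (\int[P]_w \int[mu]_v (f v * \1_(subset_le t) (v, w))%:E)%E.

Section weight.
Variable f : R -> R.
Hypotheses (mf : measurable_fun [set: R] f) (f0 : forall v, 0 <= f v).

Let F t (z : measurableTypeR R * Omega) : \bar R := (f z.1 * \1_(subset_le t) z)%:E.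

Let mF t : measurable_fun [set: measurableTypeR R * Omega] (F t).
Proof.
apply/measurable_EFinP; apply: measurable_funM; first exact: measurableT_comp.
by apply: measurable_indic; exact: measurable_subset_le.
Qed.

Let F0 t z : (0 <= F t z)%E. Proof. by rewrite lee_fin mulr_ge0. Qed.

Lemma occupation_ge0 t : (0 <= occupation f t)%E.
Proof.
apply: integral_ge0 => w _; apply: integral_ge0 => v _.
by rewrite lee_fin mulr_ge0.
Qed.

Lemma occupation_prod t :
  occupation f t = (\int[(mu \x P)%E]_(z in subset_le t) (f z.1)%:E)%E.
Proof.
rewrite integral_mkcond -[LHS](@fubini_tonelli2 _ _ _ _ R mu P _ (mF t) (F0 t)).
apply: eq_integral => z _; rewrite /F patchE indicE.
by case: (z \in _); rewrite ?mulr1 ?mulr0.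
Qed.

Lemma occupation_nd s t : s <= t -> (occupation f s <= occupation f t)%E.
Proof.
move=> st; rewrite !occupation_prod; apply: ge0_subset_integral.
- exact: measurable_subset_le.
- exact: measurable_subset_le.
- by apply/measurable_EFinP; apply: measurable_funTS; exact: measurableT_comp.
- by move=> z _; rewrite lee_fin.
- by move=> z [z0 zs]; split => //; exact: le_trans st.
Qed.

Let step_exp (s a : R) : 0 < s -> 0 <= a ->
  (\int[mu]_(t in `[0%R, +oo[) ((expR (- (s * t)) * (a <= t)%R%:R)%:E)  = (expR (- (s * a)) / s)%:E)%E.
Proof.
move=> s0 a0; rewrite [RHS]EFinM -(laplace_cst1 s0) [LHS]integral_mkcond.
rewrite /laplace [in RHS]integral_mkcond.
pose h : R -> \bar R := (fun t : R => (expR (- (s * t)))%:E * 1)%E \_ `[0, +oo[.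
rewrite -(@ge0_integral_shiftZ R h _ a).
- apply: eq_integral => t _; rewrite /h !patchE !mem_setE !in_itv/= !andbT subr_ge0.
  case: (leP a t) => at_; last by rewrite mulr0 mule0; case: ifP.
  by rewrite (le_trans a0 at_) mulr1 mule1 -EFinM -expRD; congr (expR _)%:E; ring.
- apply/(measurable_restrictT _ _).1 => //; apply: emeasurable_funM => //.
  by apply/measurable_EFinP; apply: measurable_funTS; exact: measurable_expRM.
- by move=> t; apply: erestrict_ge0 => u _; rewrite mule1 lee_fin expR_ge0.
- by rewrite lee_fin expR_ge0.
Qed.

(** Two Tonelli exchanges bring the integral in t innermost, where it gives e^{-s D(v)} / s. A third
    puts the expectation inside the integral in v, where it gives e^{-v phi(s)} / s. *)
Lemma laplace_occupation s : 0 < s ->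
  laplace (occupation f) s = (laplace (EFin \o f) (phi s) * (s^-1)%:E)%E.
Proof.
move=> s0.
pose e (t : R) : R := expR (- (s * t)).
have me : measurable_fun [set: R] e by exact: measurable_expRM.
(* With the indicator written as a product of boolean comparisons, joint measurability in (t, v, w)
   follows from that of the order. *)
pose le3 (x : (R * (measurableTypeR R * Omega))%type) : R := (0 <= x.2.1)%R%:R * (dsub x.2 <= x.1)%R%:R.
have indE t z : \1_(subset_le t) z = le3 (t, z).
  rewrite /le3 indicE /=; case: (leP 0 z.1) => z0; case: (leP (dsub z) t) => zt;
   rewrite ?mulr1 ?mulr0.
  - by rewrite mem_set.
  - by rewrite memNset// => -[_]; rewrite leNgt zt.
  - by rewrite memNset// => -[]; rewrite leNgt z0.
  - by rewrite memNset// => -[]; rewrite leNgt z0.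
have mnat (b : bool -> R) : measurable_fun [set: bool] b by [].
have mle3 : measurable_fun [set: R * (measurableTypeR R * Omega)] le3.
  apply: measurable_funM.
    apply: (measurableT_comp (mnat (fun b => b%:R))); apply: measurable_fun_ler => //.
    by apply: measurableT_comp => //; exact: measurableT_comp.
  apply: (measurableT_comp (mnat (fun b => b%:R))); apply: measurable_fun_ler => //.
  by apply: measurableT_comp => //; exact: measurable_dsub.
pose G (x : (measurableTypeR R * (measurableTypeR R * Omega))%type) : \bar R :=
  ((e x.1 * (0 <= x.1)%R%:R) * (f x.2.1 * le3 x))%:E.
have mG : measurable_fun setT G.
  apply/measurable_EFinP; apply: measurable_funM.
    apply: measurable_funM; first exact: measurableT_comp.
    by apply: (measurableT_comp (mnat (fun b => b%:R))); apply: measurable_fun_ler.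
  apply: measurable_funM; last exact: mle3.
  by apply: measurableT_comp => //; exact: measurableT_comp.
have G0 x : (0 <= G x)%E by rewrite lee_fin !mulr_ge0 ?expR_ge0.
have mGtv w : measurable_fun [set: measurableTypeR R * measurableTypeR R]
    (fun y : measurableTypeR R * measurableTypeR R => G (y.1, (y.2, w))).
  apply: (measurableT_comp mG); apply: measurable_fun_pair => //.
  by apply: measurable_fun_pair => //; exact: measurable_cst.
pose G' (y : ((measurableTypeR R * Omega) * measurableTypeR R)%type) : \bar R :=
  G (y.1.1, (y.2, y.1.2)).
(* [G'] regroups the coordinates as ((t, w), v), which makes [G1] a Fubini marginal. *)
have mG' : measurable_fun setT G'.
  apply: (measurableT_comp mG); apply: measurable_fun_pair => //.
    exact: measurableT_comp.
  by apply: measurable_fun_pair => //; exact: measurableT_comp.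
pose G1 (y : (measurableTypeR R * Omega)%type) : \bar R := (\int[mu]_v G (y.1, (v, y.2)))%E.
have mG1 : measurable_fun setT G1.
  exact: (@measurable_fun_fubini_tonelli_F _ _ _ _ R mu G' mG' (fun y => G0 _)).
have G10 y : (0 <= G1 y)%E by exact: integral_ge0.
have -> : laplace (occupation f) s = (\int[mu]_t \int[P]_w G1 (t, w))%E.
  rewrite /laplace integral_mkcond; apply: eq_integral => t _; rewrite patchE mem_setE in_itv/= andbT.
  rewrite /occupation /G1 /G/=.
  case: ifPn => t0; last first.
    rewrite integral0_eq// => w _; rewrite integral0_eq// => v _; by rewrite mulr0 mul0r.
  have e0 : (0 <= (expR (- (s * t)))%:E)%E by rewrite lee_fin expR_ge0.
  rewrite -(@ge0_integralZl _ _ R P setT measurableT _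
    (measurable_fun_fubini_tonelli_G (m1 := mu) _ (mF t) (F0 t)) _ _ e0); last first.
    by move=> w _; apply: integral_ge0 => v _; exact: F0.
  apply: eq_integral => w _; rewrite /fubini_G -ge0_integralZl//.
  - by apply: eq_integral => v _; rewrite /F indE mulr1 -EFinM.
  - by apply: (measurableT_comp (mF t)); apply: measurable_fun_pair.
rewrite (@fubini_tonelli _ _ _ _ R mu P G1 mG1 G10) /G1/=.
transitivity (\int[P]_w \int[mu]_v \int[mu]_t G (t, (v, w)))%E.
  apply: eq_integral => w _.
  exact: (@fubini_tonelli _ _ _ _ R mu mu _ (mGtv w) (fun y => G0 _)).
have inner z : (\int[mu]_t G (t, z) =
    ((f z.1 * (0 <= z.1)%R%:R) * (expR (- (s * dsub z)) / s))%:E)%E.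
  have zD : 0 <= dsub z by apply: subordinator_ge0; rewrite le_max lexx orbT.
  rewrite [RHS]EFinM -(step_exp s0 zD) [in RHS]integral_mkcond -ge0_integralZl//.
  - apply: eq_integral => t _; rewrite patchE mem_setE in_itv/= andbT /G /le3/= /e.
    by case: (0 <= t); rewrite ?mulr0 ?mul0r ?mule0// mulr1 -EFinM; congr EFin; ring.
  - apply/(measurable_restrictT _ _).1 => //; apply/measurable_EFinP; apply: measurable_funTS.
    apply: measurable_funM; first exact: measurable_expRM.
    by apply: (measurableT_comp (mnat (fun b => b%:R))); apply: measurable_fun_ler.
  - by move=> t _; apply: erestrict_ge0 => u _; rewrite lee_fin mulr_ge0 ?expR_ge0.
  - by rewrite lee_fin mulr_ge0.
pose G2 (z : measurableTypeR R * Omega) : \bar R :=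
  ((f z.1 * (0 <= z.1)%R%:R) * (expR (- (s * dsub z)) / s))%:E.
have mexpd : measurable_fun [set: measurableTypeR R * Omega] (fun z => expR (- (s * dsub z))).
  exact: (measurableT_comp (measurable_expRM s) measurable_dsub).
have mG2 : measurable_fun setT G2.
  apply/measurable_EFinP; apply: measurable_funM; last exact: measurable_funM.
  apply: measurable_funM; first exact: measurableT_comp.
  by apply: (measurableT_comp (mnat (fun b => b%:R))); apply: measurable_fun_ler.
have G20 z : (0 <= G2 z)%E.
  by rewrite lee_fin !mulr_ge0 ?expR_ge0// invr_ge0 ltW.
transitivity (\int[P]_w \int[mu]_v G2 (v, w))%E.
  by apply: eq_integral => w _; apply: eq_integral => v _; exact: inner.
rewrite -(@fubini_tonelli _ _ _ _ R mu P G2 mG2 G20).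
have si0 : (0 <= (s^-1)%:E)%E by rewrite lee_fin invr_ge0 ltW.
rewrite /laplace [in RHS]integral_mkcond -ge0_integralZr//; first last.
- by move=> v _; apply: erestrict_ge0 => u _; rewrite mule_ge0// lee_fin ?expR_ge0.
- apply/(measurable_restrictT _ _).1 => //; apply: measurable_funTS; apply: emeasurable_funM.
    by apply/measurable_EFinP; exact: measurable_expRM.
  exact/measurable_EFinP.
apply: eq_integral => v _; rewrite patchE mem_setE in_itv/= andbT /G2/=.
case: (leP 0 v) => v0; last first.
  by rewrite mul0e integral0_eq// => w _; rewrite mulr0 mul0r.
transitivity (\int[P]_w ((f v / s)%:E * (expR (- (s * D v w)))%:E))%E.
  apply: eq_integral => w _; rewrite dsubE// mulr1 -EFinM; congr EFin; ring.
rewrite ge0_integralZl//; first last.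
- by rewrite lee_fin divr_ge0// ltW.
- by apply/measurable_EFinP; exact: (measurableT_comp (measurable_expRM s) (measurable_subordinator v)).
rewrite laplace_subordinator ?(ltW s0)// -!EFinM mulrC; congr EFin.
by rewrite [phi s * v]mulrC /=; ring.
Qed.

End weight.

End subordinator.

Lemma nondecreasing_continuous (R : realType) (F : R -> R) :
  {homo F : s t / s <= t} ->
  (forall t e : R, 0 < e -> exists2 r, 0 < r & F (t + r) - F (t - r) < e) ->
  continuous F.
Proof.
move=> ndF h; suff main (t : R) : F s @[s --> t] --> F t by exact: main.
apply/cvgrPdist_lt => e e0; have [r r0 key] := h t e e0.
near=> s.
have : `|t - s| < r by near: s; exists r => //=.
rewrite ltr_norml => /andP[s1 s2].
have l1 : F (t - r) <= F s by apply: ndF; lra.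
have l2 : F s <= F (t + r) by apply: ndF; lra.
have l3 : F (t - r) <= F t by apply: ndF; lra.
have l4 : F t <= F (t + r) by apply: ndF; lra.
by rewrite ltr_norml; apply/andP; split; lra.
Unshelve. all: by end_near. Qed.

(** * Finiteness and continuity of occupation integrals *)

Section occupation.
Context {R : realType} {d : measure_display} {Omega : measurableType d}.
Variables (P : probability Omega R) (theta alpha : R) (D : R -> Omega -> R).
Hypotheses (theta0 : 0 < theta) (alpha01 : 0 < alpha < 1).
Hypothesis HD : tempered_subordinator P theta alpha D.
Local Notation mu := (@lebesgue_measure R).
Local Notation phi := (laplace_exponent theta alpha).
Local Notation Sle := (subset_le D).
Local Notation occup := (occupation P D).

Lemma indic_subset_leE (t : R) z : \1_(Sle t) z = (0 <= z.1)%R%:R * (dsub D z <= t)%R%:R :> R.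
Proof.
rewrite indicE /=; case: (leP 0 z.1) => z0; case: (leP (dsub D z) t) => zt; rewrite ?mulr1 ?mulr0.
- by rewrite mem_set.
- by rewrite memNset// => -[_]; rewrite leNgt zt.
- by rewrite memNset// => -[]; rewrite leNgt z0.
- by rewrite memNset// => -[]; rewrite leNgt z0.
Qed.

Let mS (t : R) : measurable (Sle t). Proof. exact: (measurable_subset_le HD). Qed.

Lemma measurable_subset_le_section (f : R -> R) (t : R) : measurable_fun [set: R] f ->
  (forall v, 0 <= f v) ->
  measurable_fun [set: Omega] (fun w => \int[mu]_v (f v * \1_(Sle t) (v, w))%:E)%E.
Proof.
move=> mf f0.
apply: (@measurable_fun_fubini_tonelli_G _ _ _ _ R mu
  (fun z : measurableTypeR R * Omega => (f z.1 * \1_(Sle t) z)%:E)).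
  apply/measurable_EFinP; apply: measurable_funM; first exact: measurableT_comp.
  exact: measurable_indic.
by move=> z; rewrite lee_fin mulr_ge0.
Qed.

Lemma measurable_occupation (f : R -> R) : measurable_fun [set: R] f ->
  (forall v, 0 <= f v) -> measurable_fun [set: R] (occup f).
Proof.
move=> mf f0.
have mnat (b : bool -> R) : measurable_fun [set: bool] b by [].
pose F (y : ((measurableTypeR R * Omega) * measurableTypeR R)%type) : \bar R :=
  (f y.2 * \1_(Sle y.1.1) (y.2, y.1.2))%:E.
have mF : measurable_fun setT F.
  apply/measurable_EFinP; rewrite /F.
  rewrite (_ : (fun _ => _) = (fun y : ((measurableTypeR R * Omega) * measurableTypeR R)%type =>
    f y.2 * ((0 <= y.2)%R%:R * (dsub D (y.2, y.1.2) <= y.1.1)%R%:R))); last first.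
    by apply/funext => y; rewrite indic_subset_leE.
  apply: measurable_funM; first exact: measurableT_comp.
  apply: measurable_funM.
    by apply: (measurableT_comp (mnat (fun b => b%:R))); apply: measurable_fun_ler.
  apply: (measurableT_comp (mnat (fun b => b%:R))); apply: measurable_fun_ler.
    apply: (measurableT_comp (measurable_dsub HD)); apply: measurable_fun_pair => //.
    exact: measurableT_comp.
  exact: measurableT_comp.
have F0 y : (0 <= F y)%E by rewrite lee_fin mulr_ge0.
pose G (y : (measurableTypeR R * Omega)%type) : \bar R := (\int[mu]_v F (y, v))%E.
have mG : measurable_fun setT G.
  exact: (@measurable_fun_fubini_tonelli_F _ _ _ _ R mu F mF F0).
have G0 y : (0 <= G y)%E by apply: integral_ge0 => v _; exact: F0.
exact: (@measurable_fun_fubini_tonelli_F _ _ _ _ R P G mG G0).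
Qed.

Lemma laplace_le1_lty (f : R -> R) (c : R) : 0 < c -> measurable_fun [set: R] f ->
  (forall v, 0 <= f v <= 1) -> (laplace (EFin \o f) c < +oo)%E.
Proof.
move=> c0 mf f01; apply: (@le_lt_trans _ _ (laplace (fun=> 1%E) c)); last first.
  by rewrite laplace_cst1// ltry.
have me : measurable_fun (`[0, +oo[%classic : set R) (fun t : R => (expR (- (c * t)))%:E).
  by apply/measurable_EFinP; apply: measurable_funTS; exact: measurable_expRM.
apply: ge0_le_integral => //.
- by move=> v _; rewrite -EFinM lee_fin mulr_ge0 ?expR_ge0//; case/andP: (f01 v).
- by apply: emeasurable_funM => //; apply/measurable_EFinP; exact: measurable_funTS.
- exact: emeasurable_funM.
- move=> v _; rewrite mule1 -EFinM lee_fin ler_piMr ?expR_ge0//; by case/andP: (f01 v).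
Qed.

Section weight.
Variable f : R -> R.
Hypotheses (mf : measurable_fun [set: R] f) (f01 : forall v, 0 <= f v <= 1).

Let f0 v : 0 <= f v. Proof. by case/andP: (f01 v). Qed.

(** The transform at 1 is finite since f <= 1 and phi(1) > 0; monotonicity in t extends this to
    every t. *)
Lemma occupation_lty (t : R) : (occup f t < +oo)%E.
Proof.
have lty : (laplace (occup f) 1 < +oo)%E.
  rewrite (laplace_occupation HD mf f0 ltr01) invr1 mule1.
  by apply: laplace_le1_lty => //; exact: laplace_exponent_gt0.
apply: (@nd_laplace_lty R _ 1 t ler01 _ _ _ lty).
- exact: measurable_occupation.
- by move=> u; apply: occupation_ge0.
- by move=> u v uv; exact: (occupation_nd HD).
Qed.

Lemma occupation_fin (t : R) : occup f t \is a fin_num.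
Proof. by rewrite ge0_fin_numE ?occupation_ge0// occupation_lty. Qed.

End weight.

(** For f = 1 the occupation integral is finite, so almost every path spends finite time below t; a
    path that never exceeds t would stay there forever. *)
Lemma subordinator_unbounded (t : R) :
  \forall w \ae P, exists2 x : R, 0 < x & t < D x w.
Proof.
have m1 : measurable_fun [set: R] (cst 1 : R -> R) by exact: measurable_cst.
have h1 : (forall v, 0 <= (cst 1 : R -> R) v <= 1) by move=> v; rewrite ler01 lexx.
have := occupation_lty m1 h1 t; rewrite /occupation.
set h := (fun w => _) => hlt.
have mh : measurable_fun setT h by apply: measurable_subset_le_section.
have h0 w : (0 <= h w)%E by apply: integral_ge0 => v _; rewrite lee_fin mulr_ge0.
have ih : P.-integrable setT h.
  apply/integrableP; split => //.
  by under eq_integral do rewrite gee0_abs//.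
apply: filterS (integrable_ae measurableT ih) => w /(_ I) hw.
apply/not_exists2P => nx; move: hw; rewrite fin_numElt => /andP[_].
suff -> : h w = +oo%E by rewrite ltxx.
rewrite /h -(_ : (\int[mu]_(v in `[0%R, +oo[) 1)%E = +oo%E); last first.
  by rewrite integral_cst//= mul1e lebesgue_measure_itv/= ltry addye.
rewrite [RHS]integral_mkcond; apply: eq_integral => v _.
rewrite patchE mem_setE in_itv/= andbT indic_subset_leE/= mul1r.
case: (leP 0 v) => v0; last by rewrite mul0r.
rewrite mul1r dsubE//; have -> // : D v w <= t.
have v1 : 0 < v + 1 by rewrite ltr_wpDl.
have [//|] := nx (v + 1); move/negP; rewrite -leNgt; apply: le_trans.
by apply: (subordinator_nd HD) => //; rewrite lerDl.
Qed.

(** Markov's inequality: P(D(h) <= 0) <= E e^{-s D(h)} = e^{-h phi(s)}, where phi(s) can be made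
    arbitrarily large. *)
Lemma subordinator_gt0 (h : R) : 0 < h -> P [set w | D h w <= 0] = 0%E.
Proof.
move=> h0; set Z := [set w | D h w <= 0].
have mZ : measurable Z.
  rewrite (_ : Z = D h @^-1` `]-oo, 0]); last by apply/seteqP; split => w; rewrite /= in_itv.
  by rewrite -[X in measurable X]setTI; apply: (measurable_subordinator HD) => //; exact: measurable_itv.
have le_exp (M : R) : 0 < M -> (P Z <= (expR (- (h * M)))%:E)%E.
  move=> M0; have [s s0 <-] := laplace_exponent_surj theta0 alpha01 M0.
  rewrite -(laplace_subordinator HD (ltW h0) (ltW s0)).
  rewrite (_ : P Z = \int[P]_w (\1_Z w)%:E)%E; last by rewrite integral_indic// setIT.
  apply: ge0_le_integral => //.
  - by apply/measurable_EFinP; exact: measurable_indic.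
  - by apply/measurable_EFinP; exact: (measurableT_comp (measurable_expRM s) (measurable_subordinator HD h)).
  - move=> w _; rewrite lee_fin indicE; case: (boolP (w \in Z)) => [|_]; last exact: expR_ge0.
    rewrite inE /Z/= => wZ; rewrite -[leLHS]expR0 ler_expR oppr_ge0.
    by rewrite mulr_ge0_le0// ltW.
have fZ : P Z \is a fin_num by rewrite fin_num_measure.
apply/eqP; rewrite eq_le measure_ge0 andbT -(fineK fZ) lee_fin leNgt; apply/negP => r0.
set r := fine (P Z) in r0.
have r1 : r <= 1 by rewrite -lee_fin fineK// probability_le1.
have lr : ln r <= 0 by rewrite ln_le0.
(* If [P Z] were r > 0, this choice of M would give the bound e^{ln r - 1}, which is below r. *)
have M0 : 0 < (1 - ln r) / h by rewrite divr_gt0//; lra.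
have := le_exp _ M0; rewrite -(fineK fZ) lee_fin -/r mulrC divfK ?gt_eqF// opprB leNgt.
by rewrite -[X in _ < X]lnK ?posrE// ltr_expR; lra.
Qed.

(** Stationarity transfers D(h) > 0 to the increments. Rational times keep the exceptional set a
    countable union of null sets; monotone paths then extend strictness to real times. *)
Lemma subordinator_increasing :
  \forall w \ae P, forall p q : rat, 0 <= ratr p :> R -> (ratr p : R) < ratr q -> D (ratr p) w < D (ratr q) w.
Proof.
have h n : \forall w \ae P, forall p q : rat, unpickle n = Some (p, q) ->
    0 <= ratr p :> R -> (ratr p : R) < ratr q -> D (ratr p) w < D (ratr q) w.
  case e : (unpickle n) => [[p q]|]; last by apply: nearW.
  have [p0|p0] := leP 0 (ratr p : R); last first.
    by apply: nearW => w p' q' [<- _]; rewrite leNgt p0.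
  have [pq|pq] := ltP (ratr p : R) (ratr q); last first.
    by apply: nearW => w p' q' [<- <-] _; rewrite ltNge pq.
  have h0 : 0 < ratr q - ratr p :> R by rewrite subr_gt0.
  exists [set w | D (ratr q) w - D (ratr p) w <= 0]; split.
  - rewrite (_ : [set _ | _] = (D (ratr q) \- D (ratr p)) @^-1` `]-oo, 0]); last first.
      by apply/seteqP; split => w; rewrite /= in_itv.
    rewrite -[X in measurable X]setTI.
    by apply: measurable_funB; [exact: (measurable_subordinator HD)|exact: (measurable_subordinator HD)|exact: measurableT|exact: measurable_itv].
  - case: HD => _ [_ st _]; rewrite -(subordinator_gt0 h0).
    have := st (ratr p) (ratr q - ratr p) `]-oo, 0%R]%classic p0 (ltW h0) (measurable_itv _).
    rewrite addrC subrK => e1.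
    rewrite (_ : [set w | D (ratr q) w - D (ratr p) w <= 0] = [set w | `]-oo, 0%R]%classic (D (ratr q) w - D (ratr p) w)]); last first.
      by apply/seteqP; split => w; rewrite /= in_itv.
    rewrite e1; congr (P _); by apply/seteqP; split => w; rewrite /= in_itv.
  - move=> w /= nh; rewrite leNgt; apply/negP => lt; apply: nh => p' q' [<- <-] _ _.
    by rewrite -subr_gt0.
have := ae_foralln h; apply: filterS => w hw p q.
by apply: (hw (pickle (p, q))); rewrite pickleK.
Qed.

(* A strictly increasing path takes the value t at most once. *)
Lemma level_set_null (t : R) : (mu \x P)%E [set z : measurableTypeR R * Omega | 0 <= z.1 /\ dsub D z = t] = 0%E.
Proof.
set Z := [set z | _].
have mZ : measurable Z.
  rewrite (_ : Z = (fst @^-1` `[0, +oo[) `&` (dsub D @^-1` [set t])); last first.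
    by apply/seteqP; split => z; rewrite /Z/= !in_itv/= andbT.
  apply: measurableI; rewrite -[X in measurable X]setTI.
    by apply: measurable_fst => //; exact: measurable_itv.
  by apply: (measurable_dsub HD) => //; exact: measurable_set1.
have mI : measurable_fun [set: measurableTypeR R * Omega] (fun z => (\1_Z z)%:E : \bar R).
  by apply/measurable_EFinP; exact: measurable_indic.
have I0 z : (0 <= (\1_Z z)%:E :> \bar R)%E by rewrite lee_fin.
rewrite (_ : (mu \x P)%E Z = \int[(mu \x P)%E]_z (\1_Z z)%:E)%E; last by rewrite integral_indic// setIT.
rewrite (@fubini_tonelli2 _ _ _ _ R mu P _ mI I0) /fubini_G.
rewrite (@ge0_ae_eq_integral _ _ _ P setT _ (cst 0%E))//.
- by rewrite integral0.
- exact: (@measurable_fun_fubini_tonelli_G _ _ _ _ R mu _ mI I0).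
- by move=> w _; apply: integral_ge0 => v _; exact: I0.
apply: filterS subordinator_increasing => w inc _.
have uniq_level (a b : R) : 0 <= a -> a < b -> D a w = t -> D b w = t -> False.
  move=> a0 ab ea eb.
  have [p] := rat_in_itvoo ab; rewrite in_itv/= => /andP[ap pb].
  have [q] := rat_in_itvoo pb; rewrite in_itv/= => /andP[pq qb].
  have p0 : 0 <= ratr p :> R by rewrite ltW// (le_lt_trans a0).
  have := inc p q p0 pq; rewrite ltNge => /negP; apply.
  apply: (@le_trans _ _ (D b w)).
    by apply: (subordinator_nd HD); [exact: le_trans (ltW pq)|exact: ltW].
  by rewrite eb -ea; apply: (subordinator_nd HD) => //; exact: ltW.
have mY : measurable (ysection Z w) by exact: measurable_ysection.
have -> : (\int[mu]_v (\1_Z (v, w))%:E = mu (ysection Z w))%E.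
  rewrite (_ : mu _ = \int[mu]_v (\1_(ysection Z w) v)%:E)%E; last by rewrite integral_indic// setIT.
  by apply: eq_integral => v _; rewrite !indicE mem_ysection.
have [/eqP|/set0P[a Za]] := boolP (ysection Z w == set0); first by move=> ->; rewrite measure0.
have -> : ysection Z w = [set a]; last by rewrite lebesgue_measure_set1.
move: Za; rewrite /ysection/= inE => -[/= a0]; rewrite dsubE// => ea.
apply/seteqP; split => b /=; last by move=> ->; rewrite inE; split; rewrite ?dsubE.
rewrite inE => -[/= b0]; rewrite dsubE// => eb.
have [ab|ab|//] := ltgtP b a.
- by case: (@uniq_level b a).
- by case: (@uniq_level a b).
Qed.

(** Since f <= 1, the increase from t - r to t + r is at most the measure of the shell [T n], and
    the shells shrink to the null set {D = t}. The case f = 1 makes the first shell finite. *)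
Lemma continuous_occupation (f : R -> R) : measurable_fun [set: R] f ->
  (forall v, 0 <= f v <= 1) -> continuous (fun t => fine (occup f t)).
Proof.
move=> mf f01.
have f0 v : 0 <= f v by case/andP: (f01 v).
apply: nondecreasing_continuous.
  move=> a b ab; apply: fine_le; [exact: occupation_fin|exact: occupation_fin|].
  exact: (occupation_nd HD mf f0 ab).
move=> t e e0.
have m1 : measurable_fun [set: R] (cst 1 : R -> R) by exact: measurable_cst.
have h1 : (forall v, 0 <= (cst 1 : R -> R) v <= 1) by move=> v; rewrite ler01 lexx.
pose r n : R := n.+1%:R^-1.
have r0 n : 0 < r n by rewrite invr_gt0.
pose T n := Sle (t + r n) `\` Sle (t - r n).
have mT n : measurable (T n) by exact: measurableD.
have Scap : \bigcap_n T n = [set z : measurableTypeR R * Omega | 0 <= z.1 /\ dsub D z = t].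
  apply/seteqP; split => z /=.
    move=> h; have [[z0 _] _] := h 0%N I; split=> //.
    apply/eqP; rewrite eq_le; apply/andP; split.
      apply/ler_addgt0Pr => x x0.
      have [[_ le] _] := h (Num.truncn x^-1) I; apply: (le_trans le).
      rewrite lerD2l /r invf_ple ?posrE//; apply: ltW; exact: Num.Theory.truncnS_gt.
    apply/ler_addgt0Pr => x x0.
    have [_ nle] := h (Num.truncn x^-1) I.
    have lt : t - r (Num.truncn x^-1) < dsub D z.
      by rewrite ltNge; apply/negP => le; apply: nle; split.
    rewrite -lerBlDr; apply: (le_trans _ (ltW lt)); rewrite lerD2l lerN2.
    by rewrite /r invf_ple ?posrE//; apply: ltW; exact: Num.Theory.truncnS_gt.
  move=> [z0 zt] n _; split; first by split=> //; rewrite zt lerDl ltW.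
  by move=> [_]; rewrite zt leNgt ltrBlDr ltrDl r0.
have mcap : measurable (\bigcap_n T n) by exact: bigcapT_measurable.
have T0 : ((mu \x P)%E (T 0%N) < +oo)%E.
  apply: (@le_lt_trans _ _ ((mu \x P)%E (Sle (t + r 0%N)))).
    by apply: le_measure; rewrite ?inE//; exact: subDsetl.
  have := occupation_lty m1 h1 (t + r 0%N); rewrite (occupation_prod HD)//.
  by move=> h; rewrite -[X in (X < _)%E]mul1e -integral_cst.
have ndT : {homo T : n m / (n <= m)%N >-> (m <= n)%O}.
  move=> n m nm; apply/subsetPset => z [[z0 le] nle].
  have rnm : r m <= r n by rewrite lef_pV2 ?posrE// ler_nat ltnS.
  split; first by split=> //; apply: (le_trans le); rewrite lerD2l.
  by move=> [_ le2]; apply: nle; split=> //; apply: (le_trans le2); rewrite lerD2l lerN2.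
have cap0 : (mu \x P)%E (\bigcap_n T n) = 0%E by rewrite Scap level_set_null.
have cT : (mu \x P)%E (T n) @[n --> \oo] --> 0%E.
  by rewrite -cap0; exact: (nonincreasing_cvg_mu T0 mT mcap ndT).
have [n _ /(_ n (leqnn n)) hn] : \forall n \near \oo, ((mu \x P)%E (T n) < e%:E)%E.
  apply: (cT [set x | (x < e%:E)%E]); apply: open_nbhs_nbhs.
  by split; [exact: open_ereal_lt_ereal | rewrite /= lte_fin].
exists (r n) => //.
rewrite -lte_fin EFinB !fineK ?occupation_fin//.
apply: le_lt_trans hn.
rewrite leeBlDr ?occupation_fin//.
rewrite (occupation_prod HD mf f0 (t + r n)) (occupation_prod HD mf f0 (t - r n)).
have SE : Sle (t + r n) = T n `|` Sle (t - r n).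
  rewrite /T setDE setUIl setvU setIT; apply/seteqP; split => z; [by left|case=> // -[z0 le]].
  split=> //; apply: (le_trans le); rewrite lerD2l; have := r0 n; lra.
have mfst A : measurable_fun A (fun z : measurableTypeR R * Omega => (f z.1)%:E).
  by apply/measurable_EFinP; apply: measurable_funTS; exact: measurableT_comp.
rewrite [in leLHS]SE ge0_integral_setU; last 5 first.
- exact: mT.
- exact: mS.
- exact: mfst.
- by move=> z _; rewrite lee_fin.
- by rewrite /T; apply/disj_set2P; rewrite setDE setIAC -setIA setICr setI0.
rewrite leeD2r// -[leRHS]mul1e -integral_cst//.
apply: ge0_le_integral.
- exact: mT.
- by move=> z _; rewrite lee_fin.
- exact: mfst.
- exact: measurable_cst.
- by move=> z _; rewrite lee_fin; case/andP: (f01 z.1).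
Qed.

Lemma inv_sub_ge0 (t : R) w : 0 <= inv_sub D t w.
Proof.
rewrite /inv_sub; set E := [set x | _].
have [->|/set0P E0] := eqVneq E set0; first by rewrite inf0.
by apply: lb_le_inf => // x [x0 _]; exact: ltW.
Qed.

Lemma subset_le_inv_sub (t : R) w (v : R) : 0 <= t -> 0 <= v -> v < inv_sub D t w -> D v w <= t.
Proof.
move=> t0; rewrite le_eqVlt => /predU1P[<-|v0] vY.
  by case: HD => -[_ -> _ _] _.
rewrite leNgt; apply/negP => tD; move: vY; rewrite ltNge => /negP; apply.
by apply: inf_lbound => //; exists 0 => x [x0 _]; exact: ltW.
Qed.

(** The crossing hypothesis excludes the empty set, whose [inf] is 0 and would break the bound. *)
Lemma le_inv_sub (t : R) w (v : R) : (exists2 x : R, 0 < x & t < D x w) -> 0 <= v -> D v w <= t ->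
  v <= inv_sub D t w.
Proof.
move=> [x x0 tx] v0 vt; apply: lb_le_inf; first by exists x.
move=> y [y0 ty]; rewrite leNgt; apply/negP => yv.
have := subordinator_nd HD w (ltW y0) (ltW yv).
by rewrite leNgt (le_lt_trans vt).
Qed.

(** On paths that exceed t the section of [subset_le] lies between [0, Y) and [0, Y], and one
    endpoint is a null set. *)
Lemma integral_subset_le (f : R -> R) (t : R) : measurable_fun [set: R] f ->
  (forall v, 0 <= f v) -> 0 <= t ->
  \forall w \ae P, (\int[mu]_v (f v * \1_(Sle t) (v, w))%:E =
    \int[mu]_(v in `[0%R, inv_sub D t w]) (f v)%:E)%E.
Proof.
move=> mf f0 t0; apply: filterS (subordinator_unbounded t) => w hw.
set Y := inv_sub D t w.
have mfE A : measurable_fun A (fun v => (f v)%:E).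
  by apply/measurable_EFinP; exact: measurable_funTS.
have mA : measurable (ysection (Sle t) w) by exact: measurable_ysection.
have -> : (\int[mu]_v (f v * \1_(Sle t) (v, w))%:E = \int[mu]_(v in ysection (Sle t) w) (f v)%:E)%E.
  rewrite [RHS]integral_mkcond; apply: eq_integral => v _.
  by rewrite patchE indicE mem_ysection; case: (_ \in _); rewrite ?mulr1 ?mulr0.
apply/eqP; rewrite eq_le; apply/andP; split.
  apply: ge0_subset_integral => //.
  - exact: mfE.
  - by move=> v _; rewrite lee_fin.
  - move=> v; rewrite /ysection/= inE => -[/= v0]; rewrite dsubE// => vt.
    by rewrite in_itv/= v0; exact: le_inv_sub.
rewrite -integral_itv_bndo_bndc//; apply: ge0_subset_integral => //.
- exact: mfE.
- by move=> v _; rewrite lee_fin.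
- move=> v; rewrite /= in_itv/= => /andP[v0 vY].
  by rewrite /ysection/= inE; split => //=; rewrite dsubE//; exact: subset_le_inv_sub.
Qed.

End occupation.

(** * The fractional equation *)

Lemma laplace_affine (R : realType) (a c l : R) (F G : R -> \bar R) (s : R) :
  0 < s -> 0 <= a -> 0 <= c -> 0 <= l ->
  measurable_fun [set: R] F -> measurable_fun [set: R] G ->
  (forall t, (0 <= F t)%E) -> (forall t, (0 <= G t)%E) ->
  laplace (fun r => (a%:E * F r + c%:E * 1) + l%:E * G r)%E s =
  (a%:E * laplace F s + c%:E * (s^-1)%:E + l%:E * laplace G s)%E.
Proof.
move=> s0 a0 c0 l0 mF mG F0 G0.
have m1 : measurable_fun [set: R] (fun=> 1%E : \bar R) by exact: measurable_cst.
have Z0 (b : R) (x : \bar R) : 0 <= b -> (0 <= x)%E -> (0 <= b%:E * x)%E.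
  by move=> b0 x0; rewrite mule_ge0.
rewrite laplaceD; last 4 first.
- by apply: emeasurable_funD; exact: measurable_funeM.
- exact: measurable_funeM.
- by move=> t; rewrite adde_ge0 ?Z0.
- by move=> t; rewrite Z0.
rewrite laplaceD; last 4 first.
- exact: measurable_funeM.
- exact: measurable_funeM.
- by move=> t; rewrite Z0.
- by move=> t; rewrite Z0.
have e1 (t : R) : (0 <= 1 :> \bar R)%E by [].
by rewrite (laplaceZ s a0 mF F0) (laplaceZ s c0 m1 e1) (laplaceZ s l0 mG G0) (laplace_cst1 s0).
Qed.

Section fractional_identity.
Context {R : realType} {d : measure_display} {Omega : measurableType d}.
Variables (P : probability Omega R) (theta alpha : R) (D : R -> Omega -> R).
Hypotheses (theta0 : 0 < theta) (alpha01 : 0 < alpha < 1).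
Hypothesis HD : tempered_subordinator P theta alpha D.
Local Notation mu := (@lebesgue_measure R).
Local Notation phi := (laplace_exponent theta alpha).
Local Notation occup := (occupation P D).
Local Notation Gam := (Gamma_fn (1 - alpha)).

Definition roccup (f : R -> R) (t : R) : R := fine (occup f t).

Section weight.
Variable f : R -> R.
Hypotheses (mf : measurable_fun [set: R] f) (f01 : forall v, 0 <= f v <= 1).
Let f0 v : 0 <= f v. Proof. by case/andP: (f01 v). Qed.

Lemma EFin_roccup t : (roccup f t)%:E = occup f t.
Proof. by rewrite fineK// (occupation_fin theta0 alpha01 HD mf f01). Qed.

Lemma roccup_ge0 t : 0 <= roccup f t.
Proof. by apply: fine_ge0; exact: occupation_ge0. Qed.

Lemma roccup_nd : {homo roccup f : s t / s <= t}.
Proof.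
move=> s t st; apply: fine_le; [| |exact: (occupation_nd HD mf f0 st)].
- exact: (occupation_fin theta0 alpha01 HD mf f01).
- exact: (occupation_fin theta0 alpha01 HD mf f01).
Qed.

Lemma continuous_roccup : continuous (roccup f).
Proof. exact: (continuous_occupation theta0 alpha01 HD mf f01). Qed.

Lemma measurable_roccup : measurable_fun [set: R] (roccup f).
Proof. by apply: continuous_measurable_fun; exact: continuous_roccup. Qed.

Lemma laplace_roccup s : 0 < s ->
  laplace (EFin \o roccup f) s = (laplace (EFin \o f) (phi s) * (s^-1)%:E)%E.
Proof.
move=> s0; rewrite -(laplace_occupation HD)//; congr laplace.
by apply/funext => t; rewrite /= EFin_roccup.
Qed.

Lemma laplace_fin c : 0 < c -> laplace (EFin \o f) c \is a fin_num.
Proof.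
move=> c0; rewrite ge0_fin_numE; first exact: laplace_le1_lty.
by apply: integral_ge0 => t _; rewrite mule_ge0// lee_fin ?expR_ge0.
Qed.

Definition tilted (t : R) : R := expR (theta * t) * roccup f t.

Lemma tilted_ge0 t : 0 <= tilted t.
Proof. by rewrite mulr_ge0 ?expR_ge0 ?roccup_ge0. Qed.

Lemma tilted_nd : {homo tilted : s t / s <= t}.
Proof.
move=> s t st; apply: ler_pM; rewrite ?expR_ge0 ?roccup_ge0 ?roccup_nd//.
by rewrite ler_expR ler_wpM2l// ltW.
Qed.

Lemma continuous_expRM : continuous (fun t : R => expR (theta * t)).
Proof.
move=> t; apply: (@continuous_comp _ _ _ (fun t : R => theta * t) expR).
  exact: mulrl_continuous.
exact: continuous_expR.
Qed.

Lemma continuous_tilted : continuous tilted.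
Proof. by move=> t; apply: cvgM; [exact: continuous_expRM | exact: continuous_roccup]. Qed.

Lemma measurable_tilted : measurable_fun [set: R] tilted.
Proof. by apply: continuous_measurable_fun; exact: continuous_tilted. Qed.

Lemma laplace_tilted s : 0 < s ->
  laplace (EFin \o tilted) (s + theta) = (laplace (EFin \o f) (phi s) * (s^-1)%:E)%E.
Proof.
move=> s0; rewrite -laplace_roccup// -[RHS](laplace_expM theta); congr laplace.
Qed.

End weight.

Definition ekernel (t : R) : \bar R := (t `^ (- alpha))%:E.

Lemma measurable_ekernel : measurable_fun [set: R] ekernel.
Proof. by apply/measurable_EFinP; exact: measurable_powR. Qed.

Lemma ekernel_ge0 t : (0 <= ekernel t)%E.
Proof. by rewrite lee_fin powR_ge0. Qed.

(* The Volterra equation [f + l * (b1 conv 1) = c0 + l * (b2 conv 1)] is the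
   additive form of an initial value problem for [f]; it lets all Laplace
   transforms below be taken of nonnegative functions. *)
Variables (f b1 b2 : R -> R) (l c0 : R).
Hypotheses (mf : measurable_fun [set: R] f) (mb1 : measurable_fun [set: R] b1)
  (mb2 : measurable_fun [set: R] b2).
Hypotheses (f01 : forall v, 0 <= f v <= 1) (b101 : forall v, 0 <= b1 v <= 1)
  (b201 : forall v, 0 <= b2 v <= 1).
Hypotheses (l0 : 0 <= l) (c00 : 0 <= c0).
Hypothesis volterra : forall u, 0 <= u ->
  ((f u)%:E + l%:E * conv (EFin \o b1) (fun=> 1) u =
   c0%:E + l%:E * conv (EFin \o b2) (fun=> 1) u)%E.

Let nn (g : R -> R) : (forall v, 0 <= g v <= 1) -> forall v, (0 <= (EFin \o g) v)%E.
Proof. by move=> h v; rewrite lee_fin; case/andP: (h v). Qed.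

Let mE (g : R -> R) : measurable_fun [set: R] g -> measurable_fun [set: R] (EFin \o g).
Proof. by move=> mg; apply/measurable_EFinP. Qed.

Let m1 : measurable_fun [set: R] (fun=> 1%E : \bar R).
Proof. exact: measurable_cst. Qed.

Let e1 (t : R) : (0 <= 1 :> \bar R)%E. Proof. by []. Qed.

Definition lap (g : R -> R) (c : R) : R := fine (laplace (EFin \o g) c).

Let EFin_lap (g : R -> R) c : measurable_fun [set: R] g -> (forall v, 0 <= g v <= 1) -> 0 < c ->
  laplace (EFin \o g) c = (lap g c)%:E.
Proof. by move=> mg g01 c0'; rewrite /lap fineK//; exact: laplace_fin. Qed.

(** Convolution with 1 contributes a factor 1/p to the transform; multiplying by p gives the
    transform of f' = l (b2 - b1), f(0) = c0, without mentioning a derivative. *)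
Lemma laplace_volterra p : 0 < p -> p * lap f p + l * lap b1 p = c0 + l * lap b2 p.
Proof.
move=> p0.
have mconv (g : R -> R) : measurable_fun [set: R] g -> (forall v, 0 <= g v <= 1) ->
    measurable_fun [set: R] (fun t => l%:E * conv (EFin \o g) (fun=> 1) t)%E.
  by move=> mg g01; apply: measurable_funeM; exact: (measurable_conv (mE mg) m1 (nn g01) e1).
have pconv (g : R -> R) : (forall v, 0 <= g v <= 1) ->
    forall t, (0 <= l%:E * conv (EFin \o g) (fun=> 1) t)%E.
  by move=> g01 t; rewrite mule_ge0 ?lee_fin//; exact: (conv_ge0 (nn g01) e1).
have lconv (g : R -> R) : measurable_fun [set: R] g -> (forall v, 0 <= g v <= 1) ->
    laplace (fun t => l%:E * conv (EFin \o g) (fun=> 1) t)%E p = (l * (lap g p * p^-1))%:E.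
  move=> mg g01; rewrite laplaceZ//.
  - rewrite (laplace_conv (mE mg) m1 (nn g01) e1).
    by rewrite laplace_cst1// EFin_lap// -!EFinM.
  - exact: (measurable_conv (mE mg) m1 (nn g01) e1).
  - by move=> t; exact: (conv_ge0 (nn g01) e1).
have : laplace (fun u => (EFin \o f) u + l%:E * conv (EFin \o b1) (fun=> 1) u)%E p =
       laplace (fun u => c0%:E * 1 + l%:E * conv (EFin \o b2) (fun=> 1) u)%E p.
  rewrite /laplace; apply: eq_integral => u.
  by rewrite inE/= in_itv/= andbT => u0; rewrite mule1 volterra.
rewrite laplaceD; [|exact: mE|exact: mconv|exact: nn|exact: pconv].
rewrite laplaceD; [|exact: measurable_funeM|exact: mconv|by move=> t; rewrite mule1 lee_fin|exact: pconv].
rewrite (@laplaceZ R c0 (fun=> 1%E) p c00 m1 e1) laplace_cst1// !lconv// EFin_lap// -EFinM -!EFinD => -[] e.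
have pn : p != 0 by rewrite gt_eqF.
have := congr1 (fun x => p * x) e; rewrite !mulrDr.
have h (x : R) : p * (l * (x * p^-1)) = l * x by field.
by rewrite !h [p * (c0 / p)]mulrC divfK.
Qed.

Let K := EFin \o tilted f.
Let K1 := EFin \o tilted b1.

Let mK : measurable_fun [set: R] K. Proof. by apply: mE; exact: measurable_tilted. Qed.
Let mK1 : measurable_fun [set: R] K1. Proof. by apply: mE; exact: measurable_tilted. Qed.
Let K0 t : (0 <= K t)%E. Proof. by rewrite lee_fin tilted_ge0. Qed.
Let K10 t : (0 <= K1 t)%E. Proof. by rewrite lee_fin tilted_ge0. Qed.

(** Gamma(1 - alpha) times the Riemann-Liouville integral of order 1 - alpha of [tilted f]. *)
Definition frac_int (t : R) : \bar R := conv K ekernel t.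

Lemma frac_int_ge0 t : (0 <= frac_int t)%E.
Proof. exact: (conv_ge0 K0 ekernel_ge0). Qed.

Lemma measurable_frac_int : measurable_fun [set: R] frac_int.
Proof. exact: (measurable_conv mK measurable_ekernel K0 ekernel_ge0). Qed.

Lemma frac_int_nd : {homo frac_int : s t / s <= t >-> (s <= t)%E}.
Proof.
apply: (conv_nd mK measurable_ekernel K0 ekernel_ge0).
by move=> s t st; rewrite lee_fin; exact: tilted_nd.
Qed.

Let kpow s : 0 < s -> (s + theta) `^ (alpha - 1) = (phi s + theta `^ alpha) / (s + theta).
Proof.
move=> s0; have st0 : 0 < s + theta by rewrite addr_gt0.
rewrite /laplace_exponent subrK powRB; last by rewrite (gt_eqF st0) implybT.
by rewrite powRr1// ltW.
Qed.

Lemma laplace_frac_int s : 0 < s ->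
  laplace frac_int (s + theta) =
    (lap f (phi s) / s * ((phi s + theta `^ alpha) / (s + theta) * Gam))%:E.
Proof.
move=> s0; have p0 := laplace_exponent_gt0 theta0 alpha01 s0.
rewrite (laplace_conv mK measurable_ekernel K0 ekernel_ge0).
rewrite laplace_tilted// EFin_lap// laplace_powR//; last by rewrite addr_gt0.
by rewrite kpow// -!EFinM.
Qed.

Lemma frac_int_fin t : frac_int t \is a fin_num.
Proof.
rewrite ge0_fin_numE ?frac_int_ge0//.
have h : 0 <= 1 + theta by rewrite addr_ge0// ltW.
apply: (@nd_laplace_lty R frac_int (1 + theta) t h measurable_frac_int frac_int_ge0 frac_int_nd).
by rewrite laplace_frac_int// ltry.
Qed.

Definition primitive (h : R -> R) (t : R) : R := (\int[mu]_(r in `[0%R, t]) h r)%R.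

Lemma EFin_primitive (h : R -> R) t : continuous h ->
  (primitive h t)%:E = conv (EFin \o h) (fun=> 1%E) t.
Proof.
move=> ch; rewrite /conv /primitive /Rintegral fineK; last first.
  apply: integrable_fin_num => //; apply: continuous_compact_integrable; first exact: segment_compact.
  exact: continuous_subspaceT.
by apply: eq_integral => r _; rewrite mule1.
Qed.

Lemma primitive_nd (h : R -> R) : continuous h -> (forall r, 0 <= h r) ->
  {homo primitive h : s t / s <= t}.
Proof.
move=> ch h0 s t st; rewrite -lee_fin (EFin_primitive s ch) (EFin_primitive t ch).
have mh : measurable_fun [set: R] h by exact: continuous_measurable_fun.
apply: ge0_subset_integral => //.
- by apply: emeasurable_funM => //; apply/measurable_EFinP; exact: measurable_funTS.
- by move=> r _; rewrite mule1 lee_fin.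
- by move=> r; rewrite /= !in_itv/= => /andP[->]; move/le_trans; apply.
Qed.

Lemma primitive_ge0 (h : R -> R) t : (forall r, 0 <= h r) -> 0 <= primitive h t.
Proof. by move=> h0; apply: Rintegral_ge0. Qed.

Lemma is_derive_primitive (h : R -> R) (t : R) : continuous h -> 0 < t ->
  is_derive t 1 (primitive h) (h t).
Proof.
move=> ch t0; have tt : t < t + 1 by rewrite ltrDl.
have ih : mu.-integrable `[0, t + 1] (EFin \o h).
  apply: continuous_compact_integrable; first exact: segment_compact.
  exact: continuous_subspaceT.
have [d1 d2] := @continuous_FTC1_closed R h 0 t (t + 1) tt ih t0 (ch t).
exact: (DeriveDef d1 (etrans (esym (derive1E _ _)) d2)).
Qed.

(** The expected derivative of [frac_int] up to Gamma(1 - alpha), except that the negative term in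
    [b1] is left out to keep it nonnegative. *)
Let H (r : R) : R := expR (theta * r) * (theta `^ alpha * roccup f r + c0 + l * roccup b2 r).

Let H0 r : 0 <= H r.
Proof. by rewrite mulr_ge0 ?expR_ge0// !addr_ge0 ?mulr_ge0 ?powR_ge0 ?roccup_ge0. Qed.

Let cH : continuous H.
Proof.
move=> r; apply: cvgM; first exact: continuous_expRM.
apply: cvgD; last by apply: cvgMr; exact: continuous_roccup.
apply: cvgD; last exact: cvg_cst.
by apply: cvgMr; exact: continuous_roccup.
Qed.

Let mH : measurable_fun [set: R] H. Proof. exact: continuous_measurable_fun. Qed.

Let laplace_H s : 0 < s -> laplace (EFin \o H) (s + theta) =
  ((theta `^ alpha * lap f (phi s) + c0 + l * lap b2 (phi s)) / s)%:E.
Proof.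
move=> s0; have p0 := laplace_exponent_gt0 theta0 alpha01 s0.
have -> : laplace (EFin \o H) (s + theta) = laplace (fun r =>
    ((theta `^ alpha)%:E * (EFin \o roccup f) r + c0%:E * 1) + l%:E * (EFin \o roccup b2) r)%E s.
  rewrite (_ : EFin \o H = (fun r => (expR (theta * r))%:E *
    ((theta `^ alpha)%:E * (EFin \o roccup f) r + c0%:E * 1 + l%:E * (EFin \o roccup b2) r))%E).
    by rewrite laplace_expM.
  by apply/funext => r; rewrite /= mule1 -!EFinM.
have mr (g : R -> R) : measurable_fun [set: R] g -> (forall v, 0 <= g v <= 1) ->
    measurable_fun [set: R] (EFin \o roccup g).
  by move=> *; apply: mE; exact: measurable_roccup.
have r0 (g : R -> R) : (forall v, 0 <= g v <= 1) -> forall t, (0 <= (EFin \o roccup g) t)%E.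
  by move=> g01 t; rewrite lee_fin roccup_ge0.
rewrite (laplace_affine s0 (powR_ge0 theta alpha) c00 l0 (mr f mf f01) (mr b2 mb2 b201) (r0 f f01) (r0 b2 b201)).
rewrite (laplace_roccup mf f01 s0) (laplace_roccup mb2 b201 s0).
rewrite (EFin_lap mf f01 p0) (EFin_lap mb2 b201 p0).
move: (lap f (phi s)) (lap b2 (phi s)) (theta `^ alpha) => x y z.
by rewrite -!EFinM -!EFinD; congr EFin; ring.
Qed.

(* Both sides have the same Laplace transform; the term in [b1] stays on the left
   so that [laplace_inj] applies to a monotone and a continuous function. *)
Lemma frac_int_identity t : 0 < t ->
  fine (frac_int t) + Gam * l * primitive (tilted b1) t = Gam * primitive H t.
Proof.
move=> t0.
have Gam0 : 0 < Gam by exact: Gamma_fn_gt0.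
have Gl0 : 0 <= Gam * l by rewrite mulr_ge0// ltW.
pose X (t : R) := fine (frac_int t) + Gam * l * primitive (tilted b1) t.
pose Z (t : R) := Gam * primitive H t.
have cb1 := continuous_tilted mb1 b101.
have EX u : (X u)%:E = (frac_int u + (Gam * l)%:E * conv K1 (fun=> 1) u)%E.
  by rewrite /X EFinD EFinM fineK ?frac_int_fin// (EFin_primitive u cb1).
have EZ u : (Z u)%:E = (Gam%:E * conv (EFin \o H) (fun=> 1) u)%E.
  by rewrite /Z EFinM (EFin_primitive u cH).
have H0' r : (0 <= (EFin \o H) r)%E by rewrite lee_fin.
have mX : measurable_fun [set: R] (EFin \o X).
  rewrite (_ : EFin \o X = fun u => frac_int u + (Gam * l)%:E * conv K1 (fun=> 1) u)%E; last exact/funext.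
  apply: emeasurable_funD; first exact: measurable_frac_int.
  by apply: measurable_funeM; exact: (measurable_conv mK1 m1 K10 e1).
have mZ : measurable_fun [set: R] (EFin \o Z).
  rewrite (_ : EFin \o Z = fun u => Gam%:E * conv (EFin \o H) (fun=> 1) u)%E; last exact/funext.
  by apply: measurable_funeM; exact: (measurable_conv (mE mH) m1 H0' e1).
have lapX s : 0 < s -> laplace (EFin \o X) (s + theta) =
    (lap f (phi s) / s * ((phi s + theta `^ alpha) / (s + theta) * Gam) +
     Gam * l * (lap b1 (phi s) / s / (s + theta)))%:E.
  move=> s0; have p0 := laplace_exponent_gt0 theta0 alpha01 s0.
  rewrite (_ : EFin \o X = fun u => frac_int u + (Gam * l)%:E * conv K1 (fun=> 1) u)%E; last exact/funext.
  rewrite laplaceD; last 4 first.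
  - exact: measurable_frac_int.
  - by apply: measurable_funeM; exact: (measurable_conv mK1 m1 K10 e1).
  - exact: frac_int_ge0.
  - by move=> u; rewrite mule_ge0 ?lee_fin//; exact: (conv_ge0 K10 e1).
  rewrite laplace_frac_int// laplaceZ//; last 2 first.
  - exact: (measurable_conv mK1 m1 K10 e1).
  - by move=> u; exact: (conv_ge0 K10 e1).
  rewrite (laplace_conv mK1 m1 K10 e1) laplace_tilted// laplace_cst1 ?addr_gt0// EFin_lap//.
have lapZ s : 0 < s -> laplace (EFin \o Z) (s + theta) =
    (Gam * ((theta `^ alpha * lap f (phi s) + c0 + l * lap b2 (phi s)) / s / (s + theta)))%:E.
  move=> s0.
  rewrite (_ : EFin \o Z = fun u => Gam%:E * conv (EFin \o H) (fun=> 1) u)%E; last exact/funext.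
  rewrite laplaceZ ?(ltW Gam0)//; last 2 first.
  - exact: (measurable_conv (mE mH) m1 H0' e1).
  - by move=> u; exact: (conv_ge0 H0' e1).
  rewrite (laplace_conv (mE mH) m1 H0' e1).
  by rewrite laplace_H// laplace_cst1 ?addr_gt0// -!EFinM.
(* Integers n >= n0 exceed theta, hence n = s + theta with s > 0, where both transforms have been
   computed. *)
pose n0 := (Num.truncn theta).+1.
have pos n : (n0 <= n)%N -> 0 < n%:R - theta.
  move=> n0n; rewrite subr_gt0; apply: (@lt_le_trans _ _ n0%:R); last by rewrite ler_nat.
  exact: Num.Theory.truncnS_gt.
apply: (@laplace_inj R X Z n0) => //.
- by apply/measurable_EFinP.
- by apply/measurable_EFinP.
- move=> u; rewrite addr_ge0 ?fine_ge0 ?frac_int_ge0// mulr_ge0// primitive_ge0//.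
- by move=> u; rewrite mulr_ge0 ?(ltW Gam0)// primitive_ge0.
- move=> n n0n; have s0 := pos n n0n; rewrite -(subrK theta n%:R) lapX// lapZ//.
  move: (n%:R - theta) s0 => s s0.
  have := laplace_volterra (laplace_exponent_gt0 theta0 alpha01 s0).
  move: (lap f (phi s)) => a; move: (lap b1 (phi s)) => x; move: (lap b2 (phi s)) => y.
  move: (phi s) (theta `^ alpha) Gam => p q G e.
  congr EFin; have sn : s != 0 by rewrite gt_eqF.
  have tn : s + theta != 0 by rewrite gt_eqF// addr_gt0.
  (* This isolates p a + l x, which the transformed Volterra equation replaces by c0 + l y. *)
  transitivity (G / s / (s + theta) * (p * a + l * x + q * a)); first by field; rewrite sn tn.
  by rewrite e; field; rewrite sn tn.
- by rewrite -(subrK theta n0%:R) lapX ?pos// ltry.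
- move=> s u su; apply: lerD.
    by apply: fine_le; [exact: frac_int_fin|exact: frac_int_fin|exact: frac_int_nd].
  by apply: ler_wpM2l => //; exact: (primitive_nd cb1 (tilted_ge0 _)).
- move=> u; rewrite in_itv/= andbT => u0; apply: cvgMr.
  apply: differentiable_continuous; apply/derivable1_diffP.
  by have [] := is_derive_primitive cH u0.
Qed.

(** Differentiates [frac_int_identity], which holds near each t > 0; continuity of the occupation
    integrals makes both primitives differentiable at every such t. *)
Lemma is_derive_frac_int (t : R) : 0 < t -> is_derive t 1 (fun u => fine (frac_int u))
  (Gam * (expR (theta * t) *
    (theta `^ alpha * roccup f t + c0 + l * (roccup b2 t - roccup b1 t)))).
Proof.
move=> t0.
have cb1 := continuous_tilted mb1 b101.
have d1 := is_deriveZ (Gam * l) (is_derive_primitive cb1 t0).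
have d2 := is_deriveB (is_deriveZ Gam (is_derive_primitive cH t0)) d1.
apply: (is_derive_eq (near_eq_is_derive _ d2)); last first.
  rewrite /H /tilted; move: (roccup f t) (roccup b2 t) (roccup b1 t) => x y z.
  by move: (expR _) (theta `^ alpha) Gam => e p G; rewrite /GRing.scale/=; ring.
near=> u.
have u0 : 0 < u by near: u; exact: lt_nbhsr.
have e := frac_int_identity u0.
transitivity (Gam * primitive H u - Gam * l * primitive (tilted b1) u); first by [].
by rewrite -e addrK.
Unshelve. all: by end_near. Qed.

End fractional_identity.

(** * Independent time change *)

Section time_change.
Context {R : realType} {d : measure_display} {Omega : measurableType d}.
Variables (P : probability Omega R) (theta alpha : R) (D : R -> Omega -> R) (Q : R -> Omega -> state).
Hypothesis HD : tempered_subordinator P theta alpha D.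
Hypothesis mQ : forall t s, measurable (Q t @^-1` [set s]).
Hypothesis rcQ : forall w t, 0 <= t -> exists e : R, 0 < e /\
  forall u, t <= u < t + e -> Q u w = Q t w.
Hypothesis Hind : indep_processes P Q D.
Variable t : R.
Local Notation Y := (inv_sub D t).

(** Independence is stated for events generated by the variables D(x), so Y has to be measurable for
    this sigma-algebra and not merely for that of [Omega]. *)
Let GD : set (set Omega) := [set E | exists x (C : set R), measurable C /\ E = D x @^-1` C].
Let OD := g_sigma_algebraType GD.

Let Y0 w : 0 <= Y w. Proof. exact: inv_sub_ge0. Qed.

Let mGD (x : R) (C : set R) : measurable C -> measurable (D x @^-1` C : set OD).
Proof. by move=> mC; apply: sub_sigma_algebra; exists x, C. Qed.

Let measurable_OD (A : set Omega) : measurable (A : set OD) -> measurable A.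
Proof.
apply: smallest_sub; first exact: sigma_algebra_measurable.
move=> _ [x [C [mC ->]]]; rewrite -[X in measurable X]setTI.
exact: (measurable_subordinator HD).
Qed.

(* The intersection is the event where the defining set is empty: there [inf] is 0. *)
Lemma inv_sub_ltE (x : R) : 0 < x ->
  [set w | Y w < x] = (\bigcup_(q : rat) [set w | 0 < (ratr q : R) < x /\ t < D (ratr q) w]) `|`
    (\bigcap_n [set w | D n.+1%:R w <= t]).
Proof.
move=> x0; apply/seteqP; split => w /=; rewrite /inv_sub; set E := [set y | _].
  have [E0 _|/set0P E0 /(inf_lt E0)[y [y0 ty] yx]] := eqVneq E set0.
    right => n _ /=; rewrite leNgt; apply/negP => lt.
    by have : E n.+1%:R by []; rewrite E0.
  have [q] := rat_in_itvoo yx; rewrite in_itv/= => /andP[yq qx].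
  left; exists q => //=; rewrite (lt_trans y0 yq) qx; split=> //.
  apply: (lt_le_trans ty); apply: (subordinator_nd HD); exact: ltW.
move=> [[q _ /= [/andP[q0 qx] tq]]|h].
  by apply: le_lt_trans qx; apply: ge_inf => //; exists 0 => y [y0 _]; exact: ltW.
suff -> : E = set0 by rewrite inf0.
apply/seteqP; split => // y [y0 ty]; have := h (Num.truncn y) I; rewrite /= leNgt => /negP; apply.
apply: (lt_le_trans ty); apply: (subordinator_nd HD); first exact: ltW.
by apply: ltW; exact: Num.Theory.truncnS_gt.
Qed.

Let mYlt (x : R) : measurable ([set w | Y w < x] : set OD).
Proof.
have [x0|x0] := leP x 0.
  rewrite (_ : [set w | _] = set0)//; apply/seteqP; split => // w /=.
  by rewrite ltNge (le_trans x0).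
rewrite (inv_sub_ltE x0); apply: measurableU.
  apply: bigcupT_measurable_rat => q.
  have [qx|nq] := boolP (0 < (ratr q : R) < x).
    rewrite (_ : [set w | _] = D (ratr q) @^-1` `]t, +oo[); last first.
      by apply/seteqP; split => w /=; rewrite in_itv/= andbT // => -[].
    by apply: mGD; exact: measurable_itv.
  by rewrite (_ : [set w | _] = set0)//; apply/seteqP; split => // w [].
apply: bigcapT_measurable => n.
rewrite (_ : [set w | _] = D n.+1%:R @^-1` `]-oo, t]); last first.
  by apply/seteqP; split => w /=; rewrite in_itv.
by apply: mGD; exact: measurable_itv.
Qed.

Lemma measurable_inv_sub : measurable_fun [set: Omega] Y.
Proof.
apply: (measurability _ (RGenInftyO.measurableE R)) => _ [_ [a ->] <-].
rewrite setTI (_ : _ @^-1` _ = [set w | Y w < a]).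
  by apply: measurable_OD; exact: mYlt.
by apply/seteqP; split => w /=; rewrite in_itv.
Qed.

(* Y is approximated from above by a grid-valued time: right-continuity of Q makes
   Q(ygrid) converge to Q(Y), and on a grid cell the time of Q is deterministic. *)
Section grid.
Variable n : nat.

Let pt (i : nat) : R := i%:R / n.+1%:R.
Let cell (i : nat) : set Omega := [set w | pt i <= Y w < pt i.+1].
Let idx (y : R) : nat := Num.truncn (y * n.+1%:R).

(** The successor puts the grid point strictly above Y, on the side where Q is right-continuous. *)
Definition ygrid (w : Omega) : R := pt (idx (Y w)).+1.

Let n1 : 0 < n.+1%:R :> R. Proof. by []. Qed.

Let cellP i w : cell i w <-> idx (Y w) = i.
Proof.
rewrite /cell/= /pt ler_pdivrMr// ltr_pdivlMr// /idx; split.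
  by move=> h; apply/eqP; rewrite Num.Theory.truncn_eq ?mulr_ge0.
by move=> <-; apply: Num.Theory.truncn_itv; rewrite mulr_ge0.
Qed.

Let mcell i : measurable (cell i : set OD).
Proof.
rewrite (_ : cell i = [set w | Y w < pt i.+1] `\` [set w | Y w < pt i]).
  by apply: measurableD; exact: mYlt.
apply/seteqP; split => w; rewrite /cell/=.
  by move=> /andP[h1 h2]; split=> //; rewrite ltNge h1.
by move=> [-> /negP]; rewrite -leNgt andbT.
Qed.

Lemma ygrid_gt w : Y w < ygrid w.
Proof.
rewrite /ygrid /pt ltr_pdivlMr// /idx; exact: Num.Theory.truncnS_gt.
Qed.

Lemma ygrid_le w : ygrid w <= Y w + n.+1%:R^-1.
Proof.
rewrite /ygrid /pt -natr1 mulrDl mul1r lerD2r ler_pdivrMr//.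
by rewrite Num.Theory.truncn_le mulr_ge0.
Qed.

Lemma measurable_ygrid : measurable_fun [set: Omega] ygrid.
Proof.
have h : measurable_fun [set: R] (fun y : R => pt (idx y).+1).
  apply: nondecreasing_measurable => // x y xy.
  rewrite /pt ler_wpM2r ?invr_ge0// ler_nat ltnS; apply: Num.Theory.le_truncn.
  by rewrite ler_wpM2r.
exact: (measurableT_comp h measurable_inv_sub).
Qed.

Variables (j : state) (p : R -> R).
Hypotheses (mp : measurable_fun [set: R] p) (p0 : forall u, 0 <= p u).
Hypothesis Pp : forall u, 0 <= u -> P (Q u @^-1` [set j]) = (p u)%:E.

Let Bn i := cell i `&` (Q (pt i.+1) @^-1` [set j]).

Let gridE : [set w | Q (ygrid w) w = j] = \bigcup_i Bn i.
Proof.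
apply/seteqP; split => w /=.
  by move=> h; exists (idx (Y w)) => //; split; [exact/cellP|].
by move=> [i _ [/cellP ei]]; rewrite /= /ygrid ei.
Qed.

Let mBn i : measurable (Bn i).
Proof. by apply: measurableI => //; apply: measurable_OD; exact: mcell. Qed.

Let trivcell : trivIset setT cell.
Proof. by move=> i k _ _ [w [/cellP <- /cellP <-]]. Qed.

Lemma measurable_grid_event : measurable [set w | Q (ygrid w) w = j].
Proof. by rewrite gridE; apply: bigcupT_measurable => i; exact: mBn. Qed.

(** On each cell the event intersects {Y in the cell} with {Q = j} at one fixed time; these are
    independent, and summing the products over the cells gives the integral. *)
Lemma grid_event_prob :
  P [set w | Q (ygrid w) w = j] = (\int[P]_w (p (ygrid w))%:E)%E.
Proof.
have trivB : trivIset setT Bn.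
  by move=> i k _ _ [w [[ci _] [ck _]]]; apply: trivcell => //; exists w.
rewrite gridE measure_semi_bigcup//; last by rewrite -gridE; exact: measurable_grid_event.
have cellT : \bigcup_i cell i = setT.
  by apply/seteqP; split => // w _; exists (idx (Y w)) => //; exact/cellP.
rewrite -[in RHS]cellT ge0_integral_bigcup//; last 3 first.
- by move=> i; exact: measurable_OD.
- apply/measurable_EFinP; apply: measurable_funTS.
  exact: (measurableT_comp mp measurable_ygrid).
- by move=> w _; rewrite lee_fin.
apply: eq_eseriesr => i _.
transitivity (P (Bn i)); first by [].
have -> : P (Bn i) = (P (Q (pt i.+1) @^-1` [set j]) * P (cell i))%E.
  rewrite /Bn setIC; apply: Hind; last exact: mcell.
  by apply: sub_sigma_algebra; exists (pt i.+1), j.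
rewrite Pp; last by rewrite /pt divr_ge0.
rewrite -integral_cst; last exact: measurable_OD.
by apply: eq_integral => w; rewrite inE => /cellP ei; rewrite /ygrid ei.
Qed.

End grid.

Variables (j : state) (p : R -> R).
Hypotheses (cp : continuous p) (p0 : forall u, 0 <= p u) (p1 : forall u, p u <= 1).
Hypothesis Pp : forall u, 0 <= u -> P (Q u @^-1` [set j]) = (p u)%:E.

Let mp : measurable_fun [set: R] p. Proof. exact: continuous_measurable_fun. Qed.

Let A : set Omega := [set w | Q (Y w) w = j].
Let An n : set Omega := [set w | Q (ygrid n w) w = j].

Let cvg_ygrid w : ygrid n w @[n --> \oo] --> Y w.
Proof.
apply: (@squeeze_cvgr _ _ _ _ (fun=> Y w) (fun n => Y w + n.+1%:R^-1)).
- by near=> n; rewrite (ltW (ygrid_gt n w)) ygrid_le.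
- exact: cvg_cst.
- rewrite -[X in _ --> X]addr0; apply: cvgD; [exact: cvg_cst|exact: cvg_harmonic].
Unshelve. all: by end_near. Qed.

Let cvg_indic w : (\1_(An n) w : R) @[n --> \oo] --> (\1_A w : R).
Proof.
have [e [e0 he]] := rcQ w (Y0 w).
apply: cvg_near_cst.
have /cvgrPdist_lt/(_ e e0) h := @cvg_ygrid w.
near=> n; rewrite !indicE.
have hn : `|Y w - ygrid n w| < e by near: n.
suff -> : (w \in An n) = (w \in A) by [].
have eQ : Q (ygrid n w) w = Q (Y w) w.
  apply: he; rewrite (ltW (ygrid_gt n w))/=.
  by move: hn; rewrite ltr0_norm ?subr_lt0 ?ygrid_gt// opprB ltrBlDl.
by apply/idP/idP; rewrite !inE /An /A/= eQ.
Unshelve. all: by end_near. Qed.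

Let mAn n : measurable (An n).
Proof. exact: measurable_grid_event. Qed.

Lemma measurable_time_change : measurable [set w | Q (Y w) w = j].
Proof.
apply/(measurable_indicP R); apply: (@measurable_fun_cvg _ _ _ _ (fun n => \1_(An n))).
  by move=> n; exact/measurable_indicP.
by move=> w _; exact: cvg_indic.
Qed.

(** Dominated convergence by 1 on both sides of [grid_event_prob]: the indicators are eventually
    constant by right-continuity of Q, and p(ygrid) converges by continuity of p. *)
Lemma time_change_prob : P [set w | Q (Y w) w = j] = (\int[P]_w (p (Y w))%:E)%E.
Proof.
have ig : P.-integrable setT (cst 1%E : Omega -> \bar R).
  by apply: finite_measure_integrable_cst.
have mA : measurable A := measurable_time_change.
have indic01 (B : set Omega) w : (`|(\1_B w : R)%:E| <= 1%E)%E.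
  by rewrite /= ger0_norm ?lee_fin// indicE; case: (_ \in _).
have [_ _ c1] : [/\ P.-integrable setT (fun w => (\1_A w : R)%:E),
    (\int[P]_w `|(\1_(An n) w : R)%:E - (\1_A w : R)%:E|)%E @[n --> \oo] --> 0%E &
    (\int[P]_w (\1_(An n) w : R)%:E)%E @[n --> \oo] --> (\int[P]_w (\1_A w : R)%:E)%E].
  apply: (@dominated_convergence _ _ R P setT measurableT
    (fun n w => (\1_(An n) w : R)%:E) (fun w => (\1_A w : R)%:E) (cst 1%E)) => //.
  - by move=> n; apply/measurable_EFinP; exact: measurable_indic.
  - by apply/measurable_EFinP; exact: measurable_indic.
  - by apply: aeW => w _; apply: cvg_EFin; [exact: nearW|exact: cvg_indic].
  - by apply: aeW => w n _; exact: indic01.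
have [_ _ c2] : [/\ P.-integrable setT (fun w => (p (Y w))%:E),
    (\int[P]_w `|(p (ygrid n w))%:E - (p (Y w))%:E|)%E @[n --> \oo] --> 0%E &
    (\int[P]_w (p (ygrid n w))%:E)%E @[n --> \oo] --> (\int[P]_w (p (Y w))%:E)%E].
  apply: (@dominated_convergence _ _ R P setT measurableT
    (fun n w => (p (ygrid n w))%:E) (fun w => (p (Y w))%:E) (cst 1%E)) => //.
  - move=> n; apply/measurable_EFinP.
    exact: (measurableT_comp mp (measurable_ygrid n)).
  - apply/measurable_EFinP; exact: (measurableT_comp mp measurable_inv_sub).
  - apply: aeW => w _; apply: cvg_EFin; first exact: nearW.
    by apply: continuous_cvg; [exact: cp|exact: cvg_ygrid].
  - by apply: aeW => w n _; rewrite /= ger0_norm ?lee_fin.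
have e n : (\int[P]_w (\1_(An n) w : R)%:E = \int[P]_w (p (ygrid n w))%:E)%E.
  by rewrite integral_indic// setIT; exact: (grid_event_prob n mp p0 Pp).
have -> : P [set w | Q (Y w) w = j] = (\int[P]_w (\1_A w : R)%:E)%E by rewrite integral_indic// setIT.
move: c1; rewrite (eq_cvg _ _ e) => c1.
exact: (cvg_unique _ c1 c2).
Qed.

End time_change.

(** * The tempered Erlang queue *)

Lemma measurable_countable_preimage (d : measure_display) (Omega : measurableType d)
    (T : countType) (X : Omega -> T) (B : set T) :
  (forall j, measurable (X @^-1` [set j])) -> measurable (X @^-1` B).
Proof.
move=> mX; have -> : X @^-1` B = \bigcup_(j : T) (X @^-1` [set j] `&` [set w | B (X w)]).
  by apply/seteqP; split => [w /= Bw|w [j _] []//]; exists (X w).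
apply: countable_bigcupT_measurable => [|j]; first exact: countableP.
have [Bj|nBj] := pselect (B j).
  rewrite (_ : _ `&` _ = X @^-1` [set j])//.
  by apply/seteqP; split => [w []//|w /= e]; rewrite e.
rewrite (_ : _ `&` _ = set0)//; apply/seteqP; split => // w [/= e]; rewrite e; exact: nBj.
Qed.

Lemma measurable_fun_countable (d d' : measure_display) (Omega : measurableType d)
    (U : measurableType d') (T : countType) (X : Omega -> T) (h : T -> U) :
  (forall j, measurable (X @^-1` [set j])) -> measurable_fun [set: Omega] (h \o X).
Proof.
by move=> mX _ B _; rewrite setTI comp_preimage; exact: measurable_countable_preimage.
Qed.

Lemma ae_countable (d : measure_display) (Omega : measurableType d) (R : realType)
    (mu : {measure set Omega -> \bar R}) (T : countType) (p : T -> Omega -> Prop) :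
  (forall j, \forall w \ae mu, p j w) -> \forall w \ae mu, forall j, p j w.
Proof.
move=> h; have h' n : \forall w \ae mu, forall j, unpickle n = Some j -> p j w.
  case: (unpickle n) => [j|]; last by apply: nearW.
  by apply: filterS (h j) => w pw j' [<-].
by apply: filterS (ae_foralln h') => w hw j; apply: (hw (pickle j)); rewrite pickleK.
Qed.

Lemma measure_ae_eq (d : measure_display) (Omega : measurableType d) (R : realType)
    (mu : {measure set Omega -> \bar R}) (A B : set Omega) :
  measurable A -> measurable B -> (\forall w \ae mu, A w <-> B w) -> mu A = mu B.
Proof.
move=> mA mB AB; rewrite -(setIT A) -(setIT B) -!integral_indic//.
apply: ge0_ae_eq_integral => //.
- by apply/measurable_EFinP; exact: measurable_indic.
- by apply/measurable_EFinP; exact: measurable_indic.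
- apply: filterS AB => w AB _ /=; rewrite !indicE; congr (_%:R%:E).
  by congr nat_of_bool; apply/idP/idP; rewrite !inE => /AB.
Qed.

Lemma integral_lincomb (d : measure_display) (T : measurableType d) (R : realType)
    (mu : {measure set T -> \bar R}) (A : set T) (F G : T -> R) (a b x y : R) :
  measurable A -> mu.-integrable A (EFin \o F) -> mu.-integrable A (EFin \o G) ->
  (\int[mu]_(w in A) (F w)%:E = x%:E -> \int[mu]_(w in A) (G w)%:E = y%:E ->
  \int[mu]_(w in A) (a * F w + b * G w)%:E = (a * x + b * y)%:E)%E.
Proof.
move=> mA iF iG eF eG.
have iZ (c : R) (H : T -> R) : mu.-integrable A (EFin \o H) ->
    mu.-integrable A (EFin \o (fun w => c * H w)).
  by move=> iH; apply: eq_integrable (integrableZl mA c iH) => // w _; rewrite /= EFinM.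
transitivity (\int[mu]_(w in A) ((EFin \o (fun w => a * F w)%R) \+ (EFin \o (fun w => b * G w)%R)) w)%E.
  by apply: eq_integral => w _; rewrite /= EFinD.
rewrite (integralD_EFin mA (iZ a F iF) (iZ b G iG)) EFinD.
congr (_ + _)%E.
  by rewrite EFinM -eF -integralZl//; apply: eq_integral => w _; rewrite /= EFinM.
by rewrite EFinM -eG -integralZl//; apply: eq_integral => w _; rewrite /= EFinM.
Qed.

Lemma ge0_integrable_fin (d : measure_display) (T : measurableType d) (R : realType)
    (mu : {measure set T -> \bar R}) (A : set T) (F : T -> R) (x : R) :
  measurable_fun A F -> (forall w, 0 <= F w) ->
  (\int[mu]_(w in A) (F w)%:E = x%:E)%E -> mu.-integrable A (EFin \o F).
Proof.
move=> mF F0 e; apply/integrableP; split; first exact/measurable_EFinP.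
under eq_integral do rewrite /= ger0_norm//.
by rewrite e ltry.
Qed.

Section tempered_queue.
Context {R : realType} {d : measure_display} {Omega : measurableType d}.
Variables (P : probability Omega R) (k : nat) (lam mu theta alpha : R).
Variables (Q : R -> Omega -> state) (D : R -> Omega -> R) (Pt : R -> state -> state -> R).
Hypotheses (k1 : (1 <= k)%N) (lam0 : 0 < lam) (mu0 : 0 < mu).
Hypotheses (theta0 : 0 < theta) (alpha01 : 0 < alpha < 1).
Hypothesis mQ : forall t s, measurable (Q t @^-1` [set s]).
Hypothesis rcQ : forall w (t : R), 0 <= t -> exists e : R, 0 < e /\
  forall u : R, t <= u < t + e -> Q u w = Q t w.
Hypothesis HP : erlang_transition k lam mu Pt.
Hypothesis fddQ : ctmc_fdd P Q Pt (0, 0)%N.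
Hypothesis HD : tempered_subordinator P theta alpha D.
Hypothesis Hind : indep_processes P Q D.

Local Notation Y t := (inv_sub D t).
Local Notation e0 := (0%N, 0%N).
Local Notation p j := (ptrans Pt e0 j).
Local Notation roc := (roccup P D).

Let valid0 : erlang_state k e0. Proof. by []. Qed.

Definition tempered_queue (t : R) (w : Omega) : state := Q (Y t w) w.
Local Notation QY := tempered_queue.

Lemma state_prob (u : R) j : 0 <= u -> P (Q u @^-1` [set j]) = (p j u)%:E.
Proof.
move=> u0; have := fddQ (l := [:: (u, j)]); rewrite /= andbT => /(_ u0).
rewrite subr0 mulr1 ptransE// => <-; congr (P _); apply/seteqP; split => w /=.
  by move=> e q; rewrite inE => /eqP ->.
by move=> h; have := h (u, j); rewrite inE eqxx => /(_ isT).
Qed.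

Lemma measurable_tempered_queue t j : measurable (QY t @^-1` [set j]).
Proof. exact: (measurable_time_change HD mQ rcQ t j). Qed.

Let mQYfun t (h : state -> R) : measurable_fun [set: Omega] (fun w => h (QY t w)).
Proof. exact: (measurable_fun_countable h (measurable_tempered_queue t)). Qed.

Lemma tempered_queue_prob t j :
  P (QY t @^-1` [set j]) = (\int[P]_w (p j (Y t w))%:E)%E.
Proof.
apply: (time_change_prob HD mQ rcQ Hind).
- exact: (continuous_ptrans HP).
- exact: (ptrans_ge0 HP).
- exact: (ptrans_le1 HP).
- by move=> u; exact: state_prob.
Qed.

(** [g_k] also vanishes at pairs (0, s) outside the state space, and [box] lists valid states only,
    so invalid pairs must be ruled out. There are countably many, each reached with probability
    0. *)
Lemma tempered_queue_valid t : \forall w \ae P, erlang_state k (QY t w).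
Proof.
have h (j : state) : \forall w \ae P, QY t w = j -> erlang_state k j.
  have [vj|vj] := boolP (erlang_state k j); first exact: nearW.
  exists (QY t @^-1` [set j]); split; first exact: measurable_tempered_queue.
    rewrite tempered_queue_prob integral0_eq// => w _.
    rewrite ptransE ?inv_sub_ge0// (transition_invalid k1 lam0 mu0 HP _ valid0 vj)//.
    exact: inv_sub_ge0.
  by move=> w /= nw; apply: contrapT => ne; apply: nw => /ne.
by apply: filterS (ae_countable h) => w hw; exact: hw.
Qed.

(** A path that starts at 0 and increases strictly along the rationals is positive at every positive
    rational. *)
Lemma inv_sub0 : \forall w \ae P, Y 0 w = 0.
Proof.
apply: filterS (subordinator_increasing theta0 alpha01 HD) => w hw.
apply/eqP; rewrite eq_le inv_sub_ge0 andbT leNgt; apply/negP => Y0.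
have [q] := rat_in_itvoo Y0; rewrite in_itv/= => /andP[q0 qY].
have := hw 0 q; rewrite rmorph0 lexx => /(_ isT q0).
have [[_ D0 _ _] _] := HD; rewrite D0 => Dq.
suff : Y 0 w <= ratr q by rewrite leNgt qY.
by apply: ge_inf => //; exists 0 => y [y0 _]; exact: ltW.
Qed.

Lemma tempered_queue0 : \forall w \ae P, QY 0 w = e0.
Proof.
have h : \forall w \ae P, Q 0 w = e0.
  exists (~` (Q 0 @^-1` [set e0])); split; [exact: measurableC| |by []].
  rewrite probability_setC// state_prob// ptransE//.
  by have [-> _ _ _ _] := HP; rewrite eqxx subee.
by apply: filterS2 h inv_sub0 => w hw Yw; rewrite /tempered_queue Yw.
Qed.

Lemma measurable_L0_event : measurable (L0_event k Q D).
Proof.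
exact: (measurable_countable_preimage [set j | g_k k j = 0%N] (measurable_tempered_queue 0)).
Qed.

Lemma ae_L0_event : \forall w \ae P, L0_event k Q D w.
Proof.
by apply: filterS tempered_queue0 => w; rewrite /L0_event/= /queue_length -/(QY 0 w) => ->.
Qed.

(** The conditioning event is almost sure, so conditional means and probabilities reduce to plain
    ones. *)
Lemma L0_event_prob : P (L0_event k Q D) = 1%E.
Proof.
rewrite -(probability_setT P); apply: measure_ae_eq => //; first exact: measurable_L0_event.
by apply: filterS ae_L0_event.
Qed.

Lemma mean_numE t :
  mean_num P k Q D t = (\int[P]_w ((g_k k (QY t w))%:R : R)%:E)%E.
Proof.
rewrite /mean_num integral_mkcond; have mg := mQYfun t (fun j => (g_k k j)%:R : R).
apply: ge0_ae_eq_integral => //.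
- apply/(measurable_restrict _ _ _).1 => //; first exact: measurable_L0_event.
  by apply/measurable_EFinP; apply: measurable_funTS.
- exact/measurable_EFinP.
- by move=> w _; rewrite patchE; case: ifP => // _; rewrite lee_fin.
- by apply: filterS ae_L0_event => w Lw _; rewrite patchE mem_set.
Qed.

Lemma probability_zero t :
  P (L0_event k Q D `&` [set w | queue_length k Q D t w = 0%N]) =
  (\int[P]_w (p e0 (Y t w))%:E)%E.
Proof.
rewrite -tempered_queue_prob; apply: measure_ae_eq.
- apply: measurableI; first exact: measurable_L0_event.
  exact: (measurable_countable_preimage [set j | g_k k j = 0%N] (measurable_tempered_queue t)).
- exact: measurable_tempered_queue.
- apply: filterS2 ae_L0_event (tempered_queue_valid t) => w Lw /=.
  rewrite /queue_length -/(QY t w); case: (QY t w) => [[|n] s]; rewrite /erlang_state/=.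
    by move=> /orP[/eqP[->]|//]; split.
  move=> /andP[s0 _]; split; [move=> [_]|by []].
  by move=> /eqP; rewrite addn_eq0 => /andP[_ /eqP s00]; rewrite s00 in s0.
Qed.

Lemma occ_nd i j : {homo (occ Pt) ^~ i ^~ j : s t / s <= t}.
Proof.
move=> s t st; rewrite -lee_fin !(EFin_occ HP); apply: ge0_subset_integral => //.
- by apply/measurable_EFinP; exact: (measurable_ptrans HP).
- by move=> r _; rewrite lee_fin (ptrans_ge0 HP).
- by move=> r; rewrite /= !in_itv/= => /andP[->]; move/le_trans; apply.
Qed.

Let mY t : measurable_fun [set: Omega] (Y t). Proof. exact: (measurable_inv_sub HD). Qed.

Let mocc t i j : measurable_fun [set: Omega] (fun w => occ Pt (Y t w) i j).
Proof.
have h : measurable_fun [set: R] (fun u => occ Pt u i j).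
  by apply: nondecreasing_measurable => //; exact: occ_nd.
exact: (measurableT_comp h (mY t)).
Qed.

Let one01 (v : R) : 0 <= (fun=> 1 : R) v <= 1. Proof. by rewrite ler01 lexx. Qed.
Let mone : measurable_fun [set: R] (fun=> 1 : R). Proof. exact: measurable_cst. Qed.
Let ptrans01 i j (v : R) : 0 <= ptrans Pt i j v <= 1.
Proof. by rewrite (ptrans_ge0 HP) (ptrans_le1 HP). Qed.

(** Passes from sections of [subset_le] to integrals up to Y(t), path by path outside a null set. *)
Lemma expected_integral (t : R) (f : R -> R) (F : Omega -> R) : 0 <= t ->
  measurable_fun [set: R] f -> (forall v, 0 <= f v <= 1) ->
  measurable_fun [set: Omega] F ->
  (forall w, (F w)%:E = \int[lebesgue_measure]_(v in `[0%R, Y t w]) (f v)%:E)%E ->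
  (\int[P]_w (F w)%:E = (roc f t)%:E)%E.
Proof.
move=> t0 mf f01 mF FE; rewrite (EFin_roccup theta0 alpha01 HD mf f01).
have f0 v : 0 <= f v by case/andP: (f01 v).
apply: ge0_ae_eq_integral => //.
- exact/measurable_EFinP.
- exact: (measurable_subset_le_section HD t mf f0).
- by move=> w _; rewrite FE; apply: integral_ge0 => v _; rewrite lee_fin.
- by move=> w _; apply: integral_ge0 => v _; rewrite lee_fin mulr_ge0.
- apply: filterS (integral_subset_le theta0 alpha01 HD mf f0 t0) => w e _.
  by rewrite FE -e.
Qed.

Lemma expected_inv_sub (t : R) : 0 <= t -> (\int[P]_w (Y t w)%:E = (roc (fun=> 1%R) t)%:E)%E.
Proof.
move=> t0; apply: (expected_integral t0 mone one01 (mY t)) => w.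
rewrite integral_cst//= mul1e lebesgue_measure_itv/= lte_fin.
by have := inv_sub_ge0 D t w; rewrite le_eqVlt => /predU1P[<-|->]; rewrite ?ltxx// oppr0 adde0.
Qed.

Lemma expected_occ (t : R) i j : 0 <= t ->
  (\int[P]_w (occ Pt (Y t w) i j)%:E = (roc (ptrans Pt i j) t)%:E)%E.
Proof.
move=> t0; apply: (expected_integral t0 _ (ptrans01 i j) (mocc t i j)) => [|w].
  exact: (measurable_ptrans HP).
exact: (EFin_occ HP).
Qed.

Let mp j t : measurable_fun [set: Omega] (fun w => p j (Y t w)).
Proof.
have h : measurable_fun [set: R] (p j) by exact: (measurable_ptrans HP).
exact: (measurableT_comp h (mY t)).
Qed.

(* Summing (N - g j)^+ over [box k N] yields N - min(N, g), so that only finitely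
   many state probabilities are involved. *)
Lemma expected_min t N : 0 <= t ->
  (\int[P]_w ((minn N (g_k k (QY t w)))%:R : R)%:E =
   \int[P]_w (N%:R - tail_mean k Pt N (Y t w) e0)%:E)%E.
Proof.
move=> t0.
pose a (j : state) : R := (N - g_k k j)%N%:R.
(* The common value: the sum of indicators [S] and [tail_mean] at time Y(t) both integrate to [y],
   because [tempered_queue_prob] matches them state by state. *)
pose y := \sum_(j <- box k N) fine (P (QY t @^-1` [set j])) * a j.
have a0 j : 0 <= a j by [].
pose S w : R := \sum_(j <- box k N) \1_(QY t @^-1` [set j]) w * a j.
have Pfin j : P (QY t @^-1` [set j]) \is a fin_num.
  by rewrite fin_num_measure//; exact: measurable_tempered_queue.
have sum_integral (b : state -> Omega -> R) : (forall j, measurable_fun [set: Omega] (b j)) ->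
    (forall j w, 0 <= b j w) -> (forall j, \int[P]_w (b j w)%:E = P (QY t @^-1` [set j]))%E ->
    (\int[P]_w (\sum_(j <- box k N) b j w * a j)%:E = y%:E)%E.
  move=> mb b0 be.
  under eq_integral do rewrite -sumEFin.
  rewrite ge0_integral_sum//; last 2 first.
  - by move=> j; apply/measurable_EFinP; exact: measurable_funM.
  - by move=> j w _; rewrite lee_fin mulr_ge0.
  rewrite /y -sumEFin; apply: eq_bigr => j _.
  under eq_integral do rewrite EFinM.
  rewrite ge0_integralZr//; last 3 first.
  - exact/measurable_EFinP.
  - by move=> w _; rewrite lee_fin.
  - by rewrite lee_fin.
  by rewrite be EFinM fineK.
have ES : (\int[P]_w (S w)%:E = y%:E)%E.
  apply: sum_integral => // j; first by apply: measurable_indic; exact: measurable_tempered_queue.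
  by rewrite integral_indic ?setIT//; exact: measurable_tempered_queue.
have ET : (\int[P]_w (tail_mean k Pt N (Y t w) e0)%:E = y%:E)%E.
  rewrite -(sum_integral (fun j w => p j (Y t w))).
  - apply: eq_integral => w _; congr EFin; apply: eq_bigr => j _.
    by rewrite ptransE// inv_sub_ge0.
  - by move=> j; exact: mp.
  - by move=> j w; rewrite (ptrans_ge0 HP).
  - by move=> j; rewrite tempered_queue_prob.
have mS : measurable_fun [set: Omega] S.
  apply: measurable_sum => j; apply: measurable_funM => //.
  by apply: measurable_indic; exact: measurable_tempered_queue.
have mT : measurable_fun [set: Omega] (fun w => tail_mean k Pt N (Y t w) e0).
  rewrite (_ : (fun w => _) = fun w => \sum_(j <- box k N) p j (Y t w) * a j).
    by apply: measurable_sum => j; apply: measurable_funM => //; exact: mp.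
  apply/funext => w; apply: eq_bigr => j _.
  by rewrite ptransE// inv_sub_ge0.
have S0 w : 0 <= S w by apply: sumr_ge0 => j _; rewrite mulr_ge0.
have T0 w : 0 <= tail_mean k Pt N (Y t w) e0.
  by apply: sumr_ge0 => j _; rewrite mulr_ge0// (transition_ge0 HP)// inv_sub_ge0.
have iN : P.-integrable setT (EFin \o (fun=> N%:R)) by exact: finite_measure_integrable_cst.
transitivity (\int[P]_w ((EFin \o (fun=> N%:R : R)) w - (S w)%:E))%E; last first.
  rewrite integralB_EFin//; last exact: (ge0_integrable_fin mS S0 ES).
  rewrite ES -ET -integralB_EFin//; exact: (ge0_integrable_fin mT T0 ET).
apply: ae_eq_integral => //.
- by apply/measurable_EFinP; exact: (mQYfun t (fun j => (minn N (g_k k j))%:R)).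
- by apply: emeasurable_funB => //; exact/measurable_EFinP.
apply: filterS (tempered_queue_valid t) => w vw _ /=; rewrite -EFinB; congr EFin.
rewrite /S; have [xb|xb] := boolP (QY t w \in box k N).
  rewrite (bigD1_seq (QY t w)) ?box_uniq//= big1 ?addr0 => [|j jx]; last first.
    by rewrite indicE memNset ?mul0r// => /= e; rewrite e eqxx in jx.
  rewrite indicE mem_set// mul1r /a.
  move: xb; rewrite (mem_box k1 lam0 mu0) => /andP[_ gN].
  by rewrite natrB ?(ltnW gN)// opprB addrC subrK (minn_idPr (ltnW gN)).
rewrite big1_seq ?subr0 => [|j /andP[_ jb]]; last first.
  by rewrite indicE memNset ?mul0r// => /= e; rewrite e jb in xb.
move: xb; rewrite (mem_box k1 lam0 mu0) vw/= -leqNgt => gN.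
by rewrite (minn_idPl gN).
Qed.

Lemma cvg_integral_nd (f : nat -> Omega -> R) (F : Omega -> R) :
  (forall n, measurable_fun [set: Omega] (f n)) -> (forall w, 0 <= f 0%N w) ->
  (forall n w, f n w <= f n.+1 w) -> (forall w, f n w @[n --> \oo] --> F w) ->
  ((\int[P]_w (f n w)%:E) @[n --> \oo] --> \int[P]_w (F w)%:E)%E.
Proof.
move=> mf f0 fS fF.
have nd w : {homo f ^~ w : n m / (n <= m)%N >-> n <= m}.
  by apply/nondecreasing_seqP => n; exact: fS.
have -> : (\int[P]_w (F w)%:E = \int[P]_w (limn (fun n => (f n w)%:E)))%E.
  apply: eq_integral => w _; apply/esym/cvg_lim => //.
  by apply: cvg_EFin; [exact: nearW|exact: fF].
apply: cvg_monotone_convergence => //.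
- by move=> n; exact/measurable_EFinP.
- by move=> n w _; rewrite lee_fin (le_trans (f0 w))// nd.
- by move=> w _ n m nm; rewrite lee_fin nd.
Qed.

(** Monotone limits of both sides of [expected_min]: min(N, g) increases to g, and N - [tail_mean]
    increases to [mean_length] at the random time Y(t). *)
Lemma expected_length t : 0 <= t ->
  (\int[P]_w ((g_k k (QY t w))%:R : R)%:E = \int[P]_w (mean_length k lam mu Pt (Y t w) e0)%:E)%E.
Proof.
move=> t0.
have c1 : ((\int[P]_w ((minn N (g_k k (QY t w)))%:R : R)%:E) @[N --> \oo] -->
    \int[P]_w ((g_k k (QY t w))%:R : R)%:E)%E.
  apply: (cvg_integral_nd (f := fun N w => (minn N (g_k k (QY t w)))%:R)).
  - by move=> N; exact: (mQYfun t (fun j => (minn N (g_k k j))%:R)).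
  - by move=> w; rewrite min0n.
  - by move=> N w; rewrite ler_nat leq_min geq_minr andbT (leq_trans (geq_minl _ _)).
  - move=> w; apply: cvg_near_cst; near=> N.
    by congr (_%:R); apply/minn_idPr; near: N; exact: nbhs_infty_ge.
have c2 : ((\int[P]_w (N%:R - tail_mean k Pt N (Y t w) e0)%:E) @[N --> \oo] -->
    \int[P]_w (mean_length k lam mu Pt (Y t w) e0)%:E)%E.
  apply: (cvg_integral_nd (f := fun N w => N%:R - tail_mean k Pt N (Y t w) e0)).
  - move=> N; apply: measurable_funB => //.
    rewrite (_ : (fun w => _) = fun w => \sum_(j <- box k N) p j (Y t w) * (N - g_k k j)%N%:R).
      by apply: measurable_sum => j; apply: measurable_funM => //; exact: mp.
    apply/funext => w; apply: eq_bigr => j _.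
    by rewrite ptransE// inv_sub_ge0.
  - move=> w; rewrite sub0r oppr_ge0 /tail_mean big1_seq// => j /andP[_].
    by rewrite (mem_box k1 lam0 mu0) ltn0 andbF.
  - by move=> N w; apply: (tail_mean_nd k1 lam0 mu0 HP); exact: inv_sub_ge0.
  - by move=> w; apply: (cvg_tail_mean k1 lam0 mu0 HP) => //; exact: inv_sub_ge0.
move: c1; under eq_fun do rewrite expected_min//.
by move=> c1; exact: (cvg_unique _ c1 c2).
Unshelve. all: by end_near. Qed.

Local Notation c1 := (k%:R * (lam - mu)).
Local Notation c2 := (k%:R * mu).

(** [c1] may be negative, so the two terms are combined by integrability and not by nonnegativity.
    Finiteness of the mean comes out as well. *)
Lemma mean_num_roccup t : 0 <= t ->
  mean_num P k Q D t = (c1 * roc (fun=> 1) t + c2 * roc (p e0) t)%:E.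
Proof.
move=> t0; rewrite mean_numE expected_length//.
have eY := expected_inv_sub t0; have eo := expected_occ e0 e0 t0.
rewrite -(integral_lincomb c1 c2 measurableT _ _ eY eo).
- by apply: eq_integral => w _; congr EFin; rewrite /mean_length/= add0r.
- by apply: ge0_integrable_fin eY => // w; exact: inv_sub_ge0.
- by apply: ge0_integrable_fin eo => // w; exact: (occ_ge0 HP).
Qed.

Lemma mean_queue_roccup t : 0 <= t ->
  mean_queue P k Q D t = c1 * roc (fun=> 1) t + c2 * roc (p e0) t.
Proof. by move=> t0; rewrite /mean_queue L0_event_prob mean_num_roccup//= divr1. Qed.

Lemma mean_queue0 : mean_queue P k Q D 0 = 0.
Proof.
rewrite /mean_queue /mean_num integral0_eq ?mul0r// => w.
by rewrite /L0_event/= => ->.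
Qed.

(* The backward equation at the empty state, integrated in time. *)
Lemma ptrans_volterra (u : R) : 0 <= u ->
  p e0 u + lam * occ Pt u e0 e0 = 1 + lam * occ Pt u (1%N, k) e0.
Proof.
move=> u0; have := erlang_gen_occ HP e0 e0 u0.
rewrite /erlang_gen/= ?eqxx big_seq1/= ptransE// => e.
by rewrite -[Pt u e0 e0](subrK 1) -e; ring.
Qed.

(** [ptrans_volterra] at the random time Y(t), integrated over P; all terms are integrable, so the
    probability of the empty state can be isolated. *)
Lemma p0_roccup t : 0 <= t ->
  p0 P k Q D t = 1 + lam * (roc (ptrans Pt (1%N, k) e0) t - roc (p e0) t).
Proof.
move=> t0; rewrite /p0 L0_event_prob/= divr1 probability_zero.
have : (\int[P]_w (p e0 (Y t w))%:E \is a fin_num)%E.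
  by rewrite -tempered_queue_prob fin_num_measure//; exact: measurable_tempered_queue.
move=> /fineK/esym; set r := fine _ => er.
have e00 := expected_occ e0 e0 t0; have e1k := expected_occ (1%N, k) e0 t0.
have i1 : P.-integrable setT (EFin \o (fun=> 1 : R)) by exact: finite_measure_integrable_cst.
have e1 : (\int[P]_w ((fun=> 1 : R) w)%:E = 1%:E)%E by rewrite integral_cst//= mul1e probability_setT.
have io i j : P.-integrable setT (EFin \o (fun w => occ Pt (Y t w) i j)).
  by apply: ge0_integrable_fin (expected_occ i j t0) => // w; exact: (occ_ge0 HP).
have ip : P.-integrable setT (EFin \o (fun w => p e0 (Y t w))).
  by apply: ge0_integrable_fin er => [|w]; [exact: mp|exact: (ptrans_ge0 HP)].
have L1 := integral_lincomb 1 lam measurableT ip (io e0 e0) er e00.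
have L2 := integral_lincomb 1 lam measurableT i1 (io (1%N, k) e0) e1 e1k.
have h w : 1 * p e0 (Y t w) + lam * occ Pt (Y t w) e0 e0 =
    1 * 1 + lam * occ Pt (Y t w) (1%N, k) e0.
  by rewrite !mul1r (ptrans_volterra (inv_sub_ge0 D t w)).
have := etrans (esym L1) (etrans (eq_integral _ _ (fun w _ => congr1 EFin (h w))) L2).
move: (roc _ t) (roc _ t) => x y [] /eqP; rewrite !mul1r -[r + _ == _]subr_eq => /eqP <-.
by ring.
Qed.

Lemma rl_kernel_int_mean_queue (u : R) :
  rl_kernel_int alpha (fun s => expR (theta * s) * mean_queue P k Q D s) u =
  c1 * fine (frac_int P theta alpha D (fun=> 1) u) +
  c2 * fine (frac_int P theta alpha D (p e0) u).
Proof.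
rewrite /rl_kernel_int.
have mk (f : R -> R) : measurable_fun [set: R] f -> (forall v, 0 <= f v <= 1) ->
    measurable_fun `[0, u] (fun s => tilted P theta D f s * (u - s) `^ (- alpha)).
  move=> mf f01; apply: measurable_funTS; apply: measurable_funM.
    exact: (measurable_tilted theta0 alpha01 HD mf f01).
  have m := measurable_powR (R := R) (- alpha).
  by apply: (measurableT_comp m); apply: measurable_funB.
have ef (f : R -> R) : measurable_fun [set: R] f -> (forall v, 0 <= f v <= 1) ->
    (\int[lebesgue_measure]_(s in `[0%R, u]) (tilted P theta D f s * (u - s) `^ (- alpha))%:E =
     (fine (frac_int P theta alpha D f u))%:E)%E.
  by move=> mf f01; rewrite fineK// (frac_int_fin theta0 alpha01 HD mf f01).
have mf : measurable_fun [set: R] (p e0) by exact: (measurable_ptrans HP).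
have nn (f : R -> R) : (forall v, 0 <= f v <= 1) ->
    forall s, 0 <= tilted P theta D f s * (u - s) `^ (- alpha).
  by move=> f01 s; rewrite mulr_ge0 ?powR_ge0// (tilted_ge0 P theta D f01).
have iI (f : R -> R) : measurable_fun [set: R] f -> (forall v, 0 <= f v <= 1) ->
    lebesgue_measure.-integrable `[0, u]
      (EFin \o (fun s => tilted P theta D f s * (u - s) `^ (- alpha))).
  move=> mf' f01.
  apply: (@ge0_integrable_fin _ (measurableTypeR R) R lebesgue_measure `[0, u] _
    (fine (frac_int P theta alpha D f u))).
  - exact: mk.
  - exact: nn.
  - exact: ef.
have E := @integral_lincomb _ (measurableTypeR R) R lebesgue_measure `[0, u] _ _ c1 c2 _ _
  (measurable_itv `[0, u]) (iI _ mone one01) (iI _ mf (ptrans01 e0 e0))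
  (ef _ mone one01) (ef _ mf (ptrans01 e0 e0)).
move/(congr1 fine): E => /= <-; congr fine; apply: eq_integral => s.
rewrite inE/= in_itv/= => /andP[s0 _]; congr EFin.
by rewrite mean_queue_roccup// /tilted; ring.
Qed.

Let EFin_conv_occ i j u :
  conv (EFin \o ptrans Pt i j) (fun=> 1%E) u = (occ Pt u i j)%:E.
Proof. by rewrite (EFin_occ HP); apply: eq_integral => s _; rewrite mule1. Qed.

(** The case f = 1 takes l = 0; the case f = p_00 takes l = lam, b1 = p_00 and b2 = p_{(1,k),0};
    both have c0 = 1. Weighted by [c1] and [c2], the first leaves the constant [c1], and [p0_roccup]
    recognises the second as [c2] times [p0]. *)
Lemma is_derive_rl_kernel_int (t : R) : 0 < t ->
  is_derive t 1 (rl_kernel_int alpha (fun s => expR (theta * s) * mean_queue P k Q D s))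
    (Gamma_fn (1 - alpha) * (expR (theta * t) *
      (theta `^ alpha * mean_queue P k Q D t + c1 + c2 * p0 P k Q D t))).
Proof.
move=> t0.
have mpt i j : measurable_fun [set: R] (ptrans Pt i j) by exact: (measurable_ptrans HP).
have V1 (u : R) : 0 <= u -> ((1 : R)%:E + (0 : R)%:E * conv (EFin \o (fun=> 1%R : R)) (fun=> 1) u =
    1%:E + (0 : R)%:E * conv (EFin \o (fun=> 1%R : R)) (fun=> 1) u)%E by [].
have Vp (u : R) : 0 <= u -> ((p e0 u)%:E + lam%:E * conv (EFin \o p e0) (fun=> 1) u =
    1%:E + lam%:E * conv (EFin \o ptrans Pt (1%N, k) e0) (fun=> 1) u)%E.
  by move=> u0; rewrite !EFin_conv_occ -!EFinM -!EFinD ptrans_volterra.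
have d1 := is_derive_frac_int theta0 alpha01 HD mone mone mone one01 one01 one01 (lexx 0) ler01 V1 t0.
have d2 := is_derive_frac_int theta0 alpha01 HD (mpt e0 e0) (mpt e0 e0) (mpt (1%N, k) e0)
  (ptrans01 e0 e0) (ptrans01 e0 e0) (ptrans01 (1%N, k) e0) (ltW lam0) ler01 Vp t0.
have d3 := is_deriveD (is_deriveZ c1 d1) (is_deriveZ c2 d2).
apply: (is_derive_eq (near_eq_is_derive _ d3)).
  by near=> u; rewrite rl_kernel_int_mean_queue.
rewrite (mean_queue_roccup (ltW t0)) (p0_roccup (ltW t0)).
move: (roc (fun=> 1) t) (roc (p e0) t) (roc (ptrans Pt (1%N, k) e0) t) => x y z.
by move: (expR _) (theta `^ alpha) (Gamma_fn _) => e q G; rewrite /GRing.scale/=; ring.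
Unshelve. all: by end_near. Qed.

(** M(0) = 0 removes the Caputo correction, Gamma(1 - alpha) and e^{theta t} cancel, and theta^alpha
    M is exactly what the tempered derivative subtracts. *)
Lemma caputo_tempered_mean_queue (t : R) : 0 < t ->
  caputo_tempered theta alpha (mean_queue P k Q D) t = c2 * p0 P k Q D t + c1.
Proof.
move=> t0; rewrite /caputo_tempered mean_queue0 mul0r mul0r subr0.
rewrite /tempered_rl_deriv /rl_deriv derive1E.
have d1 := is_derive_rl_kernel_int t0; rewrite derive_val.
have /andP[a0 a1] := alpha01.
have G0 : Gamma_fn (1 - alpha) != 0 by rewrite gt_eqF// (Gamma_fn_gt0 alpha01).
move: (Gamma_fn _) G0 => G G0; rewrite mulKf// mulrA -expRD addNr expR0 mul1r.
by ring.
Qed.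

End tempered_queue.

Unset Implicit Arguments.

Theorem theorem4p1 (R : realType) (d : measure_display)
    (Omega : measurableType d) (P : probability Omega R)
    (k : nat) (lam mu theta alpha : R)
    (Q : R -> Omega -> state) (D : R -> Omega -> R) :
  (1 <= k)%N -> 0 < lam -> 0 < mu -> 0 < theta -> 0 < alpha < 1 ->
  erlang_queue P k lam mu Q ->
  tempered_subordinator P theta alpha D ->
  indep_processes P Q D ->
  let M := mean_queue P k Q D in
  (forall t, 0 <= t -> (mean_num P k Q D t < +oo)%E) /\
  M 0 = 0 /\
  (forall t, 0 < t ->
     derivable (rl_kernel_int alpha (fun s => expR (theta * s) * M s)) t 1 /\
     caputo_tempered theta alpha M t
       = k%:R * mu * p0 P k Q D t + k%:R * (lam - mu)).
Proof.
move=> k1 lam0 mu0 theta0 alpha01 [mQ rcQ [Pt [HP fddQ]]] HD Hind M; split.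
  move=> t t0.
  by rewrite (mean_num_roccup k1 lam0 mu0 theta0 alpha01 mQ rcQ HP fddQ HD Hind t0) ltry.
split; first exact: mean_queue0.
move=> t t0; split; last first.
  exact: (caputo_tempered_mean_queue k1 lam0 mu0 theta0 alpha01 mQ rcQ HP fddQ HD Hind t0).
by have [] := is_derive_rl_kernel_int k1 lam0 mu0 theta0 alpha01 mQ rcQ HP fddQ HD Hind t0.
Qed.
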